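(* Let $R$ be an associative ring with identity. The map $[C]\mapsto \overline{\mathcal{Y}_C}$, where $\overline{\mathcal{Y}_C}={}^{\perp}C\cap\mathrm{Cogen}^*(C)$, is a well-defined one-to-one correspondence (bijection) between (a) the equivalence classes, under the relation $\sim$, of finitely generated, product-complete, Wakamatsu cotilting right $R$-modules; and (b) the precovering $\overline{\text{resolving}}$ subcategories $\mathcal{C}$ of $\mathrm{Mod}\text{-}R$ that admit a finitely generated, product-complete Ext-injective $\overline{\text{cogenerator}}$ $C$ and that are maximal (with respect to inclusion) among the precovering $\overline{\text{resolving}}$ subcategories of $\mathrm{Mod}\text{-}R$ sharing the same Ext-injective $\overline{\text{cogenerator}}$ $C$.
   Context: Rings are associative with identity and modules are unitary. $\mathrm{Mod}\text{-}R$ is the category of all right $R$-modules. Subcategories are understood to be full and closed under isomorphism. $\mathrm{Add}(C)$ (resp. $\mathrm{Prod}(C)$) is the class of right $R$-modules isomorphic to a direct summand of a direct sum (resp. direct product) of copies of $C$. A module $C$ is product-complete if $\mathrm{Prod}(C)\subseteq\mathrm{Add}(C)$. $\mathrm{Cogen}^*(C)$ is the class of right $R$-modules $M$ for which there is an exact sequence $0\to M\xrightarrow{f^{-1}}C^0\xrightarrow{f^0}C^1\xrightarrow{f^1}\cdots$ with all $C^i\in\mathrm{Prod}(C)$ and $\mathrm{Ext}^1_R(\mathrm{Coker} f^i,C)=0$ for all $i\ge -1$. For a subcategory $\mathcal{D}$ of $\mathrm{Mod}\text{-}R$, $\mathrm{gen}^*(\mathcal{D})$ is the class of right $R$-modules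 $M$ for which there is an exact sequence $\cdots\to D_1\xrightarrow{f_1}D_0\xrightarrow{f_0}M\to0$ with all $D_i\in\mathcal{D}$ and $\mathrm{Ext}^1_R(X,\mathrm{Ker} f_i)=0$ for all $X\in\mathcal{D}$, $i\ge0$. ${}^{\perp}C=\{M:\mathrm{Ext}^i_R(M,C)=0\text{ for all }i\ge1\}$; for a class $\mathcal{C}$, $\mathcal{C}^{\perp}=\{M:\mathrm{Ext}^i_R(X,M)=0\text{ for all }X\in\mathcal{C},i\ge1\}$. A right $R$-module $C$ is Wakamatsu cotilting if $\mathrm{Ext}^i_R(C^I,C)=0$ for every set $I$ and all $i\ge1$, and there is an injective cogenerator $Q$ for $\mathrm{Mod}\text{-}R$ with $Q\in\mathrm{gen}^*(\mathrm{Prod}(C))$. Invertible bimodules: an $(S,S')$-bimodule $P$ is invertible if $P\otimes_{S'}-:S'\text{-Mod}\to S\text{-Mod}$ is an equivalence of categories. Relation $\sim$: for right $R$-modules $T,T'$ with $S=\mathrm{End}(T_R)$, $S'=\mathrm{End}(T'_R)$, $T\sim T'$ iff there are invertible bimodules ${}_SP_{S'}$ and ${}_{S'}Q_S$ with $T\cong P\otimes_{S'}T'$ and $T'\cong Q\otimes_S T$ as right $R$-modules. This is an equivalence relation; $[T]$ is the class of $T$. A subcategory $\mathcal{C}$ of $\mathrm{Mod}\text{-}R$ is $\overline{\text{resolving}}$ if it is closed under direct summands, extensions and kernels of epimorphisms and contains all projective right $R$-modules. It is precovering if every right $R$-module $M$ admits a homomorphism $\phi:C_M\to M$ with $C_M\in\mathcal{C}$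 such that $\mathrm{Hom}_R(X,C_M)\to\mathrm{Hom}_R(X,M)$ is surjective for all $X\in\mathcal{C}$. A module $C\in\mathcal{C}$ is an Ext-injective $\overline{\text{cogenerator}}$ for $\mathcal{C}$ if $C\in\mathcal{C}^{\perp}$ and for every $M\in\mathcal{C}$ there is an exact sequence $0\to M\to C'\to M'\to0$ with $C'\in\mathrm{Prod}(C)$ and $M'\in\mathcal{C}$. *)

(* Defs.v *)
From HB Require Import structures.
From mathcomp Require Import all_boot all_algebra.
From mathcomp Require Import generic_quotient ring_quotient.
From mathcomp Require Import boolp classical_sets functions cardinality.

Set Implicit Arguments.
Unset Strict Implicit.
Unset Printing Implicit Defensive.

Import GRing.Theory.

Local Open Scope ring_scope.
Local Open Scope classical_set_scope.

(* A right R-module is a left module over the converse ring R^c: the scalar   *)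
(* multiple r *: m stands for m r. Rings may be trivial (pzRingType), since   *)
(* End(T) is trivial when T = 0. Everything that does not mention             *)
(* endomorphism rings is developed for left modules over a ring A.            *)
Notation rmodType R := (lmodType R^c).

Section LinearMaps.
Variable A : pzRingType.
Implicit Types L M N : lmodType A.

Lemma linear_eqP M N (f g : {linear M -> N}) : f =1 g -> f = g.
Proof.
case: f g => f [[f1] [f2]] [g [[g1] [g2]]] /= /funext fg.
by subst g; congr GRing.Linear.Pack; congr GRing.Linear.Class;
  [congr (_ _); apply: Prop_irrelevance | congr (_ _); apply: Prop_irrelevance].
Qed.

Definition iso M N := exists f : {linear M -> N}, bijective f.

Definition exact L M N (f : {linear L -> M}) (g : {linear M -> N}) :=
  range f = [set y | g y = 0].

Definition short_exact L M N (f : {linear L -> M}) (g : {linear M -> N}) :=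
  [/\ injective f, exact f g & range g = setT].

Definition kerp M N (f : {linear M -> N}) : {pred M} := [pred x | f x == 0].

Lemma kerp_submod M N (f : {linear M -> N}) : submod_closed (kerp f).
Proof.
split=> [|a x y]; rewrite !inE ?linear0 // => /eqP fx /eqP fy.
by rewrite linearP fx fy scaler0 addr0.
Qed.

Definition imp M N (f : {linear M -> N}) : {pred N} :=
  [pred y | `[< exists x, f x = y >]].

Lemma imp_submod M N (f : {linear M -> N}) : submod_closed (imp f).
Proof.
split=> [|a x y]; rewrite !unfold_in /=.
  by apply/asboolP; exists 0; rewrite linear0.
move=> /asboolP[u <-] /asboolP[v <-]; apply/asboolP.
by exists (a *: u + v); rewrite linearP.
Qed.

HB.instance Definition _ M N (f : {linear M -> N}) :=
  GRing.isSubmodClosed.Build A M (kerp f) (kerp_submod f).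
HB.instance Definition _ M N (f : {linear M -> N}) :=
  GRing.isSubmodClosed.Build A N (imp f) (imp_submod f).

End LinearMaps.

Section Kernel.
Variables (A : pzRingType) (M N : lmodType A) (f : {linear M -> N}).

Definition ker := {x : M | x \in kerp f}.
HB.instance Definition _ := SubChoice.on ker.
HB.instance Definition _ := [SubChoice_isSubLmodule of ker by <:].

End Kernel.

Section Cokernel.
Variables (A : pzRingType) (M N : lmodType A) (f : {linear M -> N}).
Local Open Scope quotient_scope.

Definition coker := Quotient.quot (imp f).
HB.instance Definition _ := GRing.Zmodule.on coker.

Definition coker_pi (y : N) : coker := \pi_(Quotient.quot (imp f)) y.
Definition coker_scale (a : A) (q : coker) : coker := coker_pi (a *: repr q).

Lemma coker_pi_eq x y : (coker_pi x == coker_pi y) = (x - y \in imp f).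
Proof. by rewrite Quotient.idealrBE. Qed.

Lemma coker_piD x y : coker_pi (x + y) = coker_pi x + coker_pi y.
Proof. exact: raddfD. Qed.

Lemma coker_repr q : coker_pi (repr q) = q.
Proof. exact: reprK. Qed.

Lemma coker_piZ a y : coker_pi (a *: y) = coker_scale a (coker_pi y).
Proof.
apply/esym/eqP; rewrite coker_pi_eq -scalerBr; apply: rpredZ.
by rewrite -coker_pi_eq coker_repr.
Qed.

Lemma coker_scaleA a b q :
  coker_scale a (coker_scale b q) = coker_scale (a * b) q.
Proof. by rewrite -[q]coker_repr -!coker_piZ scalerA. Qed.
Lemma coker_scale1 : left_id 1 coker_scale.
Proof. by move=> q; rewrite -[q]coker_repr -coker_piZ scale1r. Qed.
Lemma coker_scaleDr : right_distributive coker_scale +%R.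
Proof.
move=> a p q; rewrite -[p]coker_repr -[q]coker_repr.
by rewrite -coker_piD -!coker_piZ -coker_piD scalerDr.
Qed.
Lemma coker_scaleDl q : {morph coker_scale^~ q : a b / a + b}.
Proof.
by move=> a b; rewrite -[q]coker_repr -!coker_piZ scalerDl coker_piD.
Qed.
HB.instance Definition _ := GRing.Zmodule_isLmodule.Build A coker
  coker_scaleA coker_scale1 coker_scaleDr coker_scaleDl.

End Cokernel.

(* The direct product of I copies of C is the function module I -> C; the     *)
(* direct sum is its submodule of finitely supported functions.               *)
Section DirectSum.
Variables (A : pzRingType) (I : Type) (C : lmodType A).

Definition dsump : {pred I -> C} :=
  [pred x | `[< finite_set [set i | x i <> 0] >]].

Lemma dsump_submod : submod_closed dsump.
Proof.
split=> [|a x y]; rewrite !unfold_in /=.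
  by apply/asboolP; rewrite (_ : mkset _ = set0) // -subset0 => i.
move=> /asboolP fx /asboolP fy; apply/asboolP.
have fU : finite_set ([set i | x i <> 0] `|` [set i | y i <> 0]).
  by rewrite finite_setU.
apply: sub_finite_set fU => i /= axy.
have [xi0|] := EM (x i = 0); last by left.
right=> yi0; apply: axy.
by rewrite addrfctE scalrfctE xi0 yi0 scaler0 addr0.
Qed.
HB.instance Definition _ :=
  GRing.isSubmodClosed.Build A (I -> C) dsump dsump_submod.

Definition dsum := {x : I -> C | x \in dsump}.
HB.instance Definition _ := SubChoice.on dsum.
HB.instance Definition _ := [SubChoice_isSubLmodule of dsum by <:].

End DirectSum.

(* Classes of modules. They are not rendered by set (lmodType A), which is    *)
(* universe-inconsistent: set.u0 is constrained below the level of lmodType.  *)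
Definition modclass (A : pzRingType) := lmodType A -> Prop.

Definition subclass (A : pzRingType) (D E : modclass A) :=
  forall M, D M -> E M.

Section ModuleClasses.
Variable A : pzRingType.
Implicit Types (C L M N P Q X : lmodType A) (D E : modclass A).

Definition summand M N := exists L, iso N (M * L)%type.

Definition Add C : modclass A :=
  fun M => exists I : Type, summand M (dsum I C).

Definition Prod C : modclass A :=
  fun M => exists I : Type, summand M (I -> C).

Definition product_complete C := subclass (Prod C) (Add C).

Definition finitely_generated M := exists n (g : 'I_n -> M),
  forall x, exists c : 'I_n -> A, x = \sum_i c i *: g i.

Definition projective P : Prop :=
  forall M N (g : {linear M -> N}) (h : {linear P -> N}), range g = setT ->
  exists k : {linear P -> M}, forall x, g (k x) = h x.

Definition injective_module Q :=
  forall M N (g : {linear M -> N}) (h : {linear M -> Q}), injective g ->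
  exists k : {linear N -> Q}, forall x, k (g x) = h x.

Definition cogenerator Q :=
  forall M, exists (I : Type) (f : {linear M -> (I -> Q)}), injective f.

Record projective_resolution M := ProjectiveResolution {
  pr_obj :> nat -> lmodType A;
  pr_d : forall n, {linear pr_obj n.+1 -> pr_obj n};
  pr_aug : {linear pr_obj 0 -> M};
  pr_projective : forall n, projective (pr_obj n);
  pr_aug_surj : range pr_aug = setT;
  pr_exact0 : exact (pr_d 0) pr_aug;
  pr_exact : forall n, exact (pr_d n.+1) (pr_d n)
}.

Definition cocycle M N (P : projective_resolution M) n :
    set {linear P n -> N} :=
  [set f | forall x, f (pr_d P n x) = 0].

Definition coboundary M N (P : projective_resolution M) n :
    set {linear P n -> N} :=
  match n with
  | 0 => [set f | forall x, f x = 0]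
  | m.+1 => [set f | exists g : {linear P m -> N},
                       forall x, f x = g (pr_d P m x)]
  end.

(* Ext^n(M, N) = H^n(Hom(P, N)) vanishes. Projective resolutions exist and    *)
(* the cohomology does not depend on P, so "for every P" is "for some P".     *)
Definition Ext_zero n M N := forall P : projective_resolution M,
  @cocycle M N P n `<=` @coboundary M N P n.

Definition lperp C : modclass A :=
  fun M => forall n, (1 <= n)%N -> Ext_zero n M C.

Definition rperp D : modclass A :=
  fun M => forall X n, D X -> (1 <= n)%N -> Ext_zero n X M.

Definition Cogen_star C : modclass A := fun M =>
  exists (C_ : nat -> lmodType A) (f_ : {linear M -> C_ 0%N})
         (f : forall i, {linear C_ i -> C_ i.+1}),
  [/\ [/\ injective f_, exact f_ (f 0%N) & forall i, exact (f i) (f i.+1)],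
      forall i, Prod C (C_ i),
      Ext_zero 1 (coker f_) C
    & forall i, Ext_zero 1 (coker (f i)) C].

Definition gen_star D : modclass A := fun M =>
  exists (D_ : nat -> lmodType A) (f0 : {linear D_ 0%N -> M})
         (f : forall i, {linear D_ i.+1 -> D_ i}),
  [/\ [/\ range f0 = setT, exact (f 0%N) f0 & forall i, exact (f i.+1) (f i)],
      forall i, D (D_ i),
      forall X, D X -> Ext_zero 1 X (ker f0)
    & forall X i, D X -> Ext_zero 1 X (ker (f i))].

Definition Wakamatsu_cotilting C :=
  (forall (I : Type) n, (1 <= n)%N -> Ext_zero n (I -> C) C) /\
  exists Q, [/\ injective_module Q, cogenerator Q & gen_star (Prod C) Q].

Definition Ybar C : modclass A := fun M => lperp C M /\ Cogen_star C M.

(* Subcategories are full, hence given by their class of objects. *)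
Definition subcategory D := forall M N, iso M N -> D M -> D N.

Definition resolving D :=
  [/\ forall M N, summand M N -> D N -> D M,
      forall L M N (f : {linear L -> M}) (g : {linear M -> N}),
        short_exact f g -> D L -> D N -> D M,
      forall L M N (f : {linear L -> M}) (g : {linear M -> N}),
        short_exact f g -> D M -> D N -> D L
    & forall P, projective P -> D P].

Definition precovering D :=
  forall M, exists2 C, D C & exists phi : {linear C -> M},
  forall X (h : {linear X -> M}), D X ->
  exists k : {linear X -> C}, forall x, phi (k x) = h x.

Definition Ext_injective_cogenerator D C :=
  [/\ D C, rperp D C
    & forall M, D M -> exists (C' M' : lmodType A) (f : {linear M -> C'})
                          (g : {linear C' -> M'}),
        [/\ short_exact f g, Prod C C' & D M']].

Definition precovering_resolving D :=
  [/\ subcategory D, precovering D & resolving D].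

End ModuleClasses.

Section EndomorphismRing.
Variables (A : pzRingType) (T : lmodType A).

Definition endo := {linear T -> T}.
HB.instance Definition _ := gen_eqMixin endo.
HB.instance Definition _ := gen_choiceMixin endo.

Implicit Types f g h : endo.

Definition endo0 : endo := \0.
Definition endo_opp f : endo := \- f.
Definition endo_add f g : endo := f \+ g.
Definition endo1 : endo := idfun.
Definition endo_mul f g : endo := f \o g.

Lemma endo_addA : associative endo_add.
Proof. by move=> f g h; apply: linear_eqP => x /=; rewrite addrA. Qed.
Lemma endo_addC : commutative endo_add.
Proof. by move=> f g; apply: linear_eqP => x /=; rewrite addrC. Qed.
Lemma endo_add0 : left_id endo0 endo_add.
Proof. by move=> f; apply: linear_eqP => x /=; rewrite add0r. Qed.
Lemma endo_addN : left_inverse endo0 endo_opp endo_add.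
Proof. by move=> f; apply: linear_eqP => x /=; rewrite addNr. Qed.
HB.instance Definition _ :=
  GRing.isZmodule.Build endo endo_addA endo_addC endo_add0 endo_addN.

Lemma endo_mulA : associative endo_mul.
Proof. by move=> f g h; apply: linear_eqP. Qed.
Lemma endo_mul1l : left_id endo1 endo_mul.
Proof. by move=> f; apply: linear_eqP. Qed.
Lemma endo_mul1r : right_id endo1 endo_mul.
Proof. by move=> f; apply: linear_eqP. Qed.
Lemma endo_mulDl : left_distributive endo_mul endo_add.
Proof. by move=> f g h; apply: linear_eqP. Qed.
Lemma endo_mulDr : right_distributive endo_mul endo_add.
Proof. by move=> f g h; apply: linear_eqP => x /=; rewrite linearD. Qed.
HB.instance Definition _ := GRing.Zmodule_isPzRing.Build endo
  endo_mulA endo_mul1l endo_mul1r endo_mulDl endo_mulDr.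

(* T with its left End(T)-module structure, f *: x = f x. *)
Definition endmod : Type := T.
HB.instance Definition _ := GRing.Zmodule.on endmod.

Definition endmod_scale (f : endo) (x : endmod) : endmod := f x.
Lemma endmod_scaleA f g x :
  endmod_scale f (endmod_scale g x) = endmod_scale (f * g) x.
Proof. by []. Qed.
Lemma endmod_scale1 : left_id 1 endmod_scale.
Proof. by []. Qed.
Lemma endmod_scaleDr : right_distributive endmod_scale +%R.
Proof. by move=> f x y; rewrite /endmod_scale linearD. Qed.
Lemma endmod_scaleDl x : {morph endmod_scale^~ x : f g / f + g}.
Proof. by []. Qed.
HB.instance Definition _ := GRing.Zmodule_isLmodule.Build endo endmod
  endmod_scaleA endmod_scale1 endmod_scaleDr endmod_scaleDl.

End EndomorphismRing.

Record bimodule (S S' : pzRingType) := Bimodule {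
  bimodule_left :> lmodType S;
  ract : bimodule_left -> S' -> bimodule_left;
  ractDl : forall p q s, ract (p + q) s = ract p s + ract q s;
  ractDr : forall p s t, ract p (s + t) = ract p s + ract p t;
  ract1 : forall p, ract p 1 = p;
  ractM : forall p s t, ract p (s * t) = ract (ract p s) t;
  ractZ : forall a p s, ract (a *: p) s = a *: ract p s
}.

(* P (x)_S' N as the quotient of the formal sums of pairs (p, n) that         *)
(* identifies two sums when every balanced biadditive map to an abelian group *)
(* takes the same value on them; this is the group with the universal         *)
(* property of the tensor product.                                            *)
Section Tensor.
Variables (S S' : pzRingType) (P : bimodule S S').
Local Open Scope quotient_scope.

Definition balanced (N : lmodType S') (G : zmodType) (b : P -> N -> G) :=
  [/\ forall p q n, b (p + q) n = b p n + b q n,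
      forall p m n, b p (m + n) = b p m + b p n
    & forall p s n, b (ract p s) n = b p (s *: n)].

Section Construction.
Variable N : lmodType S'.
Implicit Types x y z : seq (P * N).

Definition formal_sum (G : zmodType) (b : P -> N -> G) x :=
  \sum_(u <- x) b u.1 u.2.

Definition tensor_rel x y := `[< forall (G : zmodType) (b : P -> N -> G),
  balanced b -> formal_sum b x = formal_sum b y >].

Lemma tensor_rel_equiv : equiv_class_of tensor_rel.
Proof.
split=> [x|x y|y x z]; first by apply/asboolP.
  by apply/asboolP/asboolP => e G b bb; rewrite e.
by move=> /asboolP xy /asboolP yz; apply/asboolP => G b bb; rewrite xy ?yz.
Qed.
Canonical tensor_equiv := EquivRelPack tensor_rel_equiv.
Canonical tensor_encModRel := defaultEncModRel tensor_rel.

Definition tensor := {eq_quot tensor_rel}.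
HB.instance Definition _ : EqQuotient _ tensor_rel tensor :=
  EqQuotient.on tensor.
HB.instance Definition _ := Choice.on tensor.

Definition tclass x : tensor := \pi_tensor x.

Lemma tclassP x y :
  (forall (G : zmodType) (b : P -> N -> G), balanced b ->
     formal_sum b x = formal_sum b y) <-> tclass x = tclass y.
Proof.
split=> [h|/eqP]; first by apply/eqP; rewrite /tclass piE; apply/asboolP.
by rewrite /tclass piE => /asboolP.
Qed.

Lemma tclass_repr (t : tensor) : tclass (repr t) = t.
Proof. exact: reprK. Qed.

Lemma formal_sum_repr (G : zmodType) (b : P -> N -> G) x :
  balanced b -> formal_sum b (repr (tclass x)) = formal_sum b x.
Proof. by move: G b; apply/tclassP; rewrite tclass_repr. Qed.

Lemma formal_sum_cat (G : zmodType) (b : P -> N -> G) x y :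
  formal_sum b (x ++ y) = formal_sum b x + formal_sum b y.
Proof. exact: big_cat. Qed.

Definition tensor_add (t u : tensor) := tclass (repr t ++ repr u).
Definition tensor_opp (t : tensor) :=
  tclass [seq (- u.1, u.2) | u <- repr t].
Definition tensor0 := tclass [::].

Lemma formal_sum_opp (G : zmodType) (b : P -> N -> G) x :
  balanced b -> formal_sum b [seq (- u.1, u.2) | u <- x] = - formal_sum b x.
Proof.
move=> [bDl _ _]; rewrite /formal_sum big_map -sumrN; apply: eq_bigr => u _ /=.
have b0 : b 0 u.2 = 0 by apply: (addrI (b 0 u.2)); rewrite -bDl !addr0.
by apply: (addrI (b u.1 u.2)); rewrite -bDl !subrr.
Qed.

Lemma tensor_addA : associative tensor_add.
Proof.
move=> t u v; apply/tclassP => G b bb.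
by rewrite !(formal_sum_cat, formal_sum_repr) // addrA.
Qed.
Lemma tensor_addC : commutative tensor_add.
Proof.
by move=> t u; apply/tclassP => G b bb; rewrite !formal_sum_cat addrC.
Qed.
Lemma tensor_add0 : left_id tensor0 tensor_add.
Proof.
move=> t; rewrite -[RHS]tclass_repr; apply/tclassP => G b bb.
by rewrite formal_sum_cat formal_sum_repr // /formal_sum big_nil add0r.
Qed.
Lemma tensor_addN : left_inverse tensor0 tensor_opp tensor_add.
Proof.
move=> t; apply/tclassP => G b bb.
rewrite formal_sum_cat formal_sum_repr // formal_sum_opp // addNr.
by rewrite /formal_sum big_nil.
Qed.
HB.instance Definition _ := GRing.isZmodule.Build tensor
  tensor_addA tensor_addC tensor_add0 tensor_addN.

Definition tensor_scale (a : S) (t : tensor) :=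
  tclass [seq (a *: u.1, u.2) | u <- repr t].

Lemma formal_sum_scale (G : zmodType) (b : P -> N -> G) a x :
  formal_sum b [seq (a *: u.1, u.2) | u <- x]
  = formal_sum (fun p => b (a *: p)) x.
Proof. exact: big_map. Qed.

Lemma balanced_scale (G : zmodType) (b : P -> N -> G) a :
  balanced b -> balanced (fun p => b (a *: p)).
Proof.
by move=> [bDl bDr bM]; split=> *; rewrite ?scalerDr -?ractZ ?bDl ?bDr ?bM.
Qed.

Lemma tensor_scaleA a c t :
  tensor_scale a (tensor_scale c t) = tensor_scale (a * c) t.
Proof.
apply/tclassP => G b bb; rewrite !formal_sum_scale formal_sum_repr;
  last exact: balanced_scale.
by rewrite formal_sum_scale; apply: eq_bigr => u _; rewrite scalerA.
Qed.
Lemma tensor_scale1 : left_id 1 tensor_scale.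
Proof.
move=> t; rewrite -[RHS]tclass_repr; apply/tclassP => G b bb.
by rewrite formal_sum_scale; apply: eq_bigr => u _; rewrite scale1r.
Qed.
Lemma tensor_scaleDr : right_distributive tensor_scale +%R.
Proof.
move=> a t u; apply/tclassP => G b bb.
rewrite formal_sum_scale formal_sum_cat !formal_sum_repr ?formal_sum_scale //;
  last exact: balanced_scale.
exact: formal_sum_cat.
Qed.
Lemma tensor_scaleDl t : {morph tensor_scale^~ t : a c / a + c}.
Proof.
move=> a c; apply/tclassP => G b bb.
rewrite formal_sum_cat !formal_sum_repr // !formal_sum_scale -big_split /=.
by case: bb => bDl _ _; apply: eq_bigr => u _; rewrite scalerDl bDl.
Qed.
HB.instance Definition _ := GRing.Zmodule_isLmodule.Build S tensor
  tensor_scaleA tensor_scale1 tensor_scaleDr tensor_scaleDl.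

End Construction.

Section Functoriality.
Variables (M N : lmodType S') (f : {linear M -> N}).

Definition tensor_map (t : tensor M) : tensor N :=
  tclass [seq (u.1, f u.2) | u <- repr t].

Lemma formal_sum_map (G : zmodType) (b : P -> N -> G) x :
  formal_sum b [seq (u.1, f u.2) | u <- x]
  = formal_sum (fun p m => b p (f m)) x.
Proof. exact: big_map. Qed.

Lemma balanced_map (G : zmodType) (b : P -> N -> G) :
  balanced b -> balanced (fun p m => b p (f m)).
Proof.
by move=> [bDl bDr bM]; split=> *; rewrite ?linearD ?linearZ ?bDl ?bDr ?bM.
Qed.

Lemma tensor_map_linear : linear tensor_map.
Proof.
move=> a t u; apply/tclassP => G b bb.
rewrite formal_sum_map formal_sum_repr; last exact: balanced_map.
rewrite !formal_sum_cat !formal_sum_repr //; last exact: balanced_map.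
rewrite !formal_sum_scale !formal_sum_repr ?formal_sum_map //;
  exact: balanced_scale.
Qed.
HB.instance Definition _ :=
  GRing.isLinear.Build S (tensor M) (tensor N) *:%R tensor_map tensor_map_linear.

End Functoriality.
End Tensor.
Arguments tensor_map {S S'} P {M N} f t.

Record modfunctor (A B : pzRingType) := ModFunctor {
  fobj :> lmodType A -> lmodType B;
  fmap : forall M N : lmodType A, {linear M -> N} -> {linear fobj M -> fobj N};
  fmap_id : forall M : lmodType A, fmap (idfun : {linear M -> M}) =1 idfun;
  fmap_comp : forall (L M N : lmodType A) (g : {linear M -> N}) (f : {linear L -> M}),
    fmap (g \o f) =1 fmap g \o fmap f
}.
Arguments fmap {A B} m {M N} _.

Section IdFunctor.
Variable A : pzRingType.
Definition id_functor : modfunctor A A :=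
  @ModFunctor A A id (fun _ _ f => f) (fun _ _ => erefl)
    (fun _ _ _ _ _ _ => erefl).
End IdFunctor.

Section CompFunctor.
Variables (A B D : pzRingType) (G : modfunctor B D) (F : modfunctor A B).

Lemma comp_fmap_id (M : lmodType A) :
  fmap G (fmap F (idfun : {linear M -> M})) =1 idfun.
Proof.
move=> x; rewrite (linear_eqP (g := idfun) (@fmap_id _ _ F M)).
exact: fmap_id.
Qed.

Lemma comp_fmap_comp (L M N : lmodType A)
    (g : {linear M -> N}) (f : {linear L -> M}) :
  fmap G (fmap F (g \o f)) =1 fmap G (fmap F g) \o fmap G (fmap F f).
Proof.
move=> x; rewrite (linear_eqP (@fmap_comp _ _ F _ _ _ g f)).
exact: fmap_comp.
Qed.

Definition comp_functor : modfunctor A D :=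
  ModFunctor comp_fmap_id comp_fmap_comp.
End CompFunctor.

Definition naturally_isomorphic (A B : pzRingType) (F G : modfunctor A B) :=
  exists eta : forall M : lmodType A, {linear F M -> G M},
    (forall M, bijective (eta M)) /\
    (forall (M N : lmodType A) (f : {linear M -> N}) x,
       eta N (fmap F f x) = fmap G f (eta M x)).

Definition equivalence (A B : pzRingType) (F : modfunctor A B) :=
  exists G : modfunctor B A,
    naturally_isomorphic (comp_functor G F) (id_functor A) /\
    naturally_isomorphic (comp_functor F G) (id_functor B).

Section TensorFunctor.
Variables (S S' : pzRingType) (P : bimodule S S').

Lemma tensor_map_id (M : lmodType S') :
  tensor_map P (idfun : {linear M -> M}) =1 idfun.
Proof.
move=> t; rewrite -[RHS]tclass_repr; apply/tclassP => G b bb.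
exact: formal_sum_map.
Qed.

Lemma tensor_map_comp (L M N : lmodType S')
    (g : {linear M -> N}) (f : {linear L -> M}) :
  tensor_map P (g \o f) =1 tensor_map P g \o tensor_map P f.
Proof.
move=> t; apply/tclassP => G b bb.
rewrite !formal_sum_map formal_sum_repr; last exact: balanced_map.
by rewrite formal_sum_map.
Qed.

Definition tensor_functor : modfunctor S' S :=
  @ModFunctor S' S (fun N => tensor P N) (fun M N f => tensor_map P f)
    tensor_map_id tensor_map_comp.

Definition invertible := equivalence tensor_functor.

End TensorFunctor.

(* P (x)_End(T) T with the scalar action of A coming from T, that is          *)
(* r *: (p (x) t) = p (x) (r *: t).                                           *)
Section TensorEnd.
Variables (A S : pzRingType) (T : lmodType A) (P : bimodule S (endo T)).

Definition tensor_end : Type := tensor P (endmod T).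
HB.instance Definition _ := GRing.Zmodule.on tensor_end.

Implicit Types t : tensor_end.

Definition tensor_end_scale (r : A) t : tensor_end :=
  tclass [seq (u.1, (r *: (u.2 : T) : endmod T)) | u <- repr t].

Lemma formal_sum_end (G : zmodType) (b : P -> endmod T -> G) r
    (x : seq (P * endmod T)) :
  formal_sum b [seq (u.1, (r *: (u.2 : T) : endmod T)) | u <- x]
  = formal_sum (fun p (m : endmod T) => b p (r *: (m : T))) x.
Proof. exact: big_map. Qed.

Lemma balanced_end (G : zmodType) (b : P -> endmod T -> G) r :
  balanced b -> balanced (fun p (m : endmod T) => b p (r *: (m : T))).
Proof.
move=> [bDl bDr bM]; split=> [p q m|p m n|p s m]; first exact: bDl.
  by rewrite -bDr scalerDr.
rewrite bM; congr (b _ _).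
exact: (linearZZ (s : {linear T -> T}) r (m : T)).
Qed.

Lemma tensor_end_scaleA r s t :
  tensor_end_scale r (tensor_end_scale s t) = tensor_end_scale (r * s) t.
Proof.
apply/tclassP => G b bb; rewrite !formal_sum_end formal_sum_repr;
  last exact: balanced_end.
by rewrite formal_sum_end; apply: eq_bigr => u _; rewrite scalerA.
Qed.
Lemma tensor_end_scale1 : left_id 1 tensor_end_scale.
Proof.
move=> t; rewrite -[RHS]tclass_repr; apply/tclassP => G b bb.
by rewrite formal_sum_end; apply: eq_bigr => u _; rewrite scale1r.
Qed.
Lemma tensor_end_scaleDr : right_distributive tensor_end_scale +%R.
Proof.
move=> r t u; apply/tclassP => G b bb.
rewrite formal_sum_end formal_sum_cat !formal_sum_repr ?formal_sum_end //;
  last exact: balanced_end.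
exact: formal_sum_cat.
Qed.
Lemma tensor_end_scaleDl t : {morph tensor_end_scale^~ t : r s / r + s}.
Proof.
move=> r s; apply/tclassP => G b bb.
rewrite formal_sum_cat !formal_sum_repr // !formal_sum_end -big_split /=.
by case: bb => _ bDr _; apply: eq_bigr => u _; rewrite -bDr scalerDl.
Qed.
HB.instance Definition _ := GRing.Zmodule_isLmodule.Build A tensor_end
  tensor_end_scaleA tensor_end_scale1 tensor_end_scaleDr tensor_end_scaleDl.

End TensorEnd.

Definition wsim (A : pzRingType) (T T' : lmodType A) :=
  (exists P : bimodule (endo T) (endo T'),
     invertible P /\ iso T (tensor_end P)) /\
  (exists Q : bimodule (endo T') (endo T),
     invertible Q /\ iso T' (tensor_end Q)).

Definition wsim_class (A : pzRingType) (T : lmodType A) : modclass A :=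
  fun T' => wsim T T'.

Definition wcotilting_classes (A : pzRingType) (K : modclass A) :=
  exists C : lmodType A,
    [/\ finitely_generated C, product_complete C, Wakamatsu_cotilting C
      & K = wsim_class C].

Definition maximal_cogenerated (A : pzRingType) (D : modclass A) :=
  precovering_resolving D /\
  exists C : lmodType A,
    [/\ finitely_generated C, product_complete C,
        Ext_injective_cogenerator D C
      & forall E : modclass A, precovering_resolving E ->
          Ext_injective_cogenerator E C -> subclass D E -> D = E].

(* The predicate set_bij, for predicates on types that are too large for set. *)
Definition bijection_on (X Y : Type) (a : X -> Prop) (b : Y -> Prop)
    (F : X -> Y) :=
  [/\ forall x, a x -> b (F x),
      forall x y, a x -> a y -> F x = F y -> x = y
    & forall y, b y -> exists2 x, a x & F x = y].

(* Main.v *)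
Require Import Defs.
From HB Require Import structures.
From mathcomp Require Import all_boot all_algebra.
From mathcomp Require Import generic_quotient ring_quotient.
From mathcomp Require Import boolp classical_sets functions cardinality.

Set Implicit Arguments.
Unset Strict Implicit.
Unset Printing Implicit Defensive.

Import GRing.Theory.

Local Open Scope ring_scope.
Local Open Scope classical_set_scope.

(* For a module M let M' be the cokernel of the evaluation M -> C^Hom(M, C).  *)
(* When powers of C have no higher extensions by C, the class Ybar C consists *)
(* of the M with Ext^n(M, C) = 0 for all n >= 1 such that M, M', M'', ... are *)
(* cogenerated by C. A product-complete C satisfies the descending chain      *)
(* condition on subgroups of finite definition, by Chase's argument. Hence C  *)
(* is algebraically compact, direct sums of powers of C are in Prod(C), and   *)
(* Ybar C is closed under direct sums and under pure quotients. By an         *)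
(* argument of Bican and El Bashir a map M -> M0 factors through a pure       *)
(* quotient of M whose size is bounded in terms of M0, so Ybar C is           *)
(* precovering.                                                               *)
(*   If C is Wakamatsu cotilting, the Prod(C)-resolution of the cogenerator Q *)
(* shows that P, P', P'', ... are cogenerated by C for P projective, so that  *)
(* Ybar C is resolving; coresolutions show that it contains every class with  *)
(* Ext-injective cogenerator C. Conversely, in a precovering resolving class  *)
(* with Ext-injective cogenerator C, precovers extend to modules of Prod(C),  *)
(* and starting from an injective cogenerator this yields its resolution.     *)
(*   Finally C ~ D means that each of C and D is a direct summand of a finite *)
(* power of the other. If Ybar C = Ybar D, then C embeds into a module of     *)
(* Prod(D) with cokernel in Ybar D = Ybar C, and the embedding splits.        *)

(** The correspondence rests on three facts about a finitely generated product-complete C.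

    First, [wsim C D] is a statement about summands: each module is a direct summand of a finite
    power of the other ([wsimP]). One direction uses a dual basis of the invertible bimodule, the
    other the bimodules Hom(C, D) and Hom(D, C). Hence equivalent modules have the same Prod and the
    same Ybar ([wsim_Ybar]). Conversely, if Ybar C = Ybar D, then C is Ext-injective in Ybar D, so
    its embedding into a module of Prod(D) splits. Product-completeness replaces products by sums
    and finite generation makes the sum finite ([Ybar_finitely_retracts]).

    Second, a precovering resolving class with Ext-injective cogenerator C is contained in Ybar C
    ([class_sub_Ybar]), and its existence makes C Wakamatsu cotilting ([class_Wakamatsu]): precovers
    of an injective cogenerator and of the successive kernels extend to Prod(C).

    Third, if C is Wakamatsu cotilting, then Ybar C is itself such a class, so it is the largest one
    and every maximal class has this form. The closure properties come from the coinduction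
    principle [Ybar_coind], and projectives belong to Ybar C by [Ybar_projective]. The hard point is
    [Ybar_precovering]. The chain condition of [chase] makes C compact ([chain_condition_compact]).
    By [Ybar_hullP], membership in Ybar C is tested on the canonical modules [cohulls], and
    compactness carries this test to pure quotients ([Ybar_pure_quotient]) and direct sums
    ([fsum_Ybar]). Since maps factor through pure quotients of bounded size ([small_pure_quotient]),
    one direct sum over a set of modules is a precover. *)

Definition linear_of (A : pzRingType) (M N : lmodType A) (f : M -> N)
    (f_lin : linear f) : {linear M -> N} :=
  HB.pack f (GRing.isLinear.Build A M N *:%R f f_lin).

(** * Linear maps, kernels, cokernels and retracts *)

Section Maps.
Variable A : pzRingType.
Implicit Types L M N X K P Q : lmodType A.

Lemma short_exactP L M N (f : {linear L -> M}) (g : {linear M -> N}) :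
  short_exact f g <->
  [/\ injective f, forall x, g (f x) = 0,
      forall y, g y = 0 -> exists x, f x = y & forall z, exists y, g y = z].
Proof.
split=> [[fi ex gs]|[fi gf ex gs]]; split=> //.
- move=> x; have : range f (f x) by exists x.
  by rewrite ex.
- move=> y gy; have : [set y | g y = 0] y by [].
  by rewrite -ex => -[x _ <-]; exists x.
- move=> z; have : [set: N] z by [].
  by rewrite -gs => -[y _ <-]; exists y.
- apply/seteqP; split=> [y [x _ <-]|y gy] /=; first exact: gf.
  by have [x <-] := ex y gy; exists x.
- by apply/seteqP; split=> // z _; have [y <-] := gs z; exists y.
Qed.

Lemma linear_inj M N (f : {linear M -> N}) :
  (forall x, f x = 0 -> x = 0) -> injective f.
Proof.
move=> f0 x y fxy; apply/eqP; rewrite -subr_eq0; apply/eqP/f0.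
by rewrite linearB fxy subrr.
Qed.

Lemma lift_injective L M X (f : {linear L -> M}) (h : {linear X -> M}) :
  injective f -> (forall x, exists l, f l = h x) ->
  exists k : {linear X -> L}, forall x, f (k x) = h x.
Proof.
move=> fi /choice[k kE].
have kl : linear k by move=> a x y; apply: fi; rewrite linearP !kE linearP.
by exists (linear_of kl).
Qed.

Lemma factor_surjective M N X (g : {linear M -> N}) (h : {linear M -> X}) :
  (forall z, exists y, g y = z) -> (forall y, g y = 0 -> h y = 0) ->
  exists k : {linear N -> X}, forall y, k (g y) = h y.
Proof.
move=> /choice[s sE] gh.
have eqh y y' : g y = g y' -> h y = h y'.
  move=> e; apply/eqP; rewrite -subr_eq0 -linearB; apply/eqP/gh.
  by rewrite linearB e subrr.
have kl : linear (h \o s).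
  by move=> a x y /=; rewrite -linearP; apply: eqh; rewrite linearP !sE.
by exists (linear_of kl) => y /=; apply: eqh; rewrite sE.
Qed.

(** A direct summand without a named complement; such data compose, and [summandP] relates them to
    [summand]. *)
Definition retract M N :=
  exists (i : {linear M -> N}) (p : {linear N -> M}), forall x, p (i x) = x.

Lemma retract_refl M : retract M M.
Proof. by exists idfun, idfun. Qed.

Lemma retract_trans M N L : retract M N -> retract N L -> retract M L.
Proof.
move=> [i [p ip]] [j [q jq]].
by exists (j \o i), (p \o q) => x /=; rewrite jq ip.
Qed.

Lemma iso_sym M N : iso M N -> iso N M.
Proof.
move=> [f [g fg gf]].
have gl : linear g by move=> a x y; rewrite -{1}[x]gf -{1}[y]gf -linearP fg.
by exists (linear_of gl); exists f.
Qed.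

Lemma iso_retract M N : iso M N -> retract M N.
Proof.
move=> [f [g fg gf]].
have gl : linear g by move=> a x y; rewrite -{1}[x]gf -{1}[y]gf -linearP fg.
by exists f, (linear_of gl).
Qed.

Lemma kerpE M N (f : {linear M -> N}) x : (x \in kerp f) = (f x == 0).
Proof. by []. Qed.

Lemma impP M N (f : {linear M -> N}) y : y \in imp f <-> exists x, f x = y.
Proof. by rewrite unfold_in; split => /asboolP. Qed.

Lemma ker_val_linear M N (f : {linear M -> N}) : linear (val : ker f -> M).
Proof. by []. Qed.
Definition ker_incl M N (f : {linear M -> N}) : {linear ker f -> M} :=
  linear_of (@ker_val_linear M N f).

Lemma ker_incl_inj M N (f : {linear M -> N}) : injective (ker_incl f).
Proof. exact: val_inj. Qed.

Lemma ker_incl0 M N (f : {linear M -> N}) x : f (ker_incl f x) = 0.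
Proof. by apply/eqP; rewrite -kerpE; apply: valP. Qed.

Lemma ker_inclP M N (f : {linear M -> N}) y :
  f y = 0 -> exists x, ker_incl f x = y.
Proof. by move=> /eqP fy; exists (exist _ y fy). Qed.

Global Opaque ker_incl.

Lemma ker_short_exact M N (f : {linear M -> N}) :
  (forall z, exists y, f y = z) -> short_exact (ker_incl f) f.
Proof.
move=> fs; apply/short_exactP.
by split; [exact: ker_incl_inj|exact: ker_incl0|exact: ker_inclP|].
Qed.

Lemma coker_pi_linear M N (f : {linear M -> N}) : linear (@coker_pi A M N f).
Proof. by move=> a x y; rewrite coker_piD coker_piZ. Qed.
Definition coker_proj M N (f : {linear M -> N}) : {linear N -> coker f} :=
  linear_of (@coker_pi_linear M N f).

Lemma coker_proj_surj M N (f : {linear M -> N}) z :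
  exists y, coker_proj f y = z.
Proof. by exists (repr z); apply: coker_repr. Qed.

Lemma coker_proj0 M N (f : {linear M -> N}) y :
  coker_proj f y = 0 <-> exists x, f x = y.
Proof.
have e : (coker_proj f y == 0) = (y \in imp f).
  by rewrite -[y in RHS]subr0 -coker_pi_eq -[X in _ == X](linear0 (coker_proj f)).
split=> [/eqP|h]; first by rewrite e => /impP.
by apply/eqP; rewrite e; apply/impP.
Qed.

Global Opaque coker_proj.

Lemma coker_short_exact M N (f : {linear M -> N}) :
  injective f -> short_exact f (coker_proj f).
Proof.
move=> fi; apply/short_exactP; split=> //.
- by move=> x; apply/coker_proj0; exists x.
- by move=> y /coker_proj0.
- exact: coker_proj_surj.
Qed.

(** The complement is the kernel of the retraction. *)
Lemma summandP M N : summand M N <-> retract M N.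
Proof.
split=> [[L] /iso_sym[f [g fg gf]]|[i [p ip]]].
  have gl : linear g by move=> a x y; rewrite -{1}[x]gf -{1}[y]gf -linearP fg.
  have il : linear (fun x : M => (x, 0 : L)).
    by move=> a x y; congr pair; rewrite /= scaler0 addr0.
  exists (f \o linear_of il), (fst \o linear_of gl) => x /=.
  by rewrite fg.
exists (ker p).
have [q qE] : exists q : {linear N -> ker p},
    forall x, ker_incl p (q x) = (idfun \- (i \o p)) x.
  apply: lift_injective; first exact: ker_incl_inj.
  by move=> x; apply: ker_inclP; rewrite /= linearB ip subrr.
have hl : linear (fun x => (p x, q x)) by move=> a x y; rewrite !linearP.
exists (linear_of hl); exists (fun u => i u.1 + ker_incl p u.2).
  by move=> x /=; rewrite qE /= addrC subrK.
move=> [m k] /=; have pk := ker_incl0 k.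
rewrite linearD ip pk addr0; congr pair; apply: ker_incl_inj.
by rewrite qE /= linearD ip pk addr0 addrAC subrr add0r.
Qed.

Lemma short_exact_retract L M N (f : {linear L -> M}) (g : {linear M -> N}) :
  short_exact f g -> (exists r : {linear M -> L}, forall x, r (f x) = x) ->
  retract N M.
Proof.
move=> /short_exactP[fi gf ex gs] [r rf].
have [k kE] : exists k : {linear N -> M}, forall y, k (g y) = (idfun \- (f \o r)) y.
  apply: factor_surjective => // y /ex[x <-] /=.
  by rewrite rf subrr.
exists k, g => z; have [y <-] := gs z.
by rewrite kE /= linearB gf subr0.
Qed.

End Maps.

(** * Formal linear combinations and presented modules *)

Section Relations.
Variables (A : pzRingType) (T : Type).
Implicit Types (M N : lmodType A) (e : seq (A * T)).

(** A list e is a homogeneous linear form in unknowns from T, and v assigns values to the unknowns.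
    Relations, linear systems and presentations are all written this way. *)
Definition lcomb M e (v : T -> M) : M := \sum_(u <- e) u.1 *: v u.2.

Lemma lcomb_nil M (v : T -> M) : lcomb [::] v = 0.
Proof. exact: big_nil. Qed.

Lemma lcomb_cons M u e (v : T -> M) :
  lcomb (u :: e) v = u.1 *: v u.2 + lcomb e v.
Proof. exact: big_cons. Qed.

Lemma lcomb_cat M e e' (v : T -> M) :
  lcomb (e ++ e') v = lcomb e v + lcomb e' v.
Proof. exact: big_cat. Qed.

Lemma lcomb1 M a t (v : T -> M) : lcomb [:: (a, t)] v = a *: v t.
Proof. exact: big_seq1. Qed.

Lemma lcomb_linear M N (f : {linear M -> N}) e (v : T -> M) :
  lcomb e (f \o v) = f (lcomb e v).
Proof. by rewrite linear_sum; apply: eq_bigr => u _; rewrite linearZ. Qed.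

Lemma lcombD M e (v w : T -> M) :
  lcomb e (fun t => v t + w t) = lcomb e v + lcomb e w.
Proof. by rewrite -big_split; apply: eq_bigr => u _; rewrite scalerDr. Qed.

Lemma lcombN M e (v : T -> M) : lcomb e (fun t => - v t) = - lcomb e v.
Proof. by rewrite -sumrN; apply: eq_bigr => u _; rewrite scalerN. Qed.

Lemma lcombB M e (v w : T -> M) :
  lcomb e (fun t => v t - w t) = lcomb e v - lcomb e w.
Proof. by rewrite lcombD lcombN. Qed.

Lemma lcomb0 M e : lcomb e (fun=> 0 : M) = 0.
Proof. by apply: big1 => u _; rewrite scaler0. Qed.

Definition lscale (a : A) e := [seq (a * u.1, u.2) | u <- e].

Lemma lcomb_scale M a e (v : T -> M) : lcomb (lscale a e) v = a *: lcomb e v.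
Proof.
by rewrite /lcomb big_map scaler_sumr; apply: eq_bigr => u _; rewrite scalerA.
Qed.

Definition satisfies M (Rel : seq (A * T) -> Prop) (v : T -> M) :=
  forall e, Rel e -> lcomb e v = 0.

End Relations.

Lemma lcomb_map (A : pzRingType) (T U : Type) (M : lmodType A) (h : T -> U)
    e (v : U -> M) :
  lcomb [seq (u.1, h u.2) | u <- e] v = lcomb e (v \o h).
Proof. exact: big_map. Qed.

Lemma eq_lcomb (A : pzRingType) (T : Type) (M : lmodType A) e (v w : T -> M) :
  v =1 w -> lcomb e v = lcomb e w.
Proof. by move=> vw; apply: eq_bigr => u _; rewrite vw. Qed.

Lemma eq_in_lcomb (A : pzRingType) (T : eqType) (M : lmodType A) e (v w : T -> M) :
  (forall t, t \in [seq u.2 | u <- e] -> v t = w t) -> lcomb e v = lcomb e w.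
Proof.
move=> vw; rewrite /lcomb !big_seq; apply: eq_bigr => u ue.
by rewrite vw //; apply: map_f.
Qed.

(* As for tensor products, formal linear combinations are identified when no  *)
(* interpretation that satisfies the relations separates them.                *)
Section Presented.
Variables (A : pzRingType) (T : choiceType) (Rel : seq (A * T) -> Prop).
Local Open Scope quotient_scope.

Definition pres_rel (x y : seq (A * T)) := `[< forall (M : lmodType A) (v : T -> M),
  satisfies Rel v -> lcomb x v = lcomb y v >].

Lemma pres_rel_equiv : equiv_class_of pres_rel.
Proof.
split=> [x|x y|y x z]; first by apply/asboolP.
  by apply/asboolP/asboolP => e M v vR; rewrite e.
by move=> /asboolP xy /asboolP yz; apply/asboolP => M v vR; rewrite xy ?yz.
Qed.
Canonical pres_equiv := EquivRelPack pres_rel_equiv.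
Canonical pres_encModRel := defaultEncModRel pres_rel.

Definition pres := {eq_quot pres_rel}.
HB.instance Definition _ : EqQuotient _ pres_rel pres := EqQuotient.on pres.
HB.instance Definition _ := Choice.on pres.

Definition pclass x : pres := \pi_pres x.

Lemma pclassP x y :
  (forall (M : lmodType A) (v : T -> M), satisfies Rel v -> lcomb x v = lcomb y v)
  <-> pclass x = pclass y.
Proof.
split=> [h|/eqP]; first by apply/eqP; rewrite /pclass piE; apply/asboolP.
by rewrite /pclass piE => /asboolP.
Qed.

Lemma pclass_repr (p : pres) : pclass (repr p) = p.
Proof. exact: reprK. Qed.

Lemma lcomb_repr (M : lmodType A) (v : T -> M) x :
  satisfies Rel v -> lcomb (repr (pclass x)) v = lcomb x v.
Proof. by move: M v; apply/pclassP; rewrite pclass_repr. Qed.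

Definition pres_add (p q : pres) := pclass (repr p ++ repr q).
Definition pres_opp (p : pres) := pclass (lscale (-1) (repr p)).
Definition pres0 := pclass [::].
Definition pres_scale (a : A) (p : pres) := pclass (lscale a (repr p)).

Lemma pres_addA : associative pres_add.
Proof.
move=> p q r; apply/pclassP => M v vR.
by rewrite !(lcomb_cat, lcomb_repr) // addrA.
Qed.
Lemma pres_addC : commutative pres_add.
Proof. by move=> p q; apply/pclassP => M v vR; rewrite !lcomb_cat addrC. Qed.
Lemma pres_add0 : left_id pres0 pres_add.
Proof.
move=> p; rewrite -[RHS]pclass_repr; apply/pclassP => M v vR.
by rewrite lcomb_cat lcomb_repr // lcomb_nil add0r.
Qed.
Lemma pres_addN : left_inverse pres0 pres_opp pres_add.
Proof.
move=> p; apply/pclassP => M v vR.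
by rewrite lcomb_cat lcomb_repr // lcomb_scale scaleN1r addNr lcomb_nil.
Qed.
HB.instance Definition _ := GRing.isZmodule.Build pres
  pres_addA pres_addC pres_add0 pres_addN.

Lemma pres_scaleA a b p : pres_scale a (pres_scale b p) = pres_scale (a * b) p.
Proof.
by apply/pclassP => M v vR; rewrite !(lcomb_scale, lcomb_repr) // scalerA.
Qed.
Lemma pres_scale1 : left_id 1 pres_scale.
Proof.
move=> p; rewrite -[RHS]pclass_repr; apply/pclassP => M v vR.
by rewrite lcomb_scale scale1r.
Qed.
Lemma pres_scaleDr : right_distributive pres_scale +%R.
Proof.
move=> a p q; apply/pclassP => M v vR.
by rewrite !(lcomb_scale, lcomb_repr, lcomb_cat) // scalerDr.
Qed.
Lemma pres_scaleDl p : {morph pres_scale^~ p : a b / a + b}.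
Proof.
move=> a b; apply/pclassP => M v vR.
by rewrite !(lcomb_scale, lcomb_repr, lcomb_cat) // scalerDl.
Qed.
HB.instance Definition _ := GRing.Zmodule_isLmodule.Build A pres
  pres_scaleA pres_scale1 pres_scaleDr pres_scaleDl.

Definition pgen (t : T) : pres := pclass [:: (1, t)].

Lemma pres_lift (M : lmodType A) (v : T -> M) : satisfies Rel v ->
  exists k : {linear pres -> M}, forall t, k (pgen t) = v t.
Proof.
move=> vR; have kl : linear (fun p : pres => lcomb (repr p) v).
  by move=> a p q; rewrite !(lcomb_repr, lcomb_cat, lcomb_scale).
exists (linear_of kl) => t /=.
by rewrite lcomb_repr // lcomb1 scale1r.
Qed.

Lemma pclassE e : pclass e = lcomb e pgen.
Proof.
elim: e => [|[a t] e IHe]; first by rewrite lcomb_nil.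
rewrite lcomb_cons -IHe; apply/pclassP => M v vR /=.
by rewrite lcomb_cat !(lcomb_repr, lcomb_scale) // lcomb_cons lcomb1 scale1r.
Qed.

Lemma pres_span (p : pres) : exists e, p = lcomb e pgen.
Proof. by exists (repr p); rewrite -pclassE pclass_repr. Qed.

Lemma pgen_satisfies : satisfies Rel pgen.
Proof.
move=> e eR; rewrite -pclassE; apply/pclassP => M v vR.
by rewrite vR // lcomb_nil.
Qed.

Lemma pres_eq (M : lmodType A) (f g : {linear pres -> M}) :
  (forall t, f (pgen t) = g (pgen t)) -> f =1 g.
Proof.
move=> fg p; have [e ->] := pres_span p.
by rewrite -!lcomb_linear; apply: eq_lcomb => t /=.
Qed.

End Presented.

(** The presented module without relations; [{classic T}] supplies the choice structure that the
    quotient needs. *)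
Definition freemod (A : pzRingType) (T : Type) : lmodType A :=
  pres (fun _ : seq (A * {classic T}) => False).
Definition fgen (A : pzRingType) (T : Type) (t : T) : freemod A T :=
  pgen (fun _ : seq (A * {classic T}) => False) t.

Section Free.
Variable A : pzRingType.
Implicit Types M N P Q : lmodType A.

Lemma freemod_lift T M (v : T -> M) :
  exists k : {linear freemod A T -> M}, forall t, k (fgen A t) = v t.
Proof. exact: (@pres_lift A {classic T}). Qed.

Lemma freemod_span T (p : freemod A T) : exists e, p = lcomb e (@fgen A T).
Proof. exact: (@pres_span A {classic T}). Qed.

Lemma freemod_eq T M (f g : {linear freemod A T -> M}) :
  (forall t, f (fgen A t) = g (fgen A t)) -> f =1 g.
Proof. exact: (@pres_eq A {classic T}). Qed.

Lemma freemod_projective T : projective (freemod A T).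
Proof.
move=> M N g h gs; have gs' z : exists y, g y = z.
  by have : range g z := eq_ind_r (fun S => S z) I gs; case=> y _; exists y.
  have [s sE] := choice gs'.
have [k kE] := freemod_lift (fun t => s (h (fgen A t))).
by exists k; apply: (@freemod_eq _ _ (g \o k) h) => t /=; rewrite kE sE.
Qed.

Lemma projective_lift P M N (g : {linear M -> N}) (h : {linear P -> N}) :
  projective P -> (forall z, exists y, g y = z) ->
  exists k : {linear P -> M}, forall x, g (k x) = h x.
Proof.
move=> Pp gs; apply: Pp; apply/seteqP; split=> // z _.
by have [y <-] := gs z; exists y.
Qed.

Lemma freemod_cover M : exists p : {linear freemod A M -> M}, forall z, exists y, p y = z.
Proof.
have [p pE] := freemod_lift (id : M -> M).
by exists p => z; exists (fgen A z).
Qed.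

Lemma pair_linear M N Q (f : {linear Q -> M}) (g : {linear Q -> N}) :
  linear (fun x => (f x, g x)).
Proof. by move=> a x y; rewrite !linearP. Qed.
Definition lpair M N Q (f : {linear Q -> M}) (g : {linear Q -> N}) :
    {linear Q -> (M * N)%type} :=
  linear_of (pair_linear f g).

Lemma copair_linear M N Q (f : {linear M -> Q}) (g : {linear N -> Q}) :
  linear (fun x : M * N => f x.1 + g x.2).
Proof. by move=> a x y; rewrite !linearP /= scalerDr addrACA. Qed.
Definition lcopair M N Q (f : {linear M -> Q}) (g : {linear N -> Q}) :
    {linear (M * N)%type -> Q} :=
  linear_of (copair_linear f g).

Definition lzero M N : {linear M -> N} := \0.

Lemma projective_prod P Q : projective P -> projective Q -> projective (P * Q)%type.
Proof.
move=> Pp Qp M N g h gs.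
have [k kE] := Pp M N g (h \o lpair idfun (lzero P Q)) gs.
have [l lE] := Qp M N g (h \o lpair (lzero Q P) idfun) gs.
exists (lcopair k l) => -[x y] /=; rewrite linearD kE lE /= -linearD.
by congr (h _); congr pair; rewrite /= ?addr0 ?add0r.
Qed.

End Free.

(** * Vanishing of Ext *)

Section Ext.
Variable A : pzRingType.
Implicit Types C K L M N P Q X Y Z KL PL KN PN KM PM : lmodType A.

Lemma pullback X N M (g : {linear X -> M}) (h : {linear N -> M}) :
  exists Y (a : {linear Y -> X}) (b : {linear Y -> N}),
  [/\ forall y, g (a y) = h (b y),
      forall Z (u : {linear Z -> X}) (v : {linear Z -> N}),
        (forall z, g (u z) = h (v z)) ->
        exists w : {linear Z -> Y}, forall z, a (w z) = u z /\ b (w z) = v z,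
      forall x n, g x = h n -> exists y, a y = x /\ b y = n
    & forall y, a y = 0 -> b y = 0 -> y = 0].
Proof.
pose d : {linear (X * N)%type -> M} := lcopair g (\- h).
exists (ker d), (fst \o ker_incl d), (snd \o ker_incl d).
have dE x : d x = g x.1 - h x.2 by [].
split=> [y|Z u v uv|x n e|y].
- by apply/eqP; rewrite -subr_eq0 -dE ker_incl0.
- have [w wE] : exists w : {linear Z -> ker d}, forall z, ker_incl d (w z) = lpair u v z.
    apply: lift_injective; first exact: ker_incl_inj.
    by move=> z; apply: ker_inclP; rewrite dE /= uv subrr.
  by exists w => z; rewrite /= wE.
- have [y yE] : exists y, ker_incl d y = (x, n).
    by apply: ker_inclP; rewrite dE /= e subrr.
  by exists y; rewrite /= yE.
- move=> /= y1 y2; apply: (@ker_incl_inj _ _ _ d); rewrite linear0.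
  by rewrite [LHS]surjective_pairing y1 y2.
Qed.

Lemma pushout L M N (f : {linear L -> M}) (g : {linear L -> N}) :
  exists Y (a : {linear M -> Y}) (b : {linear N -> Y}),
  [/\ forall l, a (f l) = b (g l),
      forall y, exists m n, y = a m + b n
    & forall m n, a m + b n = 0 -> exists l, f l = m /\ g l = - n].
Proof.
pose d : {linear L -> (M * N)%type} := lpair f (\- g).
have dE l : d l = (f l, - g l) by [].
exists (coker d), (coker_proj d \o lpair idfun (lzero M N)),
  (coker_proj d \o lpair (lzero N M) idfun); split=> [l|y|m n] /=.
- apply/eqP; rewrite -subr_eq0 -linearB; apply/eqP/coker_proj0.
  by exists l; rewrite dE; congr pair; rewrite /= ?subr0 ?sub0r.
- have [[m n] <-] := coker_proj_surj y; exists m, n; rewrite -linearD.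
  by congr (coker_proj d _); congr pair; rewrite /= ?addr0 ?add0r.
- rewrite -linearD => /coker_proj0[l]; rewrite dE => -[fl gl].
  by exists l; rewrite fl -[g l]opprK gl /= addr0 add0r.
Qed.

Lemma pullback_short_exact K X M N (i : {linear K -> X}) (p : {linear X -> M})
    (h : {linear N -> M}) : short_exact i p ->
  exists (Y : lmodType A) (j : {linear K -> Y}) (q : {linear Y -> N}) (a : {linear Y -> X}),
  [/\ short_exact j q, forall x, a (j x) = i x, forall y, p (a y) = h (q y),
      forall Z (u : {linear Z -> X}) (v : {linear Z -> N}),
        (forall z, p (u z) = h (v z)) ->
        exists w : {linear Z -> Y}, forall z, a (w z) = u z /\ q (w z) = v z
    & forall y, a y = 0 -> q y = 0 -> y = 0].
Proof.
move=> /short_exactP[ii pi ex ps].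
have [Y [a [b [ab univ elt inj]]]] := pullback p h.
have [j jE] : exists j : {linear K -> Y}, forall z, a (j z) = i z /\ b (j z) = lzero K N z.
  by apply: univ => z; rewrite pi linear0.
exists Y, j, b, a; split=> // [|x]; last by have [] := jE x.
apply/short_exactP; split.
- apply: linear_inj => x jx; have [] := jE x; rewrite jx !linear0 => ix _.
  by apply: ii; rewrite linear0.
- by move=> x; have [] := jE x.
- move=> y by0; have /ex[x xE] : p (a y) = 0 by rewrite ab by0 linear0.
  exists x; apply/eqP; rewrite -subr_eq0; apply/eqP; have [ajx bjx] := jE x.
  by apply: inj; rewrite linearB ?ajx ?bjx ?xE ?by0 ?subrr.
- move=> n; have [x xE] := ps (h n).
  by have [y [_ yE]] := elt x n xE; exists y.
Qed.

Definition extends C L M (f : {linear L -> M}) :=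
  forall h : {linear L -> C}, exists k : {linear M -> C}, forall x, k (f x) = h x.

(* Ext^1(M, C) = 0, stated for every presentation of M instead of only for    *)
(* the projective ones.                                                       *)
Definition Ext1_zero C M := forall K X (i : {linear K -> X}) (p : {linear X -> M}),
  short_exact i p -> extends C i.

(** A projective P maps to the middle term of any other extension [X'] of M, which makes [X'] a
    quotient of [K' * P]. The extension of h is glued from h on [K'] and from a map on P that
    extends [h \o t]. *)
Lemma Ext1_zero_presentation C K P M (i : {linear K -> P}) (p : {linear P -> M}) :
  short_exact i p -> projective P -> extends C i -> Ext1_zero C M.
Proof.
move=> /short_exactP[ii pi ex ps] Pp iC K' X i' p' /short_exactP[ii' pi' ex' ps'] h.
have [s sE] := projective_lift p Pp ps'.
have [t tE] : exists t : {linear K -> K'}, forall x, i' (t x) = (s \o i) x.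
  apply: lift_injective => // x /=.
  by apply: ex'; rewrite sE pi.
have [k kE] := iC (h \o t).
have [l lE] : exists l : {linear X -> C},
    forall y, l (lcopair i' s y) = lcopair h k y.
  apply: factor_surjective => [x|[a b]] /=.
    have [b bE] := ps (p' x); have [a aE] : exists a, i' a = x - s b.
      by apply: ex'; rewrite linearB sE bE subrr.
    by exists (a, b); rewrite /= aE subrK.
  move=> e; have pb0 : p b = 0.
    by have := congr1 p' e; rewrite linear0 linearD pi' add0r sE.
  have [x xE] := ex b pb0.
  have aE : a = - t x.
    by apply: ii'; rewrite linearN tE /= xE; apply/eqP; rewrite -addr_eq0 e.
  by rewrite -xE kE aE linearN addNr.
by exists l => x; have := lE (x, 0); rewrite /= !linear0 !addr0.
Qed.

Lemma short_exact_trivial P : short_exact (ker_incl (idfun : {linear P -> P})) idfun.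
Proof. by apply: ker_short_exact => z; exists z. Qed.

Lemma ker_idfun_eq0 P (x : ker (idfun : {linear P -> P})) : x = 0.
Proof.
by apply: (@ker_incl_inj _ _ _ idfun); rewrite linear0; apply: (ker_incl0 x).
Qed.

Lemma Ext1_zero_projective C P : projective P -> Ext1_zero C P.
Proof.
move=> Pp; apply: (Ext1_zero_presentation (short_exact_trivial P)) => // h.
by exists (lzero P C) => x; rewrite [x]ker_idfun_eq0 !linear0.
Qed.

Lemma Ext1_zero_retract C M N : retract M N -> Ext1_zero C N -> Ext1_zero C M.
Proof.
move=> [s [r rs]] EN K X i p se h.
have [Y [j [q [a [se' aj pa univ inj]]]]] := pullback_short_exact r se.
have [k kE] := EN _ _ _ _ se' h.
have [w wE] := univ X idfun (s \o p) (fun z => esym (rs (p z))).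
exists (k \o w) => x /=; rewrite -kE; congr (k _).
have [_ qj _ _] := (short_exactP _ _).1 se'.
have [_ pi _ _] := (short_exactP _ _).1 se.
have [awx qwx] := wE (i x).
apply/eqP; rewrite -subr_eq0; apply/eqP/inj.
  by rewrite linearB awx aj /= subrr.
by rewrite linearB qwx qj /= pi linear0 subrr.
Qed.

Section ShortExact.
Variables (C L M N : lmodType A) (f : {linear L -> M}) (g : {linear M -> N}).
Hypothesis fg : short_exact f g.

(** The map h is extended in two stages: to the part Y of X that lies above L, and then from Y to X,
    where the quotient is N. *)
Lemma Ext1_zero_ext : Ext1_zero C L -> Ext1_zero C N -> Ext1_zero C M.
Proof.
move=> EL EN K X i p se h.
have [Y [j [q [a [se' aj pa univ inj]]]]] := pullback_short_exact f se.
have [k kE] := EL _ _ _ _ se' h.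
have [fi gf fex gs] := (short_exactP _ _).1 fg.
have [ii pi iex ps] := (short_exactP _ _).1 se.
have [_ _ _ qs] := (short_exactP _ _).1 se'.
have seY : short_exact a (g \o p).
  apply/short_exactP; split=> [|y|x /= gpx|n].
  - apply: linear_inj => y ay; apply: inj => //.
    by apply: fi; rewrite -pa ay !linear0.
  - by rewrite /= pa gf.
  - have [l lE] := fex _ gpx; have [y yE] := qs l.
    have : p (x - a y) = 0 by rewrite linearB pa yE lE subrr.
    move=> /iex[z zE]; exists (j z + y).
    by rewrite linearD aj zE subrK.
  - by have [m <-] := gs n; have [x <-] := ps m; exists x.
have [l lE] := EN _ _ _ _ seY k.
by exists l => x; rewrite -aj lE kE.
Qed.

(** After pulling the extension back along g, h extends to Y because M is orthogonal to C. The
    kernel of Y -> X is a copy w of L; the hypothesis on f provides a map on M that corrects the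
    extension there, so that it descends to X. *)
Lemma Ext1_zero_coker : Ext1_zero C M -> extends C f -> Ext1_zero C N.
Proof.
move=> EM fC K X i p se h.
have [Y [j [q [a [se' aj pa univ inj]]]]] := pullback_short_exact g se.
have [fi gf fex gs] := (short_exactP _ _).1 fg.
have [ii pi iex ps] := (short_exactP _ _).1 se.
have [_ qj _ qs] := (short_exactP _ _).1 se'.
have [k kE] := EM _ _ _ _ se' h.
have [w wE] : exists w : {linear L -> Y}, forall l, a (w l) = lzero L X l /\ q (w l) = f l.
  by apply: univ => l; rewrite gf linear0.
have [m mE] := fC (k \o w).
have [l lE] : exists l : {linear X -> C}, forall y, l (a y) = (k \- (m \o q)) y.
  apply: factor_surjective => [x|y ay0] /=.
    have [z zE] := gs (p x).
    have [y yE] := qs z; have : p (x - a y) = 0.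
      by rewrite linearB pa yE zE subrr.
    move=> /iex[t tE]; exists (j t + y).
    by rewrite linearD aj tE subrK.
  have : g (q y) = 0 by rewrite -pa ay0 linear0.
  move=> /fex[l lE]; have -> : y = w l.
    have [awl qwl] := wE l; apply/eqP; rewrite -subr_eq0; apply/eqP/inj.
      by rewrite linearB ay0 awl subrr.
    by rewrite linearB qwl lE subrr.
  by have [_ qwl] := wE l; rewrite qwl mE subrr.
by exists l => x; rewrite -aj lE /= qj linear0 subr0 kE.
Qed.

Lemma horseshoe (KL PL KN PN : lmodType A) (iL : {linear KL -> PL}) (pL : {linear PL -> L})
    (iN : {linear KN -> PN}) (pN : {linear PN -> N}) :
  short_exact iL pL -> short_exact iN pN -> projective PN ->
  exists K (i : {linear K -> (PL * PN)%type}) (p : {linear (PL * PN)%type -> M})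
    (f' : {linear KL -> K}) (g' : {linear K -> KN}),
  [/\ short_exact i p, short_exact f' g' & forall x, i (f' x) = (iL x, 0)].
Proof.
move=> seL seN PNp.
have [fi gf fex gs] := (short_exactP _ _).1 fg.
have [iLi pLi Lex pLs] := (short_exactP _ _).1 seL.
have [iNi pNi Nex pNs] := (short_exactP _ _).1 seN.
have [s sE] := projective_lift pN PNp gs.
pose p : {linear (PL * PN)%type -> M} := lcopair (f \o pL) s.
have pE x y : p (x, y) = f (pL x) + s y by [].
have gp u : g (p u) = pN u.2.
  by case: u => x y; rewrite pE linearD gf add0r sE.
have ps z : exists y, p y = z.
  have [y yE] := pNs (g z).
  have /fex[l lE] : g (z - s y) = 0 by rewrite linearB sE yE subrr.
  by have [x xE] := pLs l; exists (x, y); rewrite pE xE lE subrK.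
have [f' f'E] : exists f' : {linear KL -> ker p},
    forall x, ker_incl p (f' x) = lpair iL (lzero KL PN) x.
  apply: lift_injective; first exact: ker_incl_inj.
  by move=> x; apply: ker_inclP; rewrite pE pLi !linear0 addr0.
have [g' g'E] : exists g' : {linear ker p -> KN},
    forall x, iN (g' x) = (snd \o ker_incl p) x.
  by apply: lift_injective => // x; apply: Nex; rewrite -gp ker_incl0 linear0.
exists (ker p), (ker_incl p), p, f', g'; split=> //.
- exact: ker_short_exact.
- apply/short_exactP; split=> [|x|u gu|z].
  + apply: linear_inj => x fx; have := f'E x; rewrite fx linear0 => -[/esym ix].
    by apply: iLi; rewrite linear0.
  + by apply: iNi; rewrite g'E /= f'E linear0.
  + have u2 : (ker_incl p u).2 = 0 by rewrite -[LHS]g'E gu linear0.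
    have := ker_incl0 u; rewrite [ker_incl p u]surjective_pairing pE u2 linear0 addr0.
    move=> fp; have /Lex[x xE] : pL (ker_incl p u).1 = 0 by apply: fi; rewrite linear0.
    exists x; apply: (@ker_incl_inj _ _ _ p); rewrite f'E.
    by rewrite [RHS]surjective_pairing u2 -xE.
  + have /fex[l lE] : g (s (iN z)) = 0 by rewrite sE pNi.
    have [x xE] := pLs l.
    have /ker_inclP[u uE] : p (- x, iN z) = 0 by rewrite pE !linearN xE lE addNr.
    by exists u; apply: iNi; rewrite g'E /= uE.
Qed.

End ShortExact.

Lemma short_exact_prod (K L M K' L' M' : lmodType A) (i : {linear K -> L}) (p : {linear L -> M})
    (i' : {linear K' -> L'}) (p' : {linear L' -> M'}) :
  short_exact i p -> short_exact i' p' ->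
  exists (j : {linear (K * K')%type -> (L * L')%type})
    (q : {linear (L * L')%type -> (M * M')%type}), short_exact j q.
Proof.
move=> /short_exactP[ii pi iex ps] /short_exactP[ii' pi' iex' ps'].
exists (lpair (i \o fst) (i' \o snd)), (lpair (p \o fst) (p' \o snd)).
apply/short_exactP; split=> [[a b] [c d] /= [/ii -> /ii' ->]//|[a b]|[a b]|[a b]] /=.
- by rewrite pi pi'.
- by move=> [/iex[x <-] /iex'[y <-]]; exists (x, y).
- by have [x <-] := ps a; have [y <-] := ps' b; exists (x, y).
Qed.

Lemma retract_inl M N : retract M (M * N)%type.
Proof. by exists (lpair idfun (lzero M N)), fst. Qed.

(* [Ext_vanish C n M] says that Ext^(n+1)(M, C) = 0. *)
Fixpoint Ext_vanish C n M : Prop :=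
  if n is m.+1 then
    exists K P (i : {linear K -> P}) (p : {linear P -> M}),
      [/\ short_exact i p, projective P & Ext_vanish C m K]
  else Ext1_zero C M.

Lemma free_presentation M : exists K P (i : {linear K -> P}) (p : {linear P -> M}),
  short_exact i p /\ projective P.
Proof.
have [p ps] := freemod_cover M.
exists (ker p), (freemod A M), (ker_incl p), p; split; first exact: ker_short_exact.
exact: freemod_projective.
Qed.

Lemma Ext_vanish_projective C n P : projective P -> Ext_vanish C n P.
Proof.
elim: n P => [|n IHn] P Pp; first exact: Ext1_zero_projective.
exists (ker (idfun : {linear P -> P})), P, (ker_incl idfun), idfun; split=> //.
  exact: short_exact_trivial.
apply: IHn => M N g h _; exists (lzero _ M) => x.
by rewrite [x]ker_idfun_eq0 !linear0.
Qed.

Lemma Ext_vanish_ext C n L M N (f : {linear L -> M}) (g : {linear M -> N}) :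
  short_exact f g -> Ext_vanish C n L -> Ext_vanish C n N -> Ext_vanish C n M.
Proof.
elim: n L M N f g => [|n IHn] L M N f g fg; first exact: Ext1_zero_ext fg.
move=> [KL [PL [iL [pL [seL PLp EL]]]]] [KN [PN [iN [pN [seN PNp EN]]]]].
have [K [i [p [f' [g' [se se' _]]]]]] := horseshoe fg seL seN PNp.
exists K, (PL * PN)%type, i, p; split=> //; first exact: projective_prod.
exact: IHn se' EL EN.
Qed.

(** Y is the pullback of P and [P'] over M. The kernel of Y -> P is [K'], and [q \- (s \o a)] splits
    it off, for s : P -> [P'] over M. *)
Lemma schanuel (K P K' P' M : lmodType A) (i : {linear K -> P}) (p : {linear P -> M})
    (i' : {linear K' -> P'}) (p' : {linear P' -> M}) :
  short_exact i p -> short_exact i' p' -> projective P -> projective P' ->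
  exists Y (j : {linear K -> Y}) (q : {linear Y -> P'}),
    short_exact j q /\ retract K' Y.
Proof.
move=> se se' Pp P'p.
have [Y [j [q [a [seY aj pa univ inj]]]]] := pullback_short_exact p' se.
exists Y, j, q; split=> //.
have [ii pi iex ps] := (short_exactP _ _).1 se.
have [ii' pi' iex' ps'] := (short_exactP _ _).1 se'.
have [s sE] := projective_lift p Pp ps'.
have [r rE] : exists r : {linear Y -> K'}, forall y, i' (r y) = (q \- (s \o a)) y.
  by apply: lift_injective => // y; apply: iex'; rewrite /= linearB sE pa subrr.
have [u uE] : exists u : {linear K' -> Y}, forall z, a (u z) = lzero K' P z /\ q (u z) = i' z.
  by apply: univ => z; rewrite pi' linear0.
exists u, r => x; apply: ii'; have [au qu] := uE x.
by rewrite rE /= au qu linear0 subr0.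
Qed.

(** Independence of the presentation. The two claims are proved together: by Schanuel's lemma a
    syzygy is a retract of an extension of a projective by any other syzygy, and a retract M of N is
    treated one level up through the syzygies of N = M * L. *)
Lemma Ext_vanish_retract_syzygy C n :
  (forall M N, retract M N -> Ext_vanish C n N -> Ext_vanish C n M) /\
  (forall K P M (i : {linear K -> P}) (p : {linear P -> M}),
    short_exact i p -> projective P -> Ext_vanish C n.+1 M -> Ext_vanish C n K).
Proof.
have syz m : (forall M N, retract M N -> Ext_vanish C m N -> Ext_vanish C m M) ->
    forall K P M (i : {linear K -> P}) (p : {linear P -> M}),
    short_exact i p -> projective P -> Ext_vanish C m.+1 M -> Ext_vanish C m K.
  move=> ret K P M i p se Pp [K' [P' [i' [p' [se' P'p EK']]]]].
  have [Y [j [q [seY rY]]]] := schanuel se' se P'p Pp.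
  apply: ret rY _; apply: Ext_vanish_ext seY EK' _.
  exact: Ext_vanish_projective.
elim: n => [|n [IHr IHs]].
  have r0 M N : retract M N -> Ext_vanish C 0 N -> Ext_vanish C 0 M.
    exact: Ext1_zero_retract.
  by split=> //; apply: syz.
suff rS M N : retract M N -> Ext_vanish C n.+1 N -> Ext_vanish C n.+1 M.
  by split=> //; apply: syz.
move=> /summandP[L /iso_sym[g [h gh hg]]] EN.
have [KM [PM [iM [pM [seM PMp]]]]] := free_presentation M.
have [KL [PL [iL [pL [seL PLp]]]]] := free_presentation L.
have [j [q /short_exactP[ji qj jex qs]]] := short_exact_prod seM seL.
exists KM, PM, iM, pM; split=> //; apply: (IHr _ _ (retract_inl KM KL)).
apply: (IHs _ (PM * PL)%type N j (g \o q)) EN; last exact: projective_prod.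
apply/short_exactP; split=> // [x|y gqy|n1] /=.
- by rewrite qj linear0.
- by apply: jex; rewrite -[q y]gh -[g (q y)]/((g \o q) y) gqy -[0 in LHS](linear0 g) gh.
- by have [y yE] := qs (h n1); exists y; rewrite yE hg.
Qed.

Lemma Ext_vanish_retract C n M N :
  retract M N -> Ext_vanish C n N -> Ext_vanish C n M.
Proof. exact: (Ext_vanish_retract_syzygy C n).1. Qed.

Lemma Ext_vanish_syzygy C n K P M (i : {linear K -> P}) (p : {linear P -> M}) :
  short_exact i p -> projective P -> Ext_vanish C n.+1 M -> Ext_vanish C n K.
Proof. exact: (Ext_vanish_retract_syzygy C n).2. Qed.

Section ShortExactVanish.
Variable C : lmodType A.

(** This lemma and [Ext_vanish_coker] are the pieces Ext^(n+1)(M) -> Ext^(n+1)(L) -> Ext^(n+2)(N) ->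
    Ext^(n+2)(M) of the long exact sequence with coefficients in C, by dimension shifting along the
    horseshoe. *)
Lemma Ext_vanish_kernel n L M N (f : {linear L -> M}) (g : {linear M -> N}) :
  short_exact f g -> Ext_vanish C n M -> Ext_vanish C n.+1 N -> Ext_vanish C n L.
Proof.
elim: n L M N f g => [|n IHn] L M N f g fg EM EN.
  have [KL [PL [iL [pL [seL PLp]]]]] := free_presentation L.
  have [KN [PN [iN [pN [seN PNp]]]]] := free_presentation N.
  have [K [i [p [f' [g' [se se' if']]]]]] := horseshoe fg seL seN PNp.
  apply: (Ext1_zero_presentation seL) => // h.
  have [k kE] := (Ext_vanish_syzygy seN PNp EN : Ext1_zero C KN) _ _ _ _ se' h.
  have [l lE] := EM _ _ _ _ se k.
  by exists (l \o lpair idfun (lzero PL PN)) => x /=; rewrite -kE -lE if'.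
have [KL [PL [iL [pL [seL PLp]]]]] := free_presentation L.
have [KN [PN [iN [pN [seN PNp]]]]] := free_presentation N.
have [K [i [p [f' [g' [se se' _]]]]]] := horseshoe fg seL seN PNp.
exists KL, PL, iL, pL; split=> //; apply: IHn se' _ _.
  by apply: (Ext_vanish_syzygy se) => //; apply: projective_prod.
exact: (Ext_vanish_syzygy seN).
Qed.

Lemma Ext_vanish_coker n L M N (f : {linear L -> M}) (g : {linear M -> N}) :
  short_exact f g -> Ext_vanish C n.+1 M -> Ext_vanish C n L -> Ext_vanish C n.+1 N.
Proof.
elim: n L M N f g => [|n IHn] L M N f g fg EM EL.
  have [KL [PL [iL [pL [seL PLp]]]]] := free_presentation L.
  have [KN [PN [iN [pN [seN PNp]]]]] := free_presentation N.
  have [K [i [p [f' [g' [se se' if']]]]]] := horseshoe fg seL seN PNp.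
  exists KN, PN, iN, pN; split=> //=; apply: (Ext1_zero_coker se') => [|h].
    by apply: (Ext_vanish_syzygy se _ EM); apply: projective_prod.
  have [k kE] := EL _ _ _ _ seL h.
  by exists (k \o (fst \o i)) => x; rewrite /= if' kE.
have [KL [PL [iL [pL [seL PLp]]]]] := free_presentation L.
have [KN [PN [iN [pN [seN PNp]]]]] := free_presentation N.
have [K [i [p [f' [g' [se se' _]]]]]] := horseshoe fg seL seN PNp.
exists KN, PN, iN, pN; split=> //; apply: IHn se' _ _.
  by apply: (Ext_vanish_syzygy se) => //; apply: projective_prod.
exact: (Ext_vanish_syzygy seL).
Qed.

End ShortExactVanish.

Lemma surj_range X Y (f : {linear X -> Y}) :
  (forall z, exists y, f y = z) -> range f = setT.
Proof. by move=> fs; apply/seteqP; split=> // z _; have [y <-] := fs z; exists y. Qed.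

Lemma range_surj X Y (f : {linear X -> Y}) :
  range f = setT -> forall z, exists y, f y = z.
Proof.
move=> fs z; have : [set: Y] z by [].
by rewrite -fs => -[y _ <-]; exists y.
Qed.

Lemma exactP L M N (f : {linear L -> M}) (g : {linear M -> N}) :
  exact f g <-> (forall x, g (f x) = 0) /\ (forall y, g y = 0 -> exists x, f x = y).
Proof.
split=> [ex|[gf ex]].
  split=> [x|y gy].
    have : range f (f x) by exists x.
    by rewrite ex.
  have : [set y | g y = 0] y by [].
  by rewrite -ex => -[x _ <-]; exists x.
apply/seteqP; split=> [y [x _ <-]|y gy] /=; first exact: gf.
by have [x <-] := ex y gy; exists x.
Qed.

(** * Comparison with Ext computed from projective resolutions *)

Section Resolution.

Let eps M : {linear freemod A M -> M} := projT1 (cid (freemod_cover M)).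

Let eps_surj M z : exists y, eps M y = z.
Proof. exact: (projT2 (cid (freemod_cover M))). Qed.

Fixpoint syz M n : lmodType A := if n is m.+1 then ker (eps (syz M m)) else M.

Lemma free_resolution M : inhabited (projective_resolution M).
Proof.
split; apply: (@ProjectiveResolution A M (fun n => freemod A (syz M n))
  (fun n => ker_incl (eps (syz M n)) \o eps (syz M n.+1)) (eps M)).
- by move=> n; apply: freemod_projective.
- exact/surj_range/eps_surj.
- apply/exactP; split=> [x|y /ker_inclP[x <-]] /=; first exact: ker_incl0.
  by have [z <-] := eps_surj x; exists z.
- move=> n; apply/exactP; split=> [x|y] /=.
    by rewrite ker_incl0 linear0.
  rewrite -[0](linear0 (ker_incl (eps (syz M n)))) => /ker_incl_inj.
  move=> /ker_inclP[x <-]; have [z <-] := eps_surj x; by exists z.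
Qed.

Section Cons.
Variables (K P M : lmodType A) (i : {linear K -> P}) (p : {linear P -> M}).
Hypotheses (se : short_exact i p) (Pp : projective P).
Variable S : projective_resolution K.

Let obj n : lmodType A := if n is m.+1 then S m else P.
Let d n : {linear obj n.+1 -> obj n} :=
  match n with 0 => i \o pr_aug S | m.+1 => pr_d S m end.

Let obj_projective n : projective (obj n).
Proof. by case: n => //= m; apply: pr_projective. Qed.

Let exact0 : exact (d 0) p.
Proof.
have [ii pi ex ps] := (short_exactP _ _).1 se.
apply/exactP; split=> [x|y /ex[x <-]] /=; first exact: pi.
by have [z <-] := range_surj (pr_aug_surj S) x; exists z.
Qed.

Let exactS n : exact (d n.+1) (d n).
Proof.
case: n => [|n]; last exact: (pr_exact S n).
have [ii pi ex ps] := (short_exactP _ _).1 se.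
have [a0 a1] := (exactP _ _).1 (pr_exact0 S).
apply/exactP; split=> [x|y] /=; first by rewrite a0 linear0.
by rewrite -[0](linear0 i) => /ii/a1.
Qed.

Definition resolution_cons : projective_resolution M :=
  ProjectiveResolution obj_projective (let: And3 _ _ h := se in h)
    exact0 exactS.

End Cons.

Section Tail.
Variables (M : lmodType A) (S : projective_resolution M).

Let ex0 := (exactP _ _).1 (pr_exact0 S).
Let aug : {linear S 1 -> ker (pr_aug S)} := projT1 (cid (lift_injective
  (@ker_incl_inj _ _ _ (pr_aug S)) (fun x => ker_inclP (ex0.1 x)))).
Let augE x : ker_incl (pr_aug S) (aug x) = pr_d S 0 x.
Proof. exact: (projT2 (cid (lift_injective
  (@ker_incl_inj _ _ _ (pr_aug S)) (fun x => ker_inclP (ex0.1 x))))). Qed.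

Let aug_surj : range aug = setT.
Proof.
apply: surj_range => z; have [y yE] := ex0.2 _ (ker_incl0 z).
by exists y; apply: (@ker_incl_inj _ _ _ (pr_aug S)); rewrite augE.
Qed.

Let aug_exact : exact (pr_d S 1) aug.
Proof.
have [a0 a1] := (exactP _ _).1 (pr_exact S 0).
apply/exactP; split=> [x|y ay].
  by apply: (@ker_incl_inj _ _ _ (pr_aug S)); rewrite augE a0 linear0.
by apply: a1; rewrite -augE ay linear0.
Qed.

Definition resolution_tail : projective_resolution (ker (pr_aug S)) :=
  @ProjectiveResolution A _ (fun n => S n.+1) (fun n => pr_d S n.+1) aug
    (fun n => @pr_projective A M S n.+1) aug_surj aug_exact (fun n => @pr_exact A M S n.+1).

Lemma resolution_short_exact : short_exact (ker_incl (pr_aug S)) (pr_aug S).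
Proof. exact/ker_short_exact/range_surj/pr_aug_surj. Qed.

Lemma resolution_tail_augE x : ker_incl (pr_aug S) (pr_aug resolution_tail x) = pr_d S 0 x.
Proof. exact: augE. Qed.

End Tail.

(** Degree one is a direct comparison of extensions with cocycles. Higher degrees shift by
    [resolution_cons] and [resolution_tail], which add and remove the first term of a resolution. *)
Lemma Ext_zeroP n M C : Ext_zero n.+1 M C <-> Ext_vanish C n M.
Proof.
split; elim: n M => [|n IHn] M E.
- have [K [P [i [p [se Pp]]]]] := free_presentation M.
  apply: (Ext1_zero_presentation se) => // h.
  have [S] := free_resolution K.
  have [a0 a1] := (exactP _ _).1 (pr_exact0 S).
  have [g gE] : @coboundary A M C (resolution_cons se Pp S) 1 (h \o pr_aug S).
    by apply: E => x /=; rewrite a0 linear0.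
  by exists g => x; have [y <-] := range_surj (pr_aug_surj S) x; rewrite -[LHS]gE.
- have [K [P [i [p [se Pp]]]]] := free_presentation M.
  exists K, P, i, p; split=> //; apply: IHn => S f fc.
  exact: (E (resolution_cons se Pp S) f fc).
- move=> S f fc; have [h hE] : exists h : {linear ker (pr_aug S) -> C},
      forall x, h (pr_aug (resolution_tail S) x) = f x.
    apply: factor_surjective; first exact/range_surj/pr_aug_surj.
    move=> y ay; have [_ /(_ y ay)[x <-]] := (exactP _ _).1 (pr_exact0 (resolution_tail S)).
    exact: fc.
  have [k kE] := E _ _ _ _ (resolution_short_exact S) h.
  by exists k => x; rewrite -hE -kE resolution_tail_augE.
- move=> S f fc; apply: (IHn (ker (pr_aug S)) _ (resolution_tail S) f fc).
  exact: (Ext_vanish_syzygy (resolution_short_exact S) (@pr_projective A M S 0)).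
Qed.

End Resolution.

Lemma lperpP C M : lperp C M <-> forall n, Ext_vanish C n M.
Proof.
split=> [h n|h [//|n] _]; first exact/Ext_zeroP/h.
exact/Ext_zeroP.
Qed.

Lemma Ext1_zeroP C M : Ext_zero 1 M C <-> Ext1_zero C M.
Proof. exact: Ext_zeroP. Qed.

End Ext.

(** * Product-complete modules and the chain condition *)

(** The diagonal set consists of the x that are values of g at some set not containing x. *)
Lemma cantor_collision (X : Type) (g : (X -> bool) -> X) :
  exists c c' x, [/\ g c = g c', c x = true & c' x = false].
Proof.
pose c x := `[< exists c', g c' = x /\ c' x = false >].
case E: (c (g c)); last first.
  have : c (g c) by apply/asboolP; exists c.
  by rewrite E.
by move/asboolP: (E) => [c' [gc' c'x]]; exists c, c', (g c).
Qed.

Section DirectSumMaps.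
Variables (A : pzRingType) (I : Type) (C : lmodType A).

Lemma dsum_val_linear : linear (val : dsum I C -> (I -> C)).
Proof. by []. Qed.
Definition dsum_incl : {linear dsum I C -> (I -> C)} := linear_of dsum_val_linear.

Lemma dsum_incl_inj : injective dsum_incl.
Proof. exact: val_inj. Qed.

Lemma dsum_finite (x : dsum I C) : finite_set [set i | dsum_incl x i <> 0].
Proof. by have := valP x; rewrite unfold_in => /asboolP. Qed.

Lemma dsum_ex (x : I -> C) :
  finite_set [set i | x i <> 0] -> exists y, dsum_incl y = x.
Proof.
move=> fx; have px : x \in @dsump A I C by rewrite unfold_in; apply/asboolP.
by exists (exist _ x px).
Qed.

Lemma eval_linear (i : I) : linear (fun x : I -> C => x i).
Proof. by []. Qed.
Definition eval_at (i : I) : {linear (I -> C) -> C} := linear_of (eval_linear i).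

Lemma tuple_linear (M : lmodType A) (f : I -> {linear M -> C}) :
  linear (fun x i => f i x).
Proof. by move=> a x y; apply/funext => i; rewrite linearP. Qed.
Definition ltuple (M : lmodType A) (f : I -> {linear M -> C}) : {linear M -> (I -> C)} :=
  linear_of (tuple_linear f).

Lemma lcomb_fun T (e : seq (A * T)) (v : T -> I -> C) i :
  lcomb e v i = lcomb e (fun t => v t i).
Proof. by rewrite -[LHS]/(eval_at i _) -lcomb_linear. Qed.

End DirectSumMaps.
Arguments dsum_incl {A I C}.
Arguments eval_at {A I C} i.
Global Opaque dsum_incl.

Section Chase.
Variable A : pzRingType.
Implicit Types C M N : lmodType A.

(* Read off on the finite tuples xs, this is the descending chain condition   *)
(* on the subgroups of C^xs that are defined by solvability of homogeneous    *)
(* linear systems.                                                            *)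
Definition chain_condition C := forall (T : eqType) (xs : seq T)
    (Rel : nat -> seq (A * T) -> Prop), (forall n e, Rel n e -> Rel n.+1 e) ->
  exists n, forall w : T -> C, satisfies (Rel n) w ->
  exists2 w', satisfies (Rel n.+1) w' & {in xs, w' =1 w}.

Lemma prod_retract C (I : Type) : product_complete C ->
  exists J, retract (I -> C) (dsum J C).
Proof.
move=> pc; have [J /summandP r] := pc (I -> C) (ex_intro _ I (proj2 (summandP _ _) (retract_refl _))).
by exists J.
Qed.

Lemma satisfies_linear T (Rel : seq (A * T) -> Prop) M N (f : {linear M -> N}) v :
  satisfies Rel v -> satisfies Rel (f \o v).
Proof. by move=> vR e eR; rewrite lcomb_linear vR ?linear0. Qed.

Lemma satisfiesB T (Rel : seq (A * T) -> Prop) M (v w : T -> M) :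
  satisfies Rel v -> satisfies Rel w -> satisfies Rel (fun t => v t - w t).
Proof. by move=> vR wR e eR; rewrite lcombB vR ?wR ?subrr. Qed.

Lemma satisfies0 T (Rel : seq (A * T) -> Prop) M : satisfies Rel (fun=> 0 : M).
Proof. by move=> e _; apply: lcomb0. Qed.

(** Chase's argument. A failing chain gives solutions [w n] of the n-th system that no solution of
    the next system matches on xs. They are placed in different coordinates of one large power of C,
    and that power is a retract of a direct sum of copies of C. Finiteness of supports in the sum
    then produces a matching solution for some n. *)
Lemma chase C : product_complete C -> chain_condition C.
Proof.
move=> pc T xs Rel mono; apply: contrapT => noN.
have Rel_le n m e : (n <= m)%N -> Rel n e -> Rel m e.
  move=> /subnKC <-; elim: (m - n)%N => [|k IHk]; first by rewrite addn0.
  by move=> /IHk; rewrite addnS; apply: mono.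
pose agrees n (v : T -> C) := exists2 w', satisfies (Rel n.+1) w' & {in xs, w' =1 v}.
have /choice[w wP] : forall n, exists w : T -> C,
    satisfies (Rel n) w /\ ~ agrees n w.
  move=> n; apply: contrapT => nw; case: noN; exists n => v vR.
  by apply: contrapT => nv; case: nw; exists v.
have agreesB n v v' : agrees n v -> agrees n v' -> agrees n (fun t => v t - v' t).
  move=> [u uR uv] [u' uR' uv']; exists (fun t => u t - u' t); first exact: satisfiesB.
  by move=> t tx; rewrite uv ?uv'.
(* The factor [seq C] is there for Cantor's argument: finitely many coordinates of finitely many
   elements form a list in C, and [seq C] has more subsets c than elements. *)
pose I := (nat * seq C)%type.
have [J [iota [pi piK]]] := prod_retract I pc.
pose z (n : nat) (c : seq C -> bool) t : I -> C :=
  fun u => if (u.1 == n) && c u.2 then w n t else 0.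
pose co j : {linear (I -> C) -> C} := eval_at j \o dsum_incl \o iota.
pose supp n c := [set j | exists2 t, t \in xs & co j (z n c t) <> 0].
have fin_supp (h : T -> (I -> C)) : finite_set [set j | exists2 t, t \in xs & co j (h t) <> 0].
  have -> : [set j | exists2 t, t \in xs & co j (h t) <> 0] =
      \bigcup_(t in [set` xs]) [set j | co j (h t) <> 0].
    by apply/seteqP; split=> j [t tx jt]; exists t.
  by apply: bigcup_finite => [|t _]; [exact: finite_seq|exact: dsum_finite].
(* For some n, the obstruction to matching [z n c] is confined to one finite set of coordinates,
   uniformly in c. Otherwise bad pairs [c n], [j n] can be chosen recursively, with [j n] outside
   the supports of all earlier choices. *)
have [n [F [Ffin nF]]] : exists n (F : set J), finite_set F /\
    forall c j, ~ F j -> agrees n (fun t => co j (z n c t)).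
  apply: contrapT => K.
  have K' n (F : set J) : finite_set F ->
      exists c j, ~ F j /\ ~ agrees n (fun t => co j (z n c t)).
    move=> Ff; apply: contrapT => nF; case: K; exists n, F; split=> // c j Fj.
    by apply: contrapT => nag; case: nF; exists c, j.
  have /choice[s sP] : forall p : nat * set J, exists s : (seq C -> bool) * J,
      finite_set p.2 -> ~ p.2 s.2 /\ ~ agrees p.1 (fun t => co s.2 (z p.1 s.1 t)).
    move=> [n F]; have [Ff|nFf] := EM (finite_set F).
      by have [c [j cj]] := K' n F Ff; exists (c, j).
    by have [c [j _]] := K' 0%N set0 (@finite_set0 _); exists (c, j).
  pose F := fix F n := if n is m.+1 then F m `|` supp m (s (m, F m)).1 else set0.
  pose c n := (s (n, F n)).1; pose j n := (s (n, F n)).2.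
  have Ff n : finite_set (F n).
    elim: n => [|n IHn] /=; first exact: finite_set0.
    by rewrite finite_setU; split=> //; apply: fin_supp.
  have jF n : ~ F n (j n) by have [] := sP (n, F n) (Ff n).
  have jag n : ~ agrees n (fun t => co (j n) (z n (c n) t)) by have [] := sP (n, F n) (Ff n).
  (* [Z] glues all the chosen elements. At coordinate [j n] the part [Lo] vanishes and [Hi] solves
     the next system, so a zero of [Z] there would make the n-th choice match. Hence [Z] has
     infinitely many nonzero coordinates in a direct sum. *)
  pose Z t : I -> C := fun u => if c u.1 u.2 then w u.1 t else 0.
  pose Lo n t : I -> C := fun u => if (u.1 < n)%N && c u.1 u.2 then w u.1 t else 0.
  pose Hi n t : I -> C := fun u => if (n < u.1)%N && c u.1 u.2 then w u.1 t else 0.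
  have LoS n t : Lo n.+1 t = Lo n t + z n (c n) t.
    apply/funext => -[m q]; rewrite /Lo /z addrfctE /= ltnS leq_eqVlt.
    case: eqVneq => [->|_]; first by rewrite ltnn add0r.
    by rewrite addr0.
  have Lo0 n : {in xs, forall t k, ~ F n k -> co k (Lo n t) = 0}.
    elim: n => [|n IHn] t tx k Fk; first exact: (linear0 (co k)).
    rewrite LoS linearD IHn ?add0r //; last by move=> Fnk; apply: Fk; left.
    by apply: contrapT => ne; apply: Fk; right; exists t.
  have ZE n t : Z t = Lo n t + z n (c n) t + Hi n t.
    apply/funext => -[m q]; rewrite -LoS /Z /Lo /Hi addrfctE /= ltnS.
    by case: leqP => _; rewrite ?addr0 ?add0r.
  have HiR n : satisfies (Rel n.+1) (Hi n).
    move=> e eR; apply/funext => -[m q]; rewrite lcomb_fun /Hi /=.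
    case: ltnP => /= nm; last exact: lcomb0.
    by case: (c m q); [apply: (wP m).1; apply: Rel_le eR|exact: lcomb0].
  have jZ n : exists2 t, t \in xs & co (j n) (Z t) <> 0.
    apply: contrapT => nZ; apply: (jag n).
    exists (fun t => 0 - co (j n) (Hi n t)).
      by apply: satisfiesB; [exact: satisfies0|exact: satisfies_linear (HiR n)].
    move=> t tx; apply/eqP; rewrite sub0r eq_sym -addr_eq0 -linearD.
    rewrite -[X in X == 0]add0r -[X in X + _](Lo0 n t tx (j n)) // -linearD addrA -ZE.
    by apply/eqP; apply: contrapT => ne; apply: nZ; exists t.
  have F_le n m : (n <= m)%N -> F n `<=` F m.
    move=> /subnKC <-; elim: (m - n)%N => [|k IHk] //; rewrite ?addn0 // addnS /=.
    by move=> x Fx; left; apply: IHk.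
  have jFS n : F n.+1 (j n).
    right; apply: contrapT => nj; apply: (jag n).
    exists (fun=> 0); first exact: satisfies0.
    by move=> t tx; apply/esym; apply: contrapT => ne; apply: nj; exists t.
  have jinj : injective j.
    move=> n m; wlog nm : n m / (n <= m)%N.
      by move=> W e; case: (leqP n m) => [/W->//|/ltnW/W->].
    move: nm; rewrite leq_eqVlt => /orP[/eqP//|nm] e.
    by case: (jF m); rewrite -e; apply: (F_le n.+1).
  have : finite_set (j @^-1` [set k | exists2 t, t \in xs & co k (Z t) <> 0]).
    by apply: finite_preimage (fin_supp Z) => ? ? _ _; apply: jinj.
  suff -> : j @^-1` [set k | exists2 t, t \in xs & co k (Z t) <> 0] = setT.
    exact: infinite_nat.
  by apply/seteqP; split=> // m _; apply: jZ.
have [s Fs] : exists s : seq {classic J}, F = [set` s] by apply/finite_seqP.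
pose ps := [seq (u, t) | u <- s, t <- xs].
(* Two subsets with the same F-coordinates: their difference v vanishes on F, is matched off F, and
   equals [w n] at the coordinate (n, x). *)
have [c [c' [x [gcc' cx c'x]]]] := cantor_collision
  (fun c => [seq co (p.1 : J) (z n c p.2) | p <- ps]).
have {}gcc' : {in ps, forall p, co (p.1 : J) (z n c p.2) = co (p.1 : J) (z n c' p.2)}.
  by apply/eq_in_map.
pose v t := z n c t - z n c' t.
have vs t k : t \in xs -> F k -> co k (v t) = 0.
  move=> tx Fk; rewrite linearB; apply/eqP; rewrite subr_eq0; apply/eqP.
  have ks : (k : {classic J}) \in s by move: Fk; rewrite Fs.
  by apply: (gcc' (k : {classic J}, t)); apply/allpairsP; exists (k : {classic J}, t).
have vag : forall k, ~ F k -> agrees n (fun t => co k (v t)).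
  move=> k Fk; have [u uR uE] := agreesB _ _ _ (nF c k Fk) (nF c' k Fk).
  by exists u => // t tx; rewrite uE // linearB.
(* The coordinatewise solutions are taken to be 0 wherever v vanishes on xs, so that together they
   lie in the direct sum. *)
have /choice[u uP] : forall k, exists u : T -> C, [/\ satisfies (Rel n.+1) u,
    {in xs, forall t, u t = co k (v t)} &
    (forall t, t \in xs -> co k (v t) = 0) -> forall t, u t = 0].
  move=> k; have [v0|v0] := EM (forall t, t \in xs -> co k (v t) = 0).
    exists (fun=> 0); split=> // [|t tx]; first exact: satisfies0.
    by rewrite v0.
  have Fk : ~ F k by move=> Fk; apply: v0 => t tx; apply: vs.
  by have [u uR uE] := vag k Fk; exists u; split.
have /choice[U UE] : forall t, exists U : dsum J C, dsum_incl U = u^~ t.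
  move=> t; apply: dsum_ex; apply: sub_finite_set (fin_supp v) => k /= ukt.
  apply: contrapT => nk; apply: ukt; have [_ _] := uP k; apply=> t' t'x.
  by apply: contrapT => ne; apply: nk; exists t'.
have UR : satisfies (Rel n.+1) U.
  move=> e eR; apply: dsum_incl_inj; rewrite linear0 -lcomb_linear; apply/funext => k.
  rewrite lcomb_fun /= (@eq_lcomb _ _ _ _ _ (u k)) => [|t]; last by rewrite /= UE.
  by have [uR _ _] := uP k; apply: uR.
have Uv t : t \in xs -> U t = iota (v t).
  move=> tx; apply: dsum_incl_inj; rewrite UE; apply/funext => k.
  by have [_ uE _] := uP k; rewrite uE.
have [wR nag] := wP n; apply: nag.
exists (fun t => pi (U t) (n, x)).
  move=> e eR; rewrite -[LHS]/(lcomb e ((eval_at (n, x) \o pi) \o U)) lcomb_linear.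
  by rewrite (UR e eR) linear0.
move=> t tx; rewrite Uv // piK /v /z /= -[LHS]/(_ - _) /= eqxx cx c'x /=.
by rewrite subr0.
Qed.

End Chase.

(** * Algebraic compactness and purity *)

Section Compactness.
Variable A : pzRingType.
Implicit Types C L M N X : lmodType A.

(** Among the traces on xs of the solution sets of base together with a finite part of Rel there is
    a smallest one; otherwise finite parts could be enlarged forever, against the chain
    condition. *)
Lemma chain_condition_min X : chain_condition X ->
  forall (T : eqType) (xs : seq T) (base Rel : seq (A * T) -> Prop),
  exists R : seq (seq (A * T)), (forall e, e \in R -> Rel e) /\
  forall R' : seq (seq (A * T)), (forall e, e \in R' -> Rel e) ->
  forall w : T -> X, satisfies (fun e => base e \/ e \in R) w ->
  exists2 w', satisfies (fun e => base e \/ e \in R') w' & {in xs, w' =1 w}.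
Proof.
move=> cc T xs base Rel; apply: contrapT => noR.
pose ok (R : seq (seq (A * T))) := forall e, e \in R -> Rel e.
pose bad (R R' : seq (seq (A * T))) := exists w : T -> X,
  satisfies (fun e => base e \/ e \in R) w /\
  ~ exists2 w', satisfies (fun e => base e \/ e \in R') w' & {in xs, w' =1 w}.
have /choice[s sP] : forall R, exists R', ok R -> ok R' /\ bad R R'.
  move=> R; have [Rok|nRok] := EM (ok R); last by exists [::].
  apply: contrapT => nR'; apply: noR; exists R; split=> // R' R'ok w wR.
  by apply: contrapT => nw; apply: nR'; exists R' => _; split=> //; exists w.
pose R := fix R n := if n is m.+1 then R m ++ s (R m) else [::].
have Rok n : ok (R n).
  elim: n => [|n IHn] e //=; rewrite mem_cat => /orP[/IHn//|].
  by have [sok _] := sP _ IHn; apply: sok.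
have [n nP] := cc T xs (fun n e => base e \/ e \in R n) (fun n e => ltac:(by
  move=> [be|eR]; [left|right; rewrite /= mem_cat eR])).
have [_ [w [wR nw]]] := sP _ (Rok n).
have [w' w'R w'w] := nP w wR; apply: nw; exists w' => // e [be|eR].
  by apply: w'R; left.
by apply: w'R; right; rewrite /= mem_cat eR orbT.
Qed.

(* Algebraic compactness of X, for homogeneous systems with part of the       *)
(* unknowns prescribed.                                                       *)
Definition compact X := forall (T : eqType) (Rel : seq (A * T) -> Prop)
    (D : T -> Prop) (v : T -> X),
  (forall R : seq (seq (A * T)), (forall e, e \in R -> Rel e) ->
     exists w : T -> X, (forall e, e \in R -> lcomb e w = 0) /\
                        forall t, D t -> w t = v t) ->
  exists w : T -> X, satisfies Rel w /\ forall t, D t -> w t = v t.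

(** Zorn's lemma for partial assignments G under which, together with the prescribed values [G0],
    every finite part of Rel stays solvable. A maximal one is total because of
    [chain_condition_min]. *)
Lemma chain_condition_compact X : chain_condition X -> compact X.
Proof.
move=> cc T Rel D v fin.
pose G0 : set (T * X) := [set p | D p.1 /\ p.2 = v p.1].
pose P (G : set (T * X)) := forall R : seq (seq (A * T)), (forall e, e \in R -> Rel e) ->
  exists w : T -> X, (forall e, e \in R -> lcomb e w = 0) /\
                     forall t c, (G `|` G0) (t, c) -> w t = c.
have P0 : P set0.
  move=> R Rok; have [w [wR wD]] := fin R Rok; exists w; split=> // t c [//|[/= Dt ->]].
  exact: wD.
have [G [PG Gmax]] : exists G, P G /\ forall B, G `<` B -> ~ P B.
  apply: Zorn_bigcup => F FP Ftot.
  have [[G1 FG1]|F0] := EM (exists G, F G); last first.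
    move=> R Rok; have [w [wR wG]] := P0 R Rok; exists w; split=> // t c [[B FB _]|g0].
      by case: F0; exists B.
    by apply: wG; right.
  pose U := \bigcup_(G in F) G `|` G0.
  have Ufun t c c' : U (t, c) -> U (t, c') -> c = c'.
    have one B : F B -> (B `|` G0) (t, c) -> (B `|` G0) (t, c') -> c = c'.
      move=> FB Bc Bc'; have [w [_ wB]] := FP B FB [::] (fun e => ltac:(by [])).
      by rewrite -(wB _ _ Bc) (wB _ _ Bc').
    move=> [[B FB Bt]|g] [[B' FB' B't]|g'].
    - have [BB'|B'B] := Ftot _ _ FB FB'.
        by apply: (one B') => //; left=> //; apply: BB'.
      by apply: (one B) => //; left=> //; apply: B'B.
    - by apply: (one B) => //; [left|right].
    - by apply: (one B') => //; [right|left].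
    - by apply: (one G1) => //; right.
  (* A finite part involves finitely many unknowns, so a single member of the chain prescribes all
     those among them that the union prescribes. *)
  have big (ts : seq T) : exists2 B, F B &
      forall t c, t \in ts -> (\bigcup_(G in F) G) (t, c) -> B (t, c).
    elim: ts => [|t ts [B FB BP]]; first by exists G1.
    have [[c [B' FB' B't]]|nt] := EM (exists c, (\bigcup_(G in F) G) (t, c)); last first.
      exists B => // t' c; rewrite inE => /orP[/eqP->|/BP]; last exact.
      by move=> tc; case: nt; exists c.
    have [B2 [FB2 BB2 B'B2]] : exists B2, [/\ F B2, B `<=` B2 & B' `<=` B2].
      by have [BB'|B'B] := Ftot _ _ FB FB'; [exists B'; split|exists B; split].
    exists B2 => // t' c'; rewrite inE => /orP[/eqP-> tc|t'ts tc].
      have -> : c' = c by apply: (Ufun t); left=> //; exists B'.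
      exact: B'B2.
    by apply/BB2/BP.
  move=> R Rok; have [B FB BP] := big [seq u.2 | u <- flatten R].
  have [w [wR wB]] := FP B FB R Rok.
  have /choice[w' w'P] : forall t, exists x : X,
      (forall c, U (t, c) -> x = c) /\ ((forall c, ~ U (t, c)) -> x = w t).
    move=> t.
    have [[c Uc]|nU] := EM (exists c, U (t, c)).
      exists c; split=> [c' Uc'|nU]; [exact: Ufun Uc Uc'|by case: (nU c)].
    by exists (w t); split=> // c Uc; case: nU; exists c.
  exists w'; split=> [e eR|t c Utc]; last by have [w'U _] := w'P t; apply: w'U.
  rewrite -(wR e eR); apply: eq_in_lcomb => t te.
  have [w'U w'N] := w'P t; have [[c Uc]|nU] := EM (exists c, U (t, c)); last first.
    by apply: w'N => c Uc; apply: nU; exists c.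
  rewrite (w'U c Uc); apply/esym/wB; case: Uc => [tc|]; [left|by right].
  apply: BP tc; have /mapP[u ue ->] := te; apply: map_f.
  by apply/flattenP; exists e.
pose V := G `|` G0.
have Vtot t : exists c, V (t, c).
  apply: contrapT => nt.
  (* [base] sets the already assigned unknowns to 0. For the finite part R with the smallest trace
     on t, the value at t of any solution w of R can be kept: the difference from a solution [w1] of
     [R ++ R'] solves base and R, so some d solving base and [R'] has the same value at t, and
     [w1 + d] works for [R']. *)
  pose base e := exists2 s : T, (exists c, V (s, c)) & e = [:: (1 : A, s)].
  have [R [Rok RP]] := chain_condition_min cc [:: t] base Rel.
  have [w [wR wG]] := PG R Rok.
  apply: (Gmax (G `|` [set (t, w t)])).
    split=> [|GG]; first by move=> p Gp; left.
    by apply: nt; exists (w t); left; apply: GG; right.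
  move=> R' R'ok.
  have [w1 [w1R w1G]] := PG (R ++ R') (fun e => ltac:(by
    rewrite mem_cat => /orP[/Rok|/R'ok])).
  have [d dR dt] := RP R' R'ok (fun s => w s - w1 s) (fun e => ltac:(
    move=> [[s [c Vc] ->]|eR]; rewrite ?lcomb1 ?lcombB ?(wG s c Vc) ?(w1G s c Vc) ?scaler0
      ?subrr ?scaler0 ?wR ?w1R ?mem_cat ?eR ?subrr //)).
  exists (fun s => w1 s + d s); split=> [e eR'|s c].
    by rewrite lcombD w1R ?mem_cat ?eR' ?orbT // add0r dR //; right.
  have d0 : V (s, c) -> d s = 0.
    move=> Vs; have := dR [:: (1, s)]; rewrite lcomb1 scale1r; apply; left.
    by exists s => //; exists c.
  move=> [[Gs|[-> ->]]|Gs].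
  - by rewrite (w1G s c) ?d0 ?addr0 //; left.
  - by rewrite dt ?inE // addrC subrK.
  - by rewrite (w1G s c) ?d0 ?addr0 //; right.
have /choice[w wV] := Vtot.
exists w; split=> [e eR|t Dt]; last first.
  have [w1 [_ w1G]] := PG [::] (fun e => ltac:(by [])).
  rewrite -(w1G t (w t) (wV t)); apply: w1G; by right.
have [w1 [w1R w1G]] := PG [:: e] (fun e' => ltac:(by rewrite inE => /eqP->)).
rewrite -[RHS](w1R e) ?inE //; apply: eq_lcomb => t.
exact/esym/w1G/wV.
Qed.

End Compactness.

(** * Pure epimorphisms *)

Section Purity.
Variable A : pzRingType.
Implicit Types C L M N X K P KM PM KL PL : lmodType A.

(** Turns the search for a linear map on L into a homogeneous system whose unknowns are the elements
    of L, the form to which [compact] applies. *)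
Lemma all_relations_linear L C (g : L -> C) :
  (forall e, lcomb e id = 0 :> L -> lcomb e g = 0) -> linear g.
Proof.
move=> gR a x y.
have := gR [:: (a, x); (1, y); (-1, a *: x + y)].
rewrite !lcomb_cons !lcomb_nil /= !scale1r !scaleN1r !addr0 !addrA subrr.
by move=> /(_ erefl)/eqP; rewrite subr_eq0 => /eqP.
Qed.

(** Equivalently, finitely presented modules lift along q; the form with a set-theoretic section is
    the one that combines with finite parts of systems. *)
Definition pure_epi M L (q : {linear M -> L}) :=
  forall R : seq (seq (A * L)), (forall e, e \in R -> lcomb e id = 0) ->
  exists s : L -> M, (forall l, q (s l) = l) /\ forall e, e \in R -> lcomb e s = 0.

Section PureEpi.
Variables (M L : lmodType A) (q : {linear M -> L}).
Hypothesis qpure : pure_epi q.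

Lemma pure_epi_surj l : exists m, q m = l.
Proof. by have [s [sq _]] := qpure (R := [::]) (fun e => ltac:(by [])); exists (s l). Qed.

(** The extension of h to X is sought as a solution of all relations of X with values prescribed on
    K. By compactness finitely many relations suffice, and for these purity provides a partial lift
    of X to the pullback Y, where h does extend. *)
Lemma Ext1_zero_pure_quotient C : compact C -> Ext1_zero C M -> Ext1_zero C L.
Proof.
move=> Cc ExtM K X i p se h.
have [Y [j [q' [a [se' aj pa univ inj]]]]] := pullback_short_exact q se.
have [ii pi iex ps] := (short_exactP _ _).1 se.
have [ji qj jex qs] := (short_exactP _ _).1 se'.
have [k kE] := ExtM _ _ _ _ se' h.
have /choice[v vE] : forall x : X, exists c, forall y, i y = x -> c = h y.
  move=> x; have [[y yx]|nx] := EM (exists y, i y = x); last first.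
    by exists 0 => y yx; case: nx; exists y.
  by exists (h y) => y' y'x; congr (h _); apply: ii; rewrite yx.
have [R RR|g [gR gD]] := Cc X (fun e => lcomb e id = 0 :> X) (fun x => exists y, i y = x) v.
  (* The additional relation 1 * 0 = 0 forces [s 0 = 0], so that elements of K are lifted to K. *)
  have [|s [sq sR]] :=
      qpure (R := [:: (1, 0)] :: [seq [seq (u.1, p u.2) | u <- e] | e <- R]).
    move=> e; rewrite inE => /orP[/eqP->|/mapP[e' e'R ->]].
      by rewrite lcomb1 scaler0.
    rewrite lcomb_map -[LHS]/(lcomb e' (p \o id)) lcomb_linear RR ?linear0 //.
  have s0 : s 0 = 0.
    by have := sR [:: (1, 0)]; rewrite inE eqxx lcomb1 scale1r; apply.
  have /choice[y yE] : forall x : X, exists y, a y = x /\ q' y = s (p x).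
    move=> x; have [y yE] := qs (s (p x)).
    have /iex[z zE] : p (x - a y) = 0 by rewrite linearB pa yE sq subrr.
    by exists (j z + y); rewrite !linearD aj qj zE subrK add0r.
  exists (k \o y); split=> [e eR|x [z zx]] /=.
    rewrite lcomb_linear; have -> : lcomb e y = 0; last exact: linear0.
    apply: inj; rewrite -lcomb_linear.
      by rewrite -[RHS](RR e eR); apply: eq_lcomb => x /=; case: (yE x).
    rewrite (@eq_lcomb _ _ _ _ _ (s \o p)) => [|x]; last by case: (yE x).
    rewrite -lcomb_map; apply: sR; rewrite inE; apply/orP; right.
    exact: (map_f (fun e => [seq (u.1, p u.2) | u <- e])).
  rewrite (vE x z zx) -kE; congr (k _); have [ay qy] := yE x.
  apply/eqP; rewrite -subr_eq0; apply/eqP/inj; rewrite linearB.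
    by rewrite ay aj zx subrr.
  by rewrite qy qj -zx pi s0 subrr.
have gl := all_relations_linear gR.
exists (linear_of gl) => y /=.
by rewrite gD ?(vE _ y) //; exists y.
Qed.

(** The cover of M is adapted to that of L: free generators for [ker q] are added to those that lift
    the generators of L. *)
Lemma pure_syzygy : exists KM PM KL PL (iM : {linear KM -> PM}) (pM : {linear PM -> M})
    (iL : {linear KL -> PL}) (pL : {linear PL -> L}) (q' : {linear KM -> KL}),
  [/\ short_exact iM pM, projective PM, short_exact iL pL, projective PL & pure_epi q'].
Proof.
have [pL pLE] := freemod_lift (id : L -> L).
have pLs z : exists y, pL y = z by exists (fgen A z).
have [s sE] := projective_lift pL (@freemod_projective A L) pure_epi_surj.
have [pK pKs] := freemod_cover (ker q).
pose PM : lmodType A := (freemod A (ker q) * freemod A L)%type.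
pose pM : {linear PM -> M} := lcopair (ker_incl q \o pK) s.
have pME x y : pM (x, y) = ker_incl q (pK x) + s y by [].
have qpM x : q (pM x) = pL x.2.
  by case: x => x y; rewrite pME linearD ker_incl0 sE add0r.
have pMs z : exists y, pM y = z.
  have [y yE] := pLs (q z).
  have /ker_inclP[k kE] : q (z - s y) = 0 by rewrite linearB sE yE subrr.
  by have [x xE] := pKs k; exists (x, y); rewrite pME xE kE subrK.
have [q' q'E] : exists q' : {linear ker pM -> ker pL},
    forall x, ker_incl pL (q' x) = (snd \o ker_incl pM) x.
  apply: lift_injective; first exact: ker_incl_inj.
  by move=> x; apply: ker_inclP; rewrite /= -qpM ker_incl0 linear0.
exists (ker pM), PM, (ker pL), (freemod A L), (ker_incl pM), pM, (ker_incl pL), pL, q'.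
split.
- exact: ker_short_exact.
- by apply: projective_prod; apply: freemod_projective.
- exact: ker_short_exact.
- exact: freemod_projective.
move=> R RR.
(* Each element of [ker pL] is itself a relation among elements of L. Purity of q for the finitely
   many that occur in R gives a section [s0] whose linear extension [s'] kills them. *)
pose zs := [seq u.2 | u <- flatten R].
have /choice[rel relE] : forall z : ker pL, exists e : seq (A * L), ker_incl pL z = lcomb e (@fgen A L).
  by move=> z; apply: freemod_span.
have relV z : lcomb (rel z) id = 0 :> L.
  have := ker_incl0 z; rewrite relE -lcomb_linear => <-; apply: eq_lcomb => l /=.
  by rewrite pLE.
have [|s0 [s0q s0R]] := qpure (R := [seq rel z | z <- zs]).
  by move=> _ /mapP[z _ ->].
have [s' s'E] := freemod_lift s0.
have s'q : forall x, q (s' x) = pL x.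
  by apply: (@freemod_eq _ _ _ (q \o s') pL) => l /=; rewrite s'E s0q pLE.
have [d dE] : exists d : {linear freemod A L -> ker q},
    forall x, ker_incl q (d x) = (s \- s') x.
  apply: lift_injective; first exact: ker_incl_inj.
  by move=> x; apply: ker_inclP; rewrite /= linearB s'q sE subrr.
have [w wE] := projective_lift d (@freemod_projective A L) pKs.
(* [t] is a linear lift to PM whose value lies in [ker pM] as soon as [s' z = 0]; this covers every
   z that R mentions, and elsewhere any lift will do. *)
pose t z : PM := (- w (ker_incl pL z), ker_incl pL z).
have pMt z : pM (t z) = s' (ker_incl pL z).
  by rewrite pME !linearN wE dE /= opprB subrK.
have /choice[r rE] : forall z, exists y, q' y = z /\
    (s' (ker_incl pL z) = 0 -> ker_incl pM y = t z).
  move=> z; have [sz|sz] := EM (s' (ker_incl pL z) = 0).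
    have /ker_inclP[y yE] : pM (t z) = 0 by rewrite pMt.
    exists y; split=> //; apply: (@ker_incl_inj _ _ _ pL).
    by rewrite q'E /= yE.
  have /ker_inclP[k kE] : q (s (ker_incl pL z)) = 0 by rewrite sE ker_incl0.
  have [x xE] := pKs k.
  have /ker_inclP[y yE] : pM (- x, ker_incl pL z) = 0.
    by rewrite pME !linearN xE kE addNr.
  exists y; split=> [|//]; apply: (@ker_incl_inj _ _ _ pL).
  by rewrite q'E /= yE.
exists r; split=> [z|e eR]; first by case: (rE z).
apply: (@ker_incl_inj _ _ _ pM); rewrite -lcomb_linear linear0.
have tl : linear t.
  by move=> a x y; congr pair; rewrite /= !linearP //= opprD scalerN.
rewrite (@eq_in_lcomb _ _ _ _ _ (linear_of tl \o id)) => [|z ze /=].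
  by rewrite lcomb_linear RR ?linear0.
have [_ ->//] := rE z; rewrite relE -lcomb_linear.
rewrite (@eq_lcomb _ _ _ _ _ s0) => [|l /=]; last by rewrite s'E.
apply: s0R; apply: map_f; have /mapP[u ue ->] := ze; apply: map_f.
by apply/flattenP; exists e.
Qed.

End PureEpi.

Lemma Ext_vanish_pure_quotient C n M L (q : {linear M -> L}) :
  compact C -> pure_epi q -> Ext_vanish C n M -> Ext_vanish C n L.
Proof.
move=> Cc; elim: n M L q => [|n IHn] M L q qp; first exact (Ext1_zero_pure_quotient qp Cc).
have [KM [PM [KL [PL [iM [pM [iL [pL [q' [seM PMp seL PLp q'p]]]]]]]]]] := pure_syzygy qp.
move=> EM; exists KL, PL, iL, pL; split=> //.
exact: IHn q'p (Ext_vanish_syzygy seM PMp EM).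
Qed.

(** A transfer principle: solvability for all linear maps L -> C already follows from finitely many
    relations of L, and these lift along a pure epimorphism. The list R has the smallest trace on
    the elements [l t], so an assignment satisfying R agrees there with a linear map, by
    compactness. *)
Lemma implied_by_finite C : chain_condition C ->
  forall L (T : eqType) (S : seq (seq (A * T))) (ts : seq T) (l : T -> L),
  (forall g : {linear L -> C}, exists w : T -> C,
     (forall e, e \in S -> lcomb e w = 0) /\ forall t, t \in ts -> w t = g (l t)) ->
  exists R : seq (seq (A * L)), (forall e, e \in R -> lcomb e id = 0) /\
  forall w : L -> C, (forall e, e \in R -> lcomb e w = 0) ->
  exists w' : T -> C, (forall e, e \in S -> lcomb e w' = 0) /\
                      forall t, t \in ts -> w' t = w (l t).
Proof.
move=> cc L T S ts l gS.
have [R [RR Rmin]] := chain_condition_min cc [seq l t | t <- ts] (fun=> False)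
  (fun e => lcomb e id = 0 :> L).
exists R; split=> // w wR.
have [R' R'R|g [gR gD]] := chain_condition_compact cc
    (Rel := fun e => lcomb e id = 0 :> L) (D := fun x => x \in [seq l t | t <- ts]) (v := w).
  have [w' w'R w'w] := Rmin R' R'R w (fun e => ltac:(by case=> // /wR)).
  by exists w'; split=> // e eR; apply: w'R; right.
have [w' [w'S w'l]] := gS (linear_of (all_relations_linear gR)).
by exists w'; split=> // t tts; rewrite w'l //= gD //; apply: map_f.
Qed.

Definition hull C M : lmodType A := {linear M -> C} -> C.
(** The evaluation map, sending x to the family of all f x; every map from M to C factors through
    it. *)
Definition hull_map C M : {linear M -> hull C M} := ltuple id.
Definition cohull C M : lmodType A := coker (hull_map C M).
Definition cohull_proj C M : {linear hull C M -> cohull C M} := coker_proj (hull_map C M).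

Fixpoint cohulls C M n : lmodType A :=
  if n is m.+1 then cohulls C (cohull C M) m else M.

End Purity.

(** * Pure quotients and the canonical embedding into a power of C *)

Section HullPurity.
Variables (A : pzRingType) (C M L : lmodType A) (q : {linear M -> L}).
Hypotheses (cc : chain_condition C) (qpure : pure_epi q).

(** As q is surjective, composition with q embeds Hom(L, C) in Hom(M, C): r restricts families to
    these indices and s extends them by 0. *)
Lemma hull_restriction : exists (r : {linear hull C M -> hull C L})
    (s : {linear hull C L -> hull C M}),
  (forall x, r (hull_map C M x) = hull_map C L (q x)) /\ (forall y, r (s y) = y).
Proof.
have rl : linear (fun (x : hull C M) (g : {linear L -> C}) => x (g \o q)) by [].
have /choice[t tE] : forall f : {linear M -> C}, exists o : option {linear L -> C},
    forall g : {linear L -> C}, f = g \o q -> o = Some g.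
  move=> f; have [[g ->]|ng] := EM (exists g : {linear L -> C}, f = g \o q); last first.
    by exists None => g fg; case: ng; exists g.
  exists (Some g) => g' e; congr Some; apply: linear_eqP => l.
  have [m <-] := pure_epi_surj qpure l.
  exact: (congr1 (fun h : {linear M -> C} => h m) e).
have sl : linear (fun (y : hull C L) (f : {linear M -> C}) => if t f is Some g then y g else 0).
  move=> a x y; apply/funext => f.
  rewrite -[RHS]/(a *: (if t f is Some g then x g else 0) + if t f is Some g then y g else 0).
  by case: (t f) => //; rewrite scaler0 addr0.
exists (linear_of rl), (linear_of sl); split=> [x|y]; first exact/funext.
by apply/funext => g /=; rewrite (tE _ g).
Qed.

(** If all maps L -> C kill l, then finitely many relations of L already force the value 0 at l.
    After lifting these relations to M, all maps M -> C kill the lift of l. *)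
Lemma hull_map_pure_quotient : injective (hull_map C M) -> injective (hull_map C L).
Proof.
move=> Mi; apply: linear_inj => l l0.
have [g|R [RR RC]] := implied_by_finite cc (S := [:: [:: (1, tt)]]) (ts := [:: tt])
    (l := fun=> l).
  exists (fun=> 0); split=> [e _|t _]; first exact: lcomb0.
  by rewrite -[g l]/(hull_map C L l g) l0.
have [s [sq sR]] := qpure RR.
suff s0 : s l = 0 by rewrite -[l]sq s0 linear0.
apply: Mi; rewrite linear0; apply/funext => f.
have [|w [wS wl]] := RC (f \o s).
  by move=> e eR; rewrite lcomb_linear sR ?linear0.
have := wS [:: (1, tt)]; rewrite inE eqxx lcomb1 scale1r => /(_ isT) w0.
by rewrite -[LHS]/((f \o s) l) -(wl tt) ?inE // w0.
Qed.

(** Relations among cosets are equations in a power of C whose right-hand sides come from elements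
    of L. Solvability of these equations is transferred from L to M by [implied_by_finite]. *)
Lemma cohull_pure_epi : exists q' : {linear cohull C M -> cohull C L}, pure_epi q'.
Proof.
have [r [s [rE rs]]] := hull_restriction.
have [q' q'E] : exists q' : {linear cohull C M -> cohull C L},
    forall x, q' (cohull_proj C M x) = (cohull_proj C L \o r) x.
  apply: factor_surjective; first exact: coker_proj_surj.
  move=> y /coker_proj0[x <-] /=; rewrite rE.
  by apply/coker_proj0; exists (q x).
exists q' => R RR.
have /choice[c cE] : forall x, exists y, cohull_proj C L y = x.
  exact: coker_proj_surj.
have /choice[l lE] : forall e : seq (A * cohull C L), exists l : L,
    e \in R -> hull_map C L l = lcomb e c.
  move=> e; have [eR|eR] := boolP (e \in R); last by exists 0.
  have /coker_proj0[l lE] : cohull_proj C L (lcomb e c) = 0.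
    rewrite -lcomb_linear -[RHS](RR e eR); apply: eq_lcomb => x /=.
    exact: cE.
  by exists l.
pose T : eqType := (cohull C L + seq (A * cohull C L))%type.
(* The unknown [inr e] stands for the right-hand side of the relation e, so that the system stays
   homogeneous. *)
pose ext (e : seq (A * cohull C L)) : seq (A * T) :=
  [seq (u.1, inl u.2) | u <- e] ++ [:: (-1, inr e)].
have extE (N : lmodType A) e (v : T -> N) :
    lcomb (ext e) v = lcomb e (v \o inl) - v (inr e).
  by rewrite lcomb_cat lcomb1 scaleN1r lcomb_map.
have [g|RL [RLR RLC]] := implied_by_finite cc (S := [seq ext e | e <- R])
    (ts := [seq (inr e : T) | e <- R])
    (l := fun t : T => if t is inr e then l e else 0).
  exists (fun t => match t with inl x => c x g | inr e => g (l e) end).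
  split=> [_ /mapP[e eR ->]|_ /mapP[e eR ->] //].
  rewrite extE /= -[lcomb e _]/(lcomb e (fun x => c x g)) -lcomb_fun -lE //.
  exact: subrr.
have [t [tq tR]] := qpure RLR.
have /choice[W WP] : forall f : {linear M -> C}, exists w : T -> C,
    (forall e, e \in R -> lcomb (ext e) w = 0) /\
    (forall e, e \in R -> w (inr e) = f (t (l e))).
  move=> f; have [|w [wS wl]] := RLC (f \o t).
    by move=> e eR; rewrite lcomb_linear tR ?linear0.
  exists w; split=> e eR; first by apply: wS; apply: map_f.
  by rewrite wl //; apply: (map_f (fun e => inr e : T)).
pose W' x : hull C M := fun f => W f (inl x).
have W'E e : e \in R -> lcomb e W' = hull_map C M (t (l e)).
  move=> eR; apply/funext => f; have [WS Wl] := WP f.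
  apply/eqP; rewrite lcomb_fun -subr_eq0 -[hull_map _ _ _ _]Wl //; apply/eqP.
  by rewrite -(WS e eR) extE.
(* [W' x] satisfies R modulo M but may not lie over x. The defect d satisfies R exactly, so adding
   [s (d x)] repairs the lift without disturbing the relations. *)
pose d x := c x - r (W' x).
have dE e : e \in R -> lcomb e d = 0.
  move=> eR; rewrite lcombB -[X in _ - X]/(lcomb e (r \o W')) lcomb_linear W'E //.
  by rewrite rE tq lE // subrr.
exists (fun x => cohull_proj C M (W' x + s (d x))); split=> [x|e eR].
  by rewrite q'E /= linearD rs addrC subrK cE.
rewrite -[LHS]/(lcomb e (cohull_proj C M \o (fun x => W' x + s (d x)))) lcomb_linear.
rewrite lcombD -[X in _ + X]/(lcomb e (s \o d)) lcomb_linear dE // linear0 addr0 W'E //.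
by apply/coker_proj0; exists (t (l e)).
Qed.

End HullPurity.

Lemma cohulls_pure_quotient (A : pzRingType) (C : lmodType A) n :
  chain_condition C -> forall (M L : lmodType A) (q : {linear M -> L}), pure_epi q ->
  (forall n, injective (hull_map C (cohulls C M n))) ->
  injective (hull_map C (cohulls C L n)).
Proof.
move=> cc; elim: n => [|n IHn] M L q qp Mi.
  by apply: (hull_map_pure_quotient cc qp); apply: (Mi 0).
have [q' q'p] := cohull_pure_epi cc qp.
apply: (IHn _ _ q' q'p) => m; exact: (Mi m.+1).
Qed.

(** * The class Ybar C *)

Section Prod.
Variable A : pzRingType.
Implicit Types C D L M N X : lmodType A.

Lemma ProdP C M : Prod C M <-> exists I : Type, retract M (I -> C).
Proof. by split=> -[I r]; exists I; apply/summandP. Qed.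

Lemma Prod_power C (I : Type) : Prod C (I -> C).
Proof. by apply/ProdP; exists I; apply: retract_refl. Qed.

Lemma Prod_retract C M N : retract M N -> Prod C N -> Prod C M.
Proof. by move=> MN /ProdP[I NI]; apply/ProdP; exists I; apply: retract_trans NI. Qed.

Lemma Prod_prod C M N : Prod C M -> Prod C N -> Prod C (M * N)%type.
Proof.
move=> /ProdP[I [i [p ip]]] /ProdP[J [j [q jq]]]; apply/ProdP; exists (I + J)%type.
exists (ltuple (fun k => match k with
    inl a => eval_at a \o (i \o fst) | inr b => eval_at b \o (j \o snd) end)).
exists (lpair (p \o ltuple (fun a => eval_at (inl a))) (q \o ltuple (fun b => eval_at (inr b)))).
move=> [x y]; congr pair; first by rewrite -[RHS]ip; congr (p _); apply/funext.
by rewrite -[RHS]jq; congr (q _); apply/funext.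
Qed.

Lemma retract_self C : retract C (unit -> C).
Proof. by exists (ltuple (fun=> idfun)), (eval_at tt). Qed.

Lemma Prod_self C : Prod C C.
Proof. by apply/ProdP; exists unit; apply: retract_self. Qed.

Lemma Prod_hull C M : Prod C (hull C M).
Proof. exact: Prod_power. Qed.

Lemma Prod0 C M : (forall x : M, x = 0) -> Prod C M.
Proof.
move=> M0; apply/ProdP; exists unit, (lzero _ _), (lzero _ _) => x.
by rewrite [x]M0 linear0.
Qed.

Lemma Ext1_zero_power C M (I : Type) : Ext1_zero C M -> Ext1_zero (I -> C) M.
Proof.
move=> E K X i p se h.
have /choice[k kE] : forall a : I, exists k : {linear X -> C}, forall x, k (i x) = h x a.
  by move=> a; apply: (E _ _ _ _ se (eval_at a \o h)).
by exists (ltuple k) => x; apply/funext => a; apply: kE.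
Qed.

Lemma Ext1_zero_coeff_retract C D M : retract C D -> Ext1_zero D M -> Ext1_zero C M.
Proof.
move=> [s [r rs]] E K X i p se h.
by have [k kE] := E _ _ _ _ se (s \o h); exists (r \o k) => x; rewrite /= kE /= rs.
Qed.

Lemma Ext_vanish_coeff C D M n :
  (forall N, Ext1_zero C N -> Ext1_zero D N) -> Ext_vanish C n M -> Ext_vanish D n M.
Proof.
move=> CD; elim: n M => [|n IHn] M; first exact: CD.
by move=> [K [P [i [p [se Pp /IHn EK]]]]]; exists K, P, i, p.
Qed.

Lemma Ext1_zero_Prod C D M : Prod C D -> Ext1_zero C M -> Ext1_zero D M.
Proof.
by move=> /ProdP[I r] E; apply: Ext1_zero_coeff_retract r _; apply: Ext1_zero_power.
Qed.

Lemma Ext_vanish_Prod C D M n : Prod C D -> Ext_vanish C n M -> Ext_vanish D n M.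
Proof. by move=> PD; apply: Ext_vanish_coeff => N; apply: Ext1_zero_Prod. Qed.

Lemma hull_map_extends C M : extends C (hull_map C M).
Proof. by move=> h; exists (eval_at h). Qed.

Lemma extends_Prod C D L M (f : {linear L -> M}) : Prod C D -> extends C f -> extends D f.
Proof.
move=> /ProdP[I [s [r rs]]] fC h.
have /choice[k kE] : forall a : I, exists k : {linear M -> C}, forall x, k (f x) = s (h x) a.
  by move=> a; apply: (fC (eval_at a \o (s \o h))).
exists (r \o ltuple k) => x /=; rewrite -[RHS]rs; congr (r _).
by apply/funext => a; apply: kE.
Qed.

Lemma hull_map_injective C D M (f : {linear M -> D}) :
  Prod C D -> injective f -> injective (hull_map C M).
Proof.
move=> /ProdP[I [s [r rs]]] fi; apply: linear_inj => x x0.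
apply: fi; rewrite linear0 -[f x]rs -[RHS](linear0 r); congr (r _).
apply/funext => a; exact: (congr1 (fun g : hull C M => g (eval_at a \o (s \o f))) x0).
Qed.

End Prod.

Section Ybar.
Variables (A : pzRingType) (C : lmodType A).
Implicit Types L M N X : lmodType A.

Lemma coker_retract L M N (f : {linear L -> M}) (g : {linear M -> N}) :
  exact f g -> (forall z, exists y, g y = z) ->
  retract (coker f) N /\ retract N (coker f).
Proof.
move=> /exactP[gf ex] gs.
have [k kE] : exists k : {linear coker f -> N}, forall y, k (coker_proj f y) = g y.
  apply: factor_surjective; first exact: coker_proj_surj.
  by move=> y /coker_proj0[x <-].
have [l lE] : exists l : {linear N -> coker f}, forall y, l (g y) = coker_proj f y.
  by apply: factor_surjective => // y /ex[x <-]; apply/coker_proj0; exists x.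
split; [exists k, l|exists l, k] => z.
  by have [y <-] := coker_proj_surj z; rewrite kE lE.
by have [y <-] := gs z; rewrite lE kE.
Qed.

(** Membership in Ybar C is coinductive: a coresolution is spliced from short exact sequences chosen
    one at a time, so an invariant G preserved by one step is enough. Most closure properties below
    amount to choosing G. *)
Lemma Ybar_coind (G : modclass A) :
  (forall M, G M -> (forall n, Ext_vanish C n M) /\
     exists (C' M' : lmodType A) (f : {linear M -> C'}) (g : {linear C' -> M'}),
       [/\ short_exact f g, Prod C C' & G M']) ->
  forall M, G M -> Ybar C M.
Proof.
move=> Gstep M GM; split; first by apply/lperpP; case: (Gstep M GM).
have [Mn [Cn [fn [gn [M0 se PC GMn]]]]] : exists (Mn Cn : nat -> lmodType A)
    (fn : forall n, {linear Mn n -> Cn n}) (gn : forall n, {linear Cn n -> Mn n.+1}),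
    [/\ Mn 0%N = M, forall n, short_exact (fn n) (gn n), forall n, Prod C (Cn n) &
        forall n, G (Mn n)].
  (* The recursion runs over modules bundled with a proof of G, since each choice depends on that
     proof. *)
  pose S := {N : lmodType A | G N}.
  pose step (N : S) := {C' : lmodType A & {M' : S & {f : {linear sval N -> C'} &
    {g : {linear C' -> sval M'} | short_exact f g /\ Prod C C'}}}}.
  have st (N : S) : step N.
    apply: inhabited_witness; case: N => N GN.
    have [_ [C' [M' [f [g [se PC' GM']]]]]] := Gstep N GN.
    by split; exists C', (exist _ M' GM'), f, g.
  pose nx := fix nx n : S := if n is m.+1 then projT1 (projT2 (st (nx m))) else exist _ M GM.
  exists (fun n => sval (nx n)), (fun n => projT1 (st (nx n))).
  exists (fun n => projT1 (projT2 (projT2 (st (nx n))))).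
  exists (fun n => sval (projT2 (projT2 (projT2 (st (nx n)))))).
  split=> // n; last exact: (proj2_sig (nx n)).
    exact: (proj2_sig (projT2 (projT2 (projT2 (st (nx n)))))).1.
  exact: (proj2_sig (projT2 (projT2 (projT2 (st (nx n)))))).2.
subst M.
have E1 n : Ext1_zero C (Mn n) by case: (Gstep _ (GMn n)) => /(_ 0%N).
have exS n : exact (fn n.+1 \o gn n) (gn n.+1).
  have [_ _ _ gs] := (short_exactP _ _).1 (se n).
  have [_ gf ex _] := (short_exactP _ _).1 (se n.+1).
  apply/exactP; split=> [x|y /ex[x <-]] /=; first exact: gf.
  by have [z <-] := gs x; exists z.
have ex0 n : exact (fn n) (fn n.+1 \o gn n).
  have [_ gf ex _] := (short_exactP _ _).1 (se n).
  have [fi _ _ _] := (short_exactP _ _).1 (se n.+1).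
  apply/exactP; split=> [x|y] /=; first by rewrite gf linear0.
  by rewrite -[0](linear0 (fn n.+1)) => /fi/ex.
exists Cn, (fn 0%N), (fun n => fn n.+1 \o gn n); split.
- split.
  + by case: (se 0%N).
  + exact: ex0.
  + move=> n; have [_ _ _ gs] := (short_exactP _ _).1 (se n.+1).
    have /exactP[a b] := exS n; have [fi _ _ _] := (short_exactP _ _).1 (se n.+2).
    apply/exactP; split=> [x|y] /=; first by have := a x; rewrite /= => ->; rewrite linear0.
    by rewrite -[0](linear0 (fn n.+2)) => /fi/b.
- exact: PC.
- apply/Ext1_zeroP; have [r _] := coker_retract (let: And3 _ h _ := se 0%N in h)
    (range_surj (let: And3 _ _ h := se 0%N in h)).
  exact: Ext1_zero_retract r (E1 1%N).
- move=> n; apply/Ext1_zeroP.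
  have [r _] := coker_retract (exS n) (range_surj (let: And3 _ _ h := se n.+1 in h)).
  exact: Ext1_zero_retract r (E1 n.+2).
Qed.

Hypothesis Cself : forall (I : Type) n, Ext_vanish C n (I -> C).

Lemma Prod_self_orthogonal M n : Prod C M -> Ext_vanish C n M.
Proof. by move=> /ProdP[I r]; apply: Ext_vanish_retract r _. Qed.

Lemma Ext_vanish_coker_Prod L M N (f : {linear L -> M}) (g : {linear M -> N}) :
  short_exact f g -> Prod C M -> (forall n, Ext_vanish C n L) -> Ext1_zero C N ->
  forall n, Ext_vanish C n N.
Proof.
move=> se PM EL EN [//|n]; apply: (Ext_vanish_coker se) => //.
exact: Prod_self_orthogonal.
Qed.

(** The coresolution is cut after its first term. Powers of C being orthogonal to C, the Ext^1
    condition on the cokernel yields all higher degrees by dimension shifting. *)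
Lemma YbarE M : Ybar C M -> (forall n, Ext_vanish C n M) /\
  exists (C' M' : lmodType A) (f : {linear M -> C'}) (g : {linear C' -> M'}),
       [/\ short_exact f g, Prod C C' & Ybar C M'].
Proof.
move=> [/lperpP EM [C_ [f_ [f [[fi ex0 ex] PC E0 E1]]]]]; split=> //.
have se := coker_short_exact fi.
exists (C_ 0%N), (coker f_), f_, (coker_proj f_); split=> //.
have EN := Ext_vanish_coker_Prod se (PC 0%N) EM ((Ext1_zeroP _ _).1 E0).
split; first exact/lperpP.
have /exactP[f0 f1] := ex0.
have [k kE] : exists k : {linear coker f_ -> C_ 1%N}, forall y, k (coker_proj f_ y) = f 0%N y.
  apply: factor_surjective; first exact: coker_proj_surj.
  by move=> y /coker_proj0[x <-].
exists (fun n => C_ n.+1), k, (fun n => f n.+1); split=> //.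
- split=> //.
    apply: linear_inj => z; have [y <-] := coker_proj_surj z.
    by rewrite kE => /f1 h; apply/coker_proj0.
  have /exactP[a b] := ex 0%N.
  apply/exactP; split=> [z|y /b[x <-]].
    by have [y <-] := coker_proj_surj z; rewrite kE.
  by exists (coker_proj f_ x).
- apply/Ext1_zeroP.
  have ex' : exact k (coker_proj (f 0%N)).
    apply/exactP; split=> [z|y].
      have [y <-] := coker_proj_surj z; rewrite kE.
      by apply/coker_proj0; exists y.
    by move=> /coker_proj0[x <-]; exists (coker_proj f_ x).
  have [r _] := coker_retract ex' (@coker_proj_surj _ _ _ (f 0%N)).
  exact: Ext1_zero_retract r ((Ext1_zeroP _ _).1 (E1 0%N)).
Qed.

Lemma Ybar_Ext M n : Ybar C M -> Ext_vanish C n M.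
Proof. by move=> /YbarE[]. Qed.

(** The dual horseshoe: the embedding of L extends to M because N is orthogonal to Prod(C), and the
    cokernel of M in [CL * CN] is again an extension of two members of Ybar C. *)
Lemma Ybar_ext L M N (f : {linear L -> M}) (g : {linear M -> N}) :
  short_exact f g -> Ybar C L -> Ybar C N -> Ybar C M.
Proof.
pose G X := exists L N (f : {linear L -> X}) (g : {linear X -> N}),
  [/\ short_exact f g, Ybar C L & Ybar C N].
move=> se YL YN; apply: (@Ybar_coind G); last by exists L, N, f, g.
move=> {L M N f g se YL YN} M [L [N [f [g [se YL YN]]]]].
have [fi gf fex gs] := (short_exactP _ _).1 se.
have [EL [CL [L' [u [v [seL PL YL']]]]]] := YbarE YL.
have [EN [CN [N' [s [t [seN PN YN']]]]]] := YbarE YN.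
have [ui vu uex vs] := (short_exactP _ _).1 seL.
have [si ts sex tS] := (short_exactP _ _).1 seN.
split=> [n|]; first exact: Ext_vanish_ext se (EL n) (EN n).
have [w wE] : exists w : {linear M -> CL}, forall x, w (f x) = u x.
  by apply: (Ext1_zero_Prod PL (EN 0%N)) se u.
have hi : injective (lpair w (s \o g)).
  apply: linear_inj => x [wx sgx].
  have /fex[l lE] : g x = 0 by apply: si; rewrite linear0.
  rewrite -lE; have -> : l = 0 by apply: ui; rewrite linear0 -wE lE.
  exact: linear0.
exists (CL * CN)%type, (coker (lpair w (s \o g))), (lpair w (s \o g)), (coker_proj _).
split; [exact: coker_short_exact|exact: Prod_prod|].
have [a aE] : exists a : {linear L' -> coker (lpair w (s \o g))},
    forall x, a (v x) = (coker_proj (lpair w (s \o g)) \o lpair idfun (lzero CL CN)) x.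
  apply: factor_surjective => // y /uex[l <-].
  by apply/coker_proj0; exists (f l); rewrite /= wE gf linear0.
have [b bE] : exists b : {linear coker (lpair w (s \o g)) -> N'},
    forall x, b (coker_proj (lpair w (s \o g)) x) = (t \o snd) x.
  apply: factor_surjective; first exact: coker_proj_surj.
  by move=> y /coker_proj0[x <-] /=; rewrite ts.
exists L', N', a, b; split=> //; apply/short_exactP; split.
- apply: linear_inj => x; have [y <-] := vs x; rewrite aE => /coker_proj0[m [wm sgm]].
  have /fex[l lE] : g m = 0 by apply: si; rewrite linear0.
  by rewrite -wm -lE wE vu.
- by move=> x; have [y <-] := vs x; rewrite aE bE /= linear0.
- move=> y; have [[x z] <-] := coker_proj_surj y; rewrite bE /= => /sex[n nE].
  have [m mE] := gs n; exists (v (x - w m)); rewrite aE /=.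
  apply/eqP; rewrite -subr_eq0 -linearB; apply/eqP/coker_proj0; exists (- m).
  by congr pair; rewrite /= !linearN ?mE ?nE ?opprB /= ?add0r // addrAC subrr add0r.
- move=> z; have [y <-] := tS z; exists (coker_proj _ (0, y)).
  by rewrite bE.
Qed.

End Ybar.

Section YbarClosure.
Variables (A : pzRingType) (C : lmodType A).
Implicit Types L M N P X : lmodType A.
Hypothesis Cself : forall (I : Type) n, Ext_vanish C n (I -> C).

Lemma Ybar_step M N P (f : {linear M -> P}) (g : {linear P -> N}) :
  short_exact f g -> Prod C P -> (forall n, Ext_vanish C n M) -> Ybar C N -> Ybar C M.
Proof.
pose G X := (forall n, Ext_vanish C n X) /\ exists (P N : lmodType A)
  (f : {linear X -> P}) (g : {linear P -> N}), [/\ short_exact f g, Prod C P & Ybar C N].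
move=> se PP EM YN; apply: (@Ybar_coind _ _ G); last first.
  by split=> //; exists P, N, f, g.
move=> X [EX [Q [Y [h [k [hk PQ YY]]]]]]; split=> //.
by exists Q, Y, h, k; split=> //; apply: YbarE.
Qed.

Lemma Ybar0 M : (forall x : M, x = 0) -> Ybar C M.
Proof.
apply: (@Ybar_coind _ _ (fun M => forall x : M, x = 0)) => {}M M0; split=> [n|].
  apply: Ext_vanish_projective => X Y g h _; exists (lzero _ _) => x.
  by rewrite [x]M0 !linear0.
exists M, M, idfun, idfun; split=> //; last exact: Prod0.
by apply/short_exactP; split=> [x y|x|y _|y] //; [exists y|exists y].
Qed.

Lemma Ybar_Prod M : Prod C M -> Ybar C M.
Proof.
move=> PM; apply: (Ybar_step (coker_short_exact (f := (idfun : {linear M -> M})) (fun x y e => e))) => //.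
  by move=> n; apply: Prod_self_orthogonal.
apply: Ybar0 => x; have [y <-] := coker_proj_surj x.
by apply/coker_proj0; exists y.
Qed.

Lemma Ybar_iso M N : iso M N -> Ybar C N -> Ybar C M.
Proof.
move=> MN YN; have [EN [P [N' [f [g [/short_exactP[fi gf ex gs] PP YN']]]]]] := YbarE Cself YN.
have EM n : Ext_vanish C n M by apply: Ext_vanish_retract (iso_retract MN) (EN n).
case: MN => h [h' hh' h'h].
apply: (@Ybar_step M N' P (f \o h) g) => //; apply/short_exactP; split=> //=.
- by move=> x y /fi/(can_inj hh').
- by move=> y /ex[x <-]; exists (h' x); rewrite /= h'h.
Qed.

(** L embeds through M into P, and the cokernel is an extension with submodule N and quotient
    [M']. *)
Lemma Ybar_kernel L M N (f : {linear L -> M}) (g : {linear M -> N}) :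
  short_exact f g -> Ybar C M -> Ybar C N -> Ybar C L.
Proof.
move=> se YM YN; have [fi gf fex gs] := (short_exactP _ _).1 se.
have [ExtM [P [M' [u [v [seM PP YM']]]]]] := YbarE Cself YM.
have [ui vu uex vs] := (short_exactP _ _).1 seM.
have ufi : injective (u \o f) by move=> x y /ui/fi.
apply: (Ybar_step (coker_short_exact ufi)) => //.
  by move=> n; apply: Ext_vanish_kernel se (ExtM n) _; apply: Ybar_Ext.
have [a aE] : exists a : {linear N -> coker (u \o f)},
    forall y, a (g y) = (coker_proj (u \o f) \o u) y.
  by apply: factor_surjective => // y /fex[x <-]; apply/coker_proj0; exists x.
have [b bE] : exists b : {linear coker (u \o f) -> M'},
    forall y, b (coker_proj (u \o f) y) = v y.
  apply: factor_surjective; first exact: coker_proj_surj.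
  by move=> y /coker_proj0[x <-] /=.
apply: (Ybar_ext Cself (f := a) (g := b)) => //; apply/short_exactP; split.
- apply: linear_inj => z; have [y <-] := gs z; rewrite aE => /coker_proj0[x /ui <-].
  exact: gf.
- by move=> z; have [y <-] := gs z; rewrite aE bE.
- move=> z; have [y <-] := coker_proj_surj z; rewrite bE => /uex[x <-].
  by exists (g x); rewrite aE.
- by move=> z; have [y <-] := vs z; exists (coker_proj _ y); rewrite bE.
Qed.

(** The invariant is to have a complement Y with X * Y in Ybar C. If X * Y embeds in P with cokernel
    W, then 0 -> X * Y -> [coker u1] * X -> W -> 0 is exact, so [coker u1] satisfies the invariant
    with complement X. *)
Lemma Ybar_retract M N : retract M N -> Ybar C N -> Ybar C M.
Proof.
move=> /summandP[L /iso_sym NML] /(Ybar_iso NML) {NML}.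
pose G X := exists Y : lmodType A, Ybar C (X * Y)%type.
move=> YML; apply: (@Ybar_coind _ _ G); last by exists L.
move=> {M N L YML} X [Y YXY]; have [EXY [P [W [u [v [seXY PP YW]]]]]] := YbarE Cself YXY.
have [ui vu uex vs] := (short_exactP _ _).1 seXY.
split=> [n|]; first exact: Ext_vanish_retract (retract_inl X Y) (EXY n).
pose u1 : {linear X -> P} := u \o lpair idfun (lzero X Y).
have u1E x : u1 x = u (x, 0) by [].
have u1i : injective u1 by move=> x y /ui[].
exists P, (coker u1), u1, (coker_proj u1); split=> //; first exact: coker_short_exact.
exists X.
have pu x y : coker_proj u1 (u (x, y)) = coker_proj u1 (u (0, y)).
  apply/eqP; rewrite -subr_eq0 -!linearB; apply/eqP/coker_proj0; exists x.
  by rewrite u1E; congr (u _); congr pair; rewrite /= ?subr0 ?subrr.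
have [b bE] : exists b : {linear coker u1 -> W}, forall y, b (coker_proj u1 y) = v y.
  apply: factor_surjective; first exact: coker_proj_surj.
  by move=> y /coker_proj0[x <-] /=.
apply: (Ybar_ext Cself (f := lpair (coker_proj u1 \o u) fst) (g := b \o fst)) YXY YW.
apply/short_exactP; split.
- apply: linear_inj => -[x y] /= [/coker_proj0[x' x'E] x0].
  by move: x'E; rewrite u1E => /ui[_ <-]; rewrite x0.
- by move=> x /=; rewrite bE.
- move=> [z x] /=; have [y <-] := coker_proj_surj z; rewrite bE => /uex[[x' y'] <-].
  by exists (x, y'); rewrite /= (pu x) (pu x').
- by move=> z; have [y <-] := vs z; exists (coker_proj _ y, 0); rewrite /= bE.
Qed.

Lemma cohull_Ext1_zero M : injective (hull_map C M) -> Ext1_zero C (cohull C M).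
Proof.
move=> ei; apply: (Ext1_zero_coker (coker_short_exact ei)); first exact: (Cself _ 0).
exact: hull_map_extends.
Qed.

Lemma Ybar_hull_injective M : Ybar C M -> injective (hull_map C M).
Proof.
by move=> /(YbarE Cself)[_ [P [N [f [g [[fi _ _] PP _]]]]]]; apply: hull_map_injective PP fi.
Qed.

(** The pushout Y of an embedding into P with cokernel in Ybar C and of the canonical one is an
    extension of W by the hull, hence in Ybar C. It is also an extension of the cohull by P, which
    splits, so the cohull is a retract of Y. *)
Lemma Ybar_cohull M : Ybar C M -> Ybar C (cohull C M).
Proof.
move=> YM; have ei := Ybar_hull_injective YM.
have [ExtM [P [W [u [v [seM PP YW]]]]]] := YbarE Cself YM.
have [ui vu uex vs] := (short_exactP _ _).1 seM.
have [Y [a [b [ab span rel]]]] := pushout u (hull_map C M).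
have cs y : exists x, lcopair a b x = y.
  by have [x [h ->]] := span y; exists (x, h).
have [w wE] : exists w : {linear Y -> W}, forall x, w (lcopair a b x) = (v \o fst) x.
  by apply: factor_surjective => // -[x h] /rel[l [/= <- _]].
have [t tE] : exists t : {linear Y -> cohull C M},
    forall x, t (lcopair a b x) = (cohull_proj C M \o snd) x.
  apply: factor_surjective => // -[x h] /rel[l [_ hE]] /=.
  by apply/coker_proj0; exists (- l); rewrite linearN hE opprK.
have wab x h : w (a x + b h) = v x := wE (x, h).
have tab x h : t (a x + b h) = cohull_proj C M h := tE (x, h).
have seb : short_exact b w.
  apply/short_exactP; split.
  - apply: linear_inj => h bh.
    have [|l [ul hl]] := rel 0 h; first by rewrite linear0 add0r.
    have l0 : l = 0 by apply: ui; rewrite linear0.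
    by move: hl; rewrite l0 linear0 => /eqP; rewrite eq_sym oppr_eq0 => /eqP.
  - by move=> h; have := wab 0 h; rewrite !linear0 add0r.
  - move=> y; have [x [h ->]] := span y; rewrite wab => /uex[l <-].
    by exists (hull_map C M l + h); rewrite linearD ab.
  - by move=> z; have [x <-] := vs z; exists (a x + b 0); rewrite wab.
have sea : short_exact a t.
  apply/short_exactP; split.
  - apply: linear_inj => x ax.
    have [|l [ul hl]] := rel x 0; first by rewrite linear0 addr0.
    have l0 : l = 0 by apply: ei; rewrite hl oppr0 linear0.
    by rewrite -ul l0 linear0.
  - by move=> x; have := tab x 0; rewrite !linear0 addr0.
  - move=> y; have [x [h ->]] := span y; rewrite tab => /coker_proj0[l <-].
    by exists (x + u l); rewrite linearD ab.
  - move=> z; have [h <-] := coker_proj_surj z; exists (a 0 + b h).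
    by rewrite tab.
have YY : Ybar C Y by apply: (Ybar_ext Cself seb) => //; apply: Ybar_Prod; apply: Prod_hull.
apply: Ybar_retract YY; apply: (short_exact_retract sea).
exact: (Ext1_zero_Prod PP (cohull_Ext1_zero ei) sea idfun).
Qed.

(** The unspecified coresolution may be replaced by the canonical one through hulls; cogeneration of
    its cokernels can then be compared between M and a quotient of M. *)
Lemma Ybar_hullP M : Ybar C M <->
  (forall n, Ext_vanish C n M) /\ (forall n, injective (hull_map C (cohulls C M n))).
Proof.
split=> [YM|].
  split=> n; first exact: Ybar_Ext.
  elim: n M YM => [|n IHn] M YM /=; first exact: Ybar_hull_injective.
  exact/IHn/Ybar_cohull.
pose G M := (forall n, Ext_vanish C n M) /\ (forall n, injective (hull_map C (cohulls C M n))).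
move: M; apply: (@Ybar_coind _ _ G) => M [ExtM ei]; split=> //.
have se := coker_short_exact (ei 0%N : injective (hull_map C M)).
exists (hull C M), (cohull C M), (hull_map C M), (cohull_proj C M); split=> //.
  exact: Prod_hull.
split; last by move=> n; apply: (ei n.+1).
apply: (Ext_vanish_coker_Prod Cself se) => //; first exact: Prod_hull.
exact: cohull_Ext1_zero (ei 0%N).
Qed.

Lemma Ybar_pure_quotient M L (q : {linear M -> L}) :
  chain_condition C -> pure_epi q -> Ybar C M -> Ybar C L.
Proof.
move=> cc qp /Ybar_hullP[ExtM ei]; apply/Ybar_hullP; split=> n.
  apply: Ext_vanish_pure_quotient qp (ExtM n); exact: chain_condition_compact.
exact: cohulls_pure_quotient cc _ _ _ qp ei.
Qed.

End YbarClosure.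

(** * Direct sums of families *)

Lemma choice_dep (I : Type) (T : I -> Type) (P : forall i, T i -> Prop) :
  (forall i, exists x, P i x) -> exists f : forall i, T i, forall i, P i (f i).
Proof. by move=> h; exists (fun i => sval (cid (h i))) => i; apply: svalP. Qed.

Section FamilySum.
Variables (A : pzRingType) (I : Type).
Implicit Types F G H : I -> lmodType A.

Section Construction.
Variable F : I -> lmodType A.

Let T := {classic {i & F i}}.
Let tg i (x : F i) : T := existT (fun i => F i : Type) i x.

Let Rel (e : seq (A * T)) := exists i (e0 : seq (A * F i)),
  e = [seq (u.1, tg u.2) | u <- e0] /\ lcomb e0 id = 0.

(** The direct sum of a family, generated by the elements of all summands subject to the relations
    inside each one; [dsum] covers copies of a single module. *)
Definition fsum : lmodType A := pres Rel.

Let fsum_inj_linear i : linear (fun x : F i => pgen Rel (tg x) : fsum).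
Proof.
apply: all_relations_linear => e e0.
rewrite -[LHS]/(lcomb e (pgen Rel \o @tg i)) -lcomb_map.
by apply: pgen_satisfies; exists i, e.
Qed.
Definition fsum_inj i : {linear F i -> fsum} := linear_of (@fsum_inj_linear i).

Lemma fsum_lift (N : lmodType A) (g : forall i, {linear F i -> N}) :
  exists k : {linear fsum -> N}, forall i x, k (fsum_inj i x) = g i x.
Proof.
have [|k kE] := @pres_lift A T Rel N (fun u : {i & F i} => g (projT1 u) (projT2 u)).
  move=> e [i [e0 [-> e00]]]; rewrite lcomb_map.
  by rewrite -[LHS]/(lcomb e0 (g i \o id)) lcomb_linear e00 linear0.
by exists k => i x; apply: (kE (tg x)).
Qed.

Lemma fsum_eq (N : lmodType A) (f g : {linear fsum -> N}) :
  (forall i x, f (fsum_inj i x) = g (fsum_inj i x)) -> f =1 g.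
Proof. by move=> fg; apply: pres_eq => -[i x]; apply: fg. Qed.

Lemma fsum_span (p : fsum) : exists e : seq (A * T), p = lcomb e (fun u => fsum_inj (projT1 u) (projT2 u)).
Proof. by have [e ->] := pres_span p; exists e; apply: eq_lcomb => -[i x]. Qed.

Opaque fsum_inj.

Let cast i j (x : F i) : F j :=
  if pselect (i = j) is left e then eq_rect i (fun i => F i : Type) x j e else 0.

Let castE i (x : F i) : cast i x = x.
Proof.
rewrite /cast; case: pselect => // e.
by rewrite (Prop_irrelevance e erefl).
Qed.

Let cast0 i j (x : F i) : i <> j -> cast j x = 0.
Proof. by rewrite /cast; case: pselect. Qed.

Let cast_linear i j : linear (cast j : F i -> F j).
Proof.
move=> a x y; have [e|ne] := EM (i = j); last by rewrite !cast0 // scaler0 addr0.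
by case: j / e; rewrite !castE.
Qed.

Lemma fsum_proj_ex j : exists p : {linear fsum -> F j},
  (forall x, p (fsum_inj j x) = x) /\ (forall i x, i <> j -> p (fsum_inj i x) = 0).
Proof.
have [p pE] := fsum_lift (fun i => linear_of (@cast_linear i j)).
by exists p; split=> [x|i x ij]; rewrite pE /= ?castE ?cast0.
Qed.

Definition fsum_proj j : {linear fsum -> F j} := projT1 (cid (fsum_proj_ex j)).

Lemma fsum_proj_inj j x : fsum_proj j (fsum_inj j x) = x.
Proof. by have [h _] := projT2 (cid (fsum_proj_ex j)); apply: h. Qed.

Lemma fsum_proj_inj0 i j x : i <> j -> fsum_proj j (fsum_inj i x) = 0.
Proof. by have [_ h] := projT2 (cid (fsum_proj_ex j)); apply: h. Qed.

Definition fsum_of (s : seq {classic I}) (x : forall i, F i) : fsum :=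
  \sum_(i <- s) fsum_inj i (x i).

Lemma fsum_proj_of s x j : uniq s ->
  fsum_proj j (fsum_of s x) = if (j : {classic I}) \in s then x j else 0.
Proof.
move=> us; rewrite linear_sum; case: ifPn => js.
  rewrite (bigD1_seq (j : {classic I})) //= fsum_proj_inj big1 ?addr0 // => i /eqP ij.
  exact: fsum_proj_inj0.
rewrite big_seq big1 // => i is_; apply: fsum_proj_inj0 => ij.
by move: js; rewrite -ij is_.
Qed.

Lemma fsum_expand (p : fsum) : exists2 s, uniq s & p = fsum_of s (fun i => fsum_proj i p).
Proof.
have [e pE] := fsum_span p.
exists (undup [seq (projT1 (u.2 : {i & F i}) : {classic I}) | u <- e]); first exact: undup_uniq.
set s := undup _.
have fl : linear (fun p : fsum => fsum_of s (fun i => fsum_proj i p)).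
  move=> a x y; rewrite /fsum_of scaler_sumr -big_split; apply: eq_bigr => i _ /=.
  by rewrite !linearP.
rewrite -[RHS]/(linear_of fl p) {1 2}pE -lcomb_linear; apply: eq_in_lcomb => -[i x] ix /=.
rewrite /fsum_of (bigD1_seq (i : {classic I})) ?undup_uniq //=.
  rewrite fsum_proj_inj big1 ?addr0 // => j /eqP ji.
  by rewrite fsum_proj_inj0 ?linear0 // => ij; apply: ji.
rewrite mem_undup; have /mapP[u ue uE] := ix.
have := map_f (fun u : A * T => (projT1 (u.2 : {i & F i}) : {classic I})) ue.
by rewrite -uE.
Qed.

Lemma fsum_separated (p q : fsum) : (forall i, fsum_proj i p = fsum_proj i q) -> p = q.
Proof.
move=> pq; apply/eqP; rewrite -subr_eq0; apply/eqP.
have [s _ ->] := fsum_expand (p - q); apply: big1 => i _.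
by rewrite linearB pq subrr linear0.
Qed.

End Construction.

Lemma fsum_map_ex F G (f : forall i, {linear F i -> G i}) :
  exists k : {linear fsum F -> fsum G}, forall i x, k (fsum_inj F i x) = fsum_inj G i (f i x).
Proof. exact: (fsum_lift (fun i => fsum_inj G i \o f i)). Qed.

Lemma fsum_short_exact F G H (f : forall i, {linear F i -> G i})
    (g : forall i, {linear G i -> H i}) : (forall i, short_exact (f i) (g i)) ->
  exists (fs : {linear fsum F -> fsum G}) (gs : {linear fsum G -> fsum H}),
    [/\ short_exact fs gs, forall i x, fs (fsum_inj F i x) = fsum_inj G i (f i x) &
        forall i x, gs (fsum_inj G i x) = fsum_inj H i (g i x)].
Proof.
move=> se; have [fs fsE] := fsum_map_ex f; have [gs gsE] := fsum_map_ex g.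
have projE (F' G' : I -> lmodType A) (h : forall i, {linear F' i -> G' i}) (k : {linear fsum F' -> fsum G'}) :
    (forall i x, k (fsum_inj F' i x) = fsum_inj G' i (h i x)) ->
    forall j p, fsum_proj G' j (k p) = h j (fsum_proj F' j p).
  move=> kE j; apply: (@fsum_eq F' _ (fsum_proj G' j \o k) (h j \o fsum_proj F' j)) => i x /=.
  rewrite kE; have [e|ne] := EM (i = j); last by rewrite !fsum_proj_inj0 ?linear0.
  by case: j / e; rewrite !fsum_proj_inj.
exists fs, gs; split=> //; apply/short_exactP; split.
- apply: linear_inj => p fp; apply: fsum_separated => i.
  have [fi _ _ _] := (short_exactP _ _).1 (se i); apply: fi.
  by rewrite -(projE _ _ _ _ fsE) fp !linear0.
- apply: (@fsum_eq F _ (gs \o fs) (lzero _ _)) => i x /=.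
  by have [_ gf _ _] := (short_exactP _ _).1 (se i); rewrite fsE gsE gf linear0.
- move=> y gy; have /choice_dep[x xE] : forall i, exists x, f i x = fsum_proj G i y.
    move=> i; have [_ _ ex _] := (short_exactP _ _).1 (se i); apply: ex.
    by rewrite -(projE _ _ _ _ gsE) gy linear0.
  have [s us yE] := fsum_expand y; exists (fsum_of s x).
  rewrite linear_sum [RHS]yE; apply: eq_bigr => i _.
  by rewrite fsE xE.
- move=> z; have /choice_dep[y yE] : forall i, exists y, g i y = fsum_proj H i z.
    by move=> i; have [_ _ _ gS] := (short_exactP _ _).1 (se i).
  have [s us zE] := fsum_expand z; exists (fsum_of s y).
  rewrite linear_sum [RHS]zE; apply: eq_bigr => i _.
  by rewrite gsE yE.
Qed.

End FamilySum.

Section FamilySumClosure.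
Variables (A : pzRingType) (C : lmodType A) (I : Type).
Implicit Types F : I -> lmodType A.

Lemma fsum_projective F : (forall i, projective (F i)) -> projective (fsum F).
Proof.
move=> Fp M N g h gs.
have /choice_dep[k kE] : forall i, exists k : {linear F i -> M}, forall x, g (k x) = h (fsum_inj F i x).
  by move=> i; apply: (Fp i M N g (h \o fsum_inj F i)).
have [l lE] := fsum_lift k; exists l.
by apply: (@fsum_eq A I F _ (g \o l) h) => i x /=; rewrite lE kE.
Qed.

Lemma fsum_Ext_vanish F n : (forall i, Ext_vanish C n (F i)) -> Ext_vanish C n (fsum F).
Proof.
have pres F' : exists (K P : I -> lmodType A) (u : forall i, {linear K i -> P i})
    (v : forall i, {linear P i -> F' i}), forall i, short_exact (u i) (v i) /\ projective (P i).
  have /choice_dep[K KE] := fun i => free_presentation (F' i).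
  have /choice_dep[P PE] := KE; have /choice_dep[u uE] := PE; have /choice_dep[v vE] := uE.
  by exists K, P, u, v.
elim: n F => [|n IHn] F EF; have [K [P [u [v uv]]]] := pres F;
  have [us [vs [se usE vsE]]] := fsum_short_exact (fun i => (uv i).1).
- apply: (Ext1_zero_presentation se); first by apply: fsum_projective => i; case: (uv i).
  move=> h; have /choice_dep[k kE] : forall i, exists k : {linear P i -> C},
      forall x, k (u i x) = h (fsum_inj K i x).
    by move=> i; apply: (EF i _ _ _ _ (uv i).1 (h \o fsum_inj K i)).
  have [l lE] := fsum_lift k; exists l.
  by apply: (@fsum_eq A I K _ (l \o us) h) => i x /=; rewrite usE lE kE.
- exists (fsum K), (fsum P), us, vs; split=> //.
    by apply: fsum_projective => i; case: (uv i).
  by apply: IHn => i; have [se' Pp] := uv i; apply: Ext_vanish_syzygy se' Pp (EF i).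
Qed.

Hypothesis cc : chain_condition C.

Section Powers.
Variable J : I -> Type.
Let F i : lmodType A := J i -> C.
Let X := fsum F.

(** The n found for C serves all coordinates at once. Outside the finite support of the values on xs
    the solution is taken to be 0, which keeps it in the direct sum. *)
Lemma fsum_power_chain_condition : chain_condition X.
Proof.
move=> T xs Rel mono; have [n nP] := cc xs mono; exists n => w wR.
have /choice_dep[w' w'P] : forall u : {i & J i}, exists w' : T -> C,
    satisfies (Rel n.+1) w' /\ {in xs, forall t, w' t = fsum_proj _ (projT1 u) (w t) (projT2 u)}.
  move=> [i j]; have [|w' w'R w'w] := nP (fun t => fsum_proj _ i (w t) j); last by exists w'.
  move=> e eR; rewrite -[LHS]/(lcomb e ((eval_at j \o fsum_proj _ i) \o w)) lcomb_linear.
  by rewrite (wR e eR) linear0.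
have [s us sP] : exists2 s : seq {classic I}, uniq s &
    forall t i, t \in xs -> (i : {classic I}) \notin s -> fsum_proj _ i (w t) = 0.
  elim: (xs) => [|t ts [s us sP]]; first by exists [::].
  have [s' us' wE] := fsum_expand (w t); exists (undup (s ++ s')); first exact: undup_uniq.
  move=> t' i; rewrite inE mem_undup mem_cat negb_or => /orP[/eqP->|t'ts] /andP[is_ is'].
    by rewrite wE fsum_proj_of // (negbTE is').
  exact: sP.
pose W t : X := fsum_of s (fun i j => w' (existT J i j) t).
have WE t i : fsum_proj _ i (W t) =
    if (i : {classic I}) \in s then (fun j => w' (existT J i j) t) else 0.
  by rewrite fsum_proj_of.
exists W.
  move=> e eR; apply: fsum_separated => i; rewrite linear0 -lcomb_linear.
  rewrite (@eq_lcomb _ _ _ _ _ (fun t => if (i : {classic I}) \in s then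
    (fun j => w' (existT J i j) t) else 0)) => [|t]; last exact: WE.
  case: ((i : {classic I}) \in s); last exact: lcomb0.
  apply/funext => j; rewrite lcomb_fun; have [w'R _] := w'P (existT J i j); exact: w'R.
move=> t tx; apply: fsum_separated => i; rewrite WE; case: ifPn => is_.
  by apply/funext => j; have [_ ->] := w'P (existT J i j).
by rewrite sP.
Qed.

(** The direct sum X is pure in the full product P: the truncation [tau s] is a linear map P -> X
    that fixes any finitely many given elements of X for suitable s. As X is compact, these
    truncations yield a retraction P -> X. *)
Lemma fsum_power_Prod : Prod C X.
Proof.
pose P : lmodType A := {i & J i} -> C.
pose iota : {linear X -> P} := ltuple (fun u : {i & J i} => eval_at (projT2 u) \o fsum_proj F (projT1 u)).
pose tau (s : seq {classic I}) (y : P) : X := fsum_of s (fun i j => y (existT J i j)).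
have tau_linear s : linear (tau s).
  move=> a x y; rewrite /tau /fsum_of scaler_sumr -big_split; apply: eq_bigr => i _.
  exact: (linearP (fsum_inj _ i) a (fun j => x (existT J i j)) (fun j => y (existT J i j))).
have iotai : injective iota.
  move=> x y e; apply: fsum_separated => i; apply/funext => j.
  exact: (congr1 (fun f : P => f (existT J i j)) e).
have tauK s x : uniq s -> (forall i, (i : {classic I}) \notin s -> fsum_proj _ i x = 0) ->
    tau s (iota x) = x.
  move=> us xs; apply: fsum_separated => i; rewrite fsum_proj_of //.
  by case: ifPn => [_|/xs->]; first exact/funext.
have /choice[v vE] : forall y : P, exists x : X, forall x', iota x' = y -> x = x'.
  move=> y; have [[x xy]|nx] := EM (exists x, iota x = y); last first.
    by exists 0 => x xy; case: nx; exists x.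
  by exists x => x' x'y; apply: iotai; rewrite xy.
apply/ProdP; exists {i & J i}.
have [R RR|r [rR rD]] := chain_condition_compact fsum_power_chain_condition
    (Rel := fun e => lcomb e id = 0 :> P) (D := fun y => exists x, iota x = y) (v := v).
  pose ys := [seq u.2 | u <- flatten R].
  have [s us sP] : exists2 s : seq {classic I}, uniq s & forall x i, iota x \in ys ->
      (i : {classic I}) \notin s -> fsum_proj _ i x = 0.
    elim: (ys) => [|y ys' [s us sP]]; first by exists [::].
    have [[x xy]|nx] := EM (exists x, iota x = y); last first.
      exists s => // x i; rewrite inE => /orP[/eqP xy|]; last exact: sP.
      by case: nx; exists x.
    have [s' us' xE] := fsum_expand x; exists (undup (s ++ s')); first exact: undup_uniq.
    move=> x' i; rewrite inE mem_undup mem_cat negb_or => /orP[/eqP x'y|x'ys] /andP[is_ is'].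
      have -> : x' = x by apply: iotai; rewrite x'y.
      by rewrite xE fsum_proj_of // (negbTE is').
    exact: sP.
  pose w y := if `[< exists x, iota x = y >] then v y else tau s y.
  exists w; split=> [e eR|y Dy]; last by rewrite /w; case: asboolP.
  rewrite (@eq_in_lcomb _ _ _ _ _ (linear_of (tau_linear s) \o id)) => [|y ye].
    by rewrite lcomb_linear RR ?linear0.
  rewrite /w; case: asboolP => // -[x xy] /=.
  rewrite (vE y x xy) -xy tauK // => i; apply: sP; rewrite xy.
  by have /mapP[u ue ->] := ye; apply: map_f; apply/flattenP; exists e.
exists iota, (linear_of (all_relations_linear rR)) => x /=.
by rewrite rD; [rewrite (vE _ x)|exists x].
Qed.

End Powers.

(** The sum of the canonical embeddings has its middle term in Prod(C) by [fsum_power_Prod] and its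
    cokernel in the same invariant class. *)
Lemma fsum_Ybar F : (forall (J : Type) n, Ext_vanish C n (J -> C)) ->
  (forall i, Ybar C (F i)) -> Ybar C (fsum F).
Proof.
move=> Cself YF.
pose G X := exists F : I -> lmodType A, X = fsum F /\ forall i, Ybar C (F i).
apply: (@Ybar_coind _ _ G); last by exists F.
move=> {F YF} _ [F [-> YF]]; split=> [n|].
  by apply: fsum_Ext_vanish => i; apply: Ybar_Ext (YF i).
have se i := coker_short_exact (Ybar_hull_injective Cself (YF i)).
have [fs [gs [se' _ _]]] := fsum_short_exact se.
exists (fsum (fun i => hull C (F i))), (fsum (fun i => cohull C (F i))), fs, gs; split=> //.
  exact: fsum_power_Prod.
by exists (fun i => cohull C (F i)); split=> // i; apply: Ybar_cohull (YF i).
Qed.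

End FamilySumClosure.

(** * Small pure quotients *)

Section PureSubmodules.
Variable A : pzRingType.
Implicit Types L M N : lmodType A.

Definition submodule M (K : M -> Prop) :=
  K 0 /\ forall a x y, K x -> K y -> K (a *: x + y).

(** The criterion by finite systems; the right-hand sides are not named, they are the values of S at
    a solution w in M. *)
Definition pure_submodule M (K : M -> Prop) := submodule K /\
  forall (S : seq (seq (A * nat))) (w : nat -> M),
  (forall k, (k < size S)%N -> K (lcomb (nth [::] S k) w)) ->
  exists u : nat -> M, (forall i, K (u i)) /\
    forall k, (k < size S)%N -> lcomb (nth [::] S k) u = lcomb (nth [::] S k) w.

Section Closed.
Variables (M : lmodType A) (K : M -> Prop).
Hypothesis Ksub : submodule K.

Lemma submodule_lcomb T (e : seq (A * T)) (v : T -> M) : (forall t, K (v t)) -> K (lcomb e v).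
Proof.
move=> Kv; elim: e => [|u e IHe]; first by rewrite lcomb_nil; apply: Ksub.1.
by rewrite lcomb_cons; apply: Ksub.2.
Qed.

Lemma quotient_ex : exists (L : lmodType A) (q : {linear M -> L}),
  (forall z, exists y, q y = z) /\ forall x, q x = 0 <-> K x.
Proof.
have [i iE] := freemod_lift (fun x : {x : M | K x} => sval x).
exists (coker i), (coker_proj i); split=> [|x]; first exact: coker_proj_surj.
split=> [/coker_proj0[p <-]|Kx]; last first.
  by apply/coker_proj0; exists (fgen A (exist _ x Kx)); rewrite iE.
have [e ->] := freemod_span p; rewrite -lcomb_linear; apply: submodule_lcomb => t /=.
by rewrite iE; apply: (svalP (t : {x | K x})).
Qed.

End Closed.

Section Quotient.
Variables (M L : lmodType A) (K : M -> Prop) (q : {linear M -> L}).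
Hypotheses (Kpure : pure_submodule K) (qs : forall z, exists y, q y = z).
Hypothesis qK : forall x, q x = 0 <-> K x.

(** An arbitrary section violates the relations of R by elements of K; a solution in K of the system
    with these right-hand sides is subtracted from it. *)
Lemma pure_submodule_epi : pure_epi q.
Proof.
move=> R RR; have /choice[s sE] := qs.
pose ls := undup [seq u.2 | u <- flatten R].
pose S := [seq [seq (u.1, index u.2 ls) | u <- e] | e <- R].
pose w i := s (nth 0 ls i).
have lsE e t : e \in R -> t \in [seq u.2 | u <- e] -> nth 0 ls (index t ls) = t.
  move=> eR /mapP[u ue ->]; rewrite nth_index // mem_undup; apply: map_f.
  by apply/flattenP; exists e.
have wE e : e \in R -> lcomb [seq (u.1, index u.2 ls) | u <- e] w = lcomb e s.
  move=> eR; rewrite (lcomb_map (index^~ ls)); apply: eq_in_lcomb => t te /=.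
  by rewrite /w (lsE e).
have [k|u [uK uE]] := Kpure.2 S w.
  rewrite size_map => kR; rewrite (nth_map [::]) // wE ?mem_nth //; apply/qK.
  rewrite -lcomb_linear -[RHS](RR (nth [::] R k)) ?mem_nth //.
  by apply: eq_lcomb => l /=.
exists (fun l => s l - u (index l ls)); split=> [l|e eR].
  by rewrite linearB sE ((qK _).2 (uK _)) subr0.
rewrite lcombB -(wE e eR) -[X in _ - X]/(lcomb e (u \o index^~ ls)) -(lcomb_map (index^~ ls)).
have := uE (index e R); rewrite size_map index_mem => /(_ eR).
by rewrite (nth_map [::]) ?index_mem // nth_index // => ->; rewrite subrr.
Qed.

(** A system is first solved modulo K; the defect of a lifted solution lies in K and is corrected
    there. *)
Lemma pure_submodule_preimage (K1 : L -> Prop) :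
  pure_submodule K1 -> pure_submodule (K1 \o q).
Proof.
move=> [[K10 K1lin] K1p]; split.
  by split=> [|a x y]; rewrite /= ?linear0 // linearP; apply: K1lin.
move=> S w Sw; have [k kS|u1 [u1K u1E]] := K1p S (q \o w).
  by rewrite lcomb_linear; apply: Sw.
have /choice[u uE] : forall i, exists y, q y = u1 i by move=> i; apply: qs.
have [k kS|v [vK vE]] := Kpure.2 S (fun i => w i - u i).
  apply/qK; rewrite lcombB linearB -lcomb_linear -lcomb_linear -(u1E k kS).
  by apply/eqP; rewrite subr_eq0; apply/eqP/eq_lcomb => i /=; rewrite uE.
exists (fun i => u i + v i); split=> [i|k kS] /=.
  by rewrite linearD uE ((qK _).2 (vK i)) addr0.
by rewrite lcombD vE // lcombB addrC subrK.
Qed.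

End Quotient.
End PureSubmodules.

(* Names for the elements of a submodule that is generated by one element and *)
(* closed under solving systems: LX is the generator and LSk S r k the k-th   *)
(* coordinate of a solution of S with right-hand sides named by r.            *)
Inductive lam (A : pzRingType) : Type :=
  | LX
  | LLin of A & lam A & lam A
  | LSk of seq (seq (A * nat)) & (nat -> lam A) & nat.
Arguments LX {A}.

(** What a copy of a submodule must reproduce: which names denote old elements, the linear relations
    between names, and the values of the map to M0. It depends on A and M0 alone, so the type of
    trees is independent of the module being bounded. *)
Record label (A : pzRingType) (M0 : Type) := Label {
  lab_old : lam A -> Prop;
  lab_rel : A -> lam A -> lam A -> lam A -> Prop;
  lab_val : lam A -> M0
}.

(* Names for the elements of a subset that contains a copy of every such      *)
(* submodule, over each of its own small subsets; trees are what bounds the   *)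
(* size of that subset.                                                       *)
Inductive tree (A : pzRingType) (M0 : Type) : Type :=
  | TNil
  | TSat of label A M0 & (lam A -> tree A M0) & lam A.
Arguments TNil {A M0}.

Section BicanElBashir.
Variables (A : pzRingType) (M0 N : lmodType A) (f : {linear N -> M0}).

Definition realizes (t : label A M0) (e b : lam A -> N) :=
  [/\ forall l, lab_old t l -> b l = e l,
      forall a l m n, lab_rel t a l m n <-> b n = a *: b l + b m
    & forall l, f (b l) = lab_val t l].

Fixpoint tree_val (t : tree A M0) : N :=
  match t with
  | TNil => 0
  | TSat lab e l =>
      if pselect (exists b, realizes lab (fun m => tree_val (e m)) b) is left h
      then sval (cid h) l else 0
  end.

Definition in_tree x := exists t, tree_val t = x.

Lemma realizes_tree lab (e : lam A -> tree A M0) (b : lam A -> N) :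
  realizes lab (tree_val \o e) b ->
  exists b', realizes lab (tree_val \o e) b' /\ forall l, in_tree (b' l).
Proof.
move=> rb; exists (fun l => tree_val (TSat lab e l)).
rewrite /=; case: pselect => [h|[]]; last by exists b.
split; first exact: (svalP (cid h)).
move=> l; exists (TSat lab e l) => /=.
by case: pselect => // h'; rewrite (Prop_irrelevance h h').
Qed.

Section Span.
Variable x : N.

(** Solvability up to errors d named by trees. The submodule and its copy agree on such errors,
    which therefore cancel in the differences. *)
Definition solves (S : seq (seq (A * nat))) (c : nat -> N) (w : nat -> N) :=
  exists d : nat -> N, (forall k, in_tree (d k)) /\
    forall k, (k < size S)%N -> lcomb (nth [::] S k) w = c k - d k.

Fixpoint lam_val (l : lam A) : N :=
  match l with
  | LX => x
  | LLin a l m => a *: lam_val l + lam_val m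
  | LSk Sy r k => if pselect (exists w, solves Sy (fun k => lam_val (r k)) w) is left h
                 then sval (cid h) k else 0
  end.

Lemma solves_lam S (r : nat -> lam A) w : solves S (lam_val \o r) w ->
  exists u : nat -> lam A, solves S (lam_val \o r) (lam_val \o u).
Proof.
move=> sw; exists (LSk S r).
have -> : lam_val \o LSk S r = fun k => lam_val (LSk S r k) by [].
rewrite /=; case: pselect => [h|[]]; last by exists w.
exact: (svalP (cid h)).
Qed.

Definition lam_zero : lam A := LLin (-1) LX LX.

Fixpoint lam_comb T (e : seq (A * T)) (v : T -> lam A) : lam A :=
  if e is u :: e' then LLin u.1 (v u.2) (lam_comb e' v) else lam_zero.

End Span.

(* If x is not named by a tree, then the submodule B of the elements that lam *)
(* names has a copy B' among the elements named by trees, which agrees with B *)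
(* on those; {b - b'} is pure and is killed by f, but x - x' <> 0.            *)
Lemma tree_val_surjective :
  (forall K : N -> Prop, pure_submodule K -> (forall x, K x -> f x = 0) ->
     forall x, K x -> x = 0) ->
  forall x, in_tree x.
Proof.
move=> noK x; apply: contrapT => xD.
pose b := lam_val x.
have /choice[e eE] : forall l, exists t, in_tree (b l) -> tree_val t = b l.
  move=> l; have [[t tE]|nt] := EM (in_tree (b l)); first by exists t.
  by exists TNil.
pose lab := Label (fun l => in_tree (b l)) (fun a l m n => b n = a *: b l + b m) (f \o b).
have [|b' [[b'old b'rel b'val] b'D]] := @realizes_tree lab e b.
  by split=> // l /eE /= ->.
have b'E l : in_tree (b l) -> b' l = b l by move=> lD; rewrite b'old //= eE.
have b'lin a l m : b' (LLin a l m) = a *: b' l + b' m by apply/b'rel.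
have b'eq l m : b l = b m -> b' l = b' m.
  move=> lm; have : b' l = 0 *: b' l + b' m by apply/b'rel; rewrite /= scale0r add0r.
  by rewrite scale0r add0r.
have b0 : b lam_zero = 0 by rewrite /b /= scaleN1r addNr.
have b'0 : b' lam_zero = 0 by rewrite b'lin scaleN1r addNr.
have bcomb T (c : seq (A * T)) v : b (lam_comb c v) = lcomb c (b \o v).
  by elim: c => [|u c IHc]; rewrite ?lcomb_nil // lcomb_cons -IHc.
have b'comb T (c : seq (A * T)) v : b' (lam_comb c v) = lcomb c (b' \o v).
  by elim: c => [|u c IHc]; rewrite ?lcomb_nil // lcomb_cons -IHc b'lin.
have xb' : x <> b' LX by move=> xE; apply: xD; rewrite xE.
pose K y := exists l, y = b l - b' l.
apply: xb'; apply/eqP; rewrite -subr_eq0; apply/eqP; apply: (noK K); last by exists LX.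
  split.
    split; first by exists lam_zero; rewrite b0 b'0 subrr.
    move=> a _ _ [l ->] [m ->]; exists (LLin a l m).
    by rewrite b'lin /b /= scalerBr opprD addrACA.
  move=> S w Sw.
  have /choice[r rE] : forall k, exists l, (k < size S)%N ->
      lcomb (nth [::] S k) w = b l - b' l.
    move=> k; have [kS|kS] := boolP (k < size S)%N; last by exists LX.
    by have [l lE] := Sw k kS; exists l.
  have [u [d [dD uE]]] : exists u, solves S (b \o r) (b \o u).
    apply: (solves_lam (w := w)); exists (b' \o r); split=> [k|k kS]; first exact: b'D.
    exact: rE.
  exists (fun i => b (u i) - b' (u i)); split=> [i|k kS]; first by exists (u i).
  pose c := nth [::] S k.
  (* [m] names the error of the k-th equation; its value [d k] is old, so b and [b'] take the same
     value at m. *)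
  pose m := LLin (-1) (lam_comb c u) (r k).
  have bm : b m = d k by rewrite /b /= -/b bcomb uE //= scaleN1r opprB addrNK.
  have : b' m = b m by apply: b'E; rewrite bm.
  rewrite b'lin b'comb bm scaleN1r => dE.
  rewrite rE // lcombB -/c -[X in X - _]/(lcomb c (b \o u)) uE //= -dE.
  by rewrite opprD opprK addrA addrAC addrK.
by move=> _ [l ->]; rewrite linearB b'val subrr.
Qed.

End BicanElBashir.

(** L is the quotient by a maximal pure submodule inside the kernel of f. A nonzero pure submodule
    of L killed by g would enlarge it, so [tree_val_surjective] bounds L by trees. *)
Lemma small_pure_quotient (A : pzRingType) (M0 M : lmodType A) (f : {linear M -> M0}) :
  exists (L : lmodType A) (q : {linear M -> L}) (g : {linear L -> M0}) (t : tree A M0 -> L),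
  [/\ pure_epi q, forall x, g (q x) = f x & forall l, exists u, t u = l].
Proof.
(* Zorn's lemma is applied to sets, with the empty chain included; adding 0 lets the empty set stand
   for the zero submodule. *)
pose add0 (K : set M) x := K x \/ x = 0.
pose P (K : set M) := pure_submodule (add0 K) /\ forall x, K x -> f x = 0.
have [K [[Kp Kf] Kmax]] : exists K, P K /\ forall B, K `<` B -> ~ P B.
  apply: Zorn_bigcup => F FP Ftot; split; last by move=> x [K FK Kx]; apply: (FP K FK).2.
  have fin n (x : nat -> M) : (forall k, (k < n)%N -> add0 (\bigcup_(K in F) K) (x k)) ->
      (exists2 K, F K & forall k, (k < n)%N -> add0 K (x k)) \/
      (forall k, (k < n)%N -> x k = 0).
    elim: n => [|n IHn] xU; first by right.
    have [[K FK Kx]|x0] := IHn (fun k kn => xU k (ltnW kn)).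
      have [[K' FK' K'x]|x0] := xU n (ltnSn n); last first.
        left; exists K => // k; rewrite ltnS leq_eqVlt => /orP[/eqP->|/Kx//].
        by right.
      have [KK'|K'K] := Ftot _ _ FK FK'; left.
        exists K' => // k; rewrite ltnS leq_eqVlt => /orP[/eqP->|/Kx[/KK'|]]; by [left|right].
      exists K => // k; rewrite ltnS leq_eqVlt => /orP[/eqP->|/Kx//].
      by left; apply: K'K.
    have [[K FK Kx]|xn0] := xU n (ltnSn n); [left|right].
      exists K => // k; rewrite ltnS leq_eqVlt => /orP[/eqP->|/x0]; by [left|right].
    by move=> k; rewrite ltnS leq_eqVlt => /orP[/eqP->|/x0].
  have sub K : F K -> add0 K `<=` add0 (\bigcup_(K in F) K).
    by move=> FK x [Kx|->]; [left; exists K|right].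
  split.
    split=> [|a x y Ux Uy]; first by right.
    have [k|[K FK KP]|P0] := fin 2%N (fun k => if k is 0 then x else y).
    - by case: k.
    - apply: (sub K FK); apply: (FP K FK).1.1.2; [exact: (KP 0%N)|exact: (KP 1%N)].
    - have /= -> := P0 0%N isT; have /= -> := P0 1%N isT.
      by right; rewrite scaler0 addr0.
  move=> S w Sw; have [[K FK KP]|P0] := fin (size S) (fun k => lcomb (nth [::] S k) w) Sw.
    have [u [uK uE]] := (FP K FK).1.2 S w KP.
    by exists u; split=> // i; apply: (sub K FK).
  exists (fun=> 0); split=> [i|k kS]; first by right.
  by rewrite P0 // lcomb0.
have [L [q [qs qK]]] := quotient_ex Kp.1.
have [g gE] : exists g : {linear L -> M0}, forall x, g (q x) = f x.
  by apply: factor_surjective => // y /qK[/Kf|->]; rewrite ?linear0.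
exists L, q, g, (@tree_val A M0 L g); split=> //; first exact: pure_submodule_epi Kp qs qK.
apply: tree_val_surjective => K1 K1p K1g x K1x.
have [y yx] := qs x; rewrite -yx; apply/qK; apply: contrapT => nKy.
apply: (Kmax (K1 \o q)).
  split=> [z Kz|sub]; first by rewrite /= (qK z).2; [exact: K1p.1.1|left].
  by apply: nKy; left; apply: sub; rewrite /= yx.
split; last by move=> z K1z; rewrite -gE; apply: K1g.
have -> : add0 (K1 \o q) = K1 \o q.
  apply/seteqP; split=> z; last by left.
  by move=> [//|->]; rewrite /= linear0; apply: K1p.1.1.
exact: pure_submodule_preimage Kp qs qK _ K1p.
Qed.

(** * Wakamatsu cotilting modules and resolving classes *)

Section YbarPrecovering.
Variables (A : pzRingType) (C : lmodType A).
Hypothesis Cself : forall (I : Type) n, Ext_vanish C n (I -> C).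
Hypothesis cc : chain_condition C.

(** Any map X -> M0 from a member of Ybar C factors through a pure quotient L, again in Ybar C and
    with generators indexed by trees over M0. Presentations on these generators with a map to M0
    form a set I, and the direct sum over I is the precover. *)
Lemma Ybar_precovering : precovering (Ybar C).
Proof.
move=> M0; pose T := {classic tree A M0}.
pose I := {p : (seq (A * T) -> Prop) * (T -> M0) | satisfies p.1 p.2 /\ Ybar C (pres p.1)}.
pose F (i : I) : lmodType A := pres (sval i).1.
have /choice_dep[g gE] : forall i : I, exists g : {linear F i -> M0},
    forall t, g (pgen (sval i).1 t) = (sval i).2 t.
  by move=> i; apply: pres_lift; case: (svalP i).
exists (fsum F); first by apply: (fsum_Ybar cc Cself) => i; case: (svalP i).
have [phi phiE] := fsum_lift g; exists phi => X h YX.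
have [L [q [f [t [qp fE ts]]]]] := small_pure_quotient h.
pose Rel (e : seq (A * T)) := lcomb e (t : T -> L) = 0.
have [k kE] := @pres_lift A T Rel L t (fun e => id).
have [l lE] : exists l : {linear L -> pres Rel}, forall p, l (k p) = (idfun : {linear pres Rel -> pres Rel}) p.
  apply: factor_surjective => [y|p].
    by have [u <-] := ts y; exists (pgen Rel u).
  have [e ->] := pres_span p; rewrite -lcomb_linear => e0.
  apply: pgen_satisfies; rewrite /Rel -[RHS]e0; apply: eq_lcomb => u /=.
  by rewrite kE.
have kl y : k (l y) = y.
  by have [u <-] := ts y; rewrite -kE lE.
have Rv : satisfies Rel (f \o t) /\ Ybar C (pres Rel).
  split; first by move=> e e0; rewrite lcomb_linear e0 linear0.
  apply: (Ybar_iso Cself (N := L)); first by exists k, l.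
  exact: Ybar_pure_quotient cc qp YX.
pose i : I := exist _ (Rel, f \o t) Rv.
exists (fsum_inj F i \o (l \o q)) => x /=; rewrite phiE -fE.
rewrite -[in RHS](kl (q x)); move: (l _) => p.
apply: (@pres_eq A T Rel M0 (g i) (f \o k)) => u /=.
by rewrite (gE i) kE.
Qed.

End YbarPrecovering.

Section CoefficientSequences.
Variable A : pzRingType.
Implicit Types K M N X Y : lmodType A.

(** This lemma and [Ext1_zero_coeff_kernel] come from the exact sequence Hom(M, X) -> Hom(M, N) ->
    Ext^1(M, K) -> Ext^1(M, X) in the second variable, at its second and third terms. *)
Lemma Ext1_zero_lift K X N M (i : {linear K -> X}) (p : {linear X -> N}) (a : {linear M -> N}) :
  short_exact i p -> Ext1_zero K M -> exists k : {linear M -> X}, forall x, p (k x) = a x.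
Proof.
move=> se E; have [Y [j [q [b [se' bj pb _ _]]]]] := pullback_short_exact a se.
have [r rj] := E _ _ _ _ se' idfun.
have [_ pi _ _] := (short_exactP _ _).1 se.
have [_ qj qex qs] := (short_exactP _ _).1 se'.
have [k kE] : exists k : {linear M -> X}, forall y, k (q y) = (b \- (i \o r)) y.
  apply: factor_surjective => // y /qex[x <-] /=.
  by rewrite bj rj subrr.
exists k => x; have [y <-] := qs x.
by rewrite kE /= linearB pi subr0.
Qed.

Lemma Ext1_zero_coeff_kernel K Y N X (i : {linear K -> Y}) (p : {linear Y -> N}) :
  short_exact i p -> Ext1_zero Y X ->
  (forall h : {linear X -> N}, exists k : {linear X -> Y}, forall x, p (k x) = h x) ->
  Ext1_zero K X.
Proof.
move=> /short_exactP[ii pi ex ps] E lft U V u v se h.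
have [k kE] := E _ _ _ _ se (i \o h).
have [_ vu uex vs] := (short_exactP _ _).1 se.
have [a aE] : exists a : {linear X -> N}, forall y, a (v y) = (p \o k) y.
  by apply: factor_surjective => // y /uex[x <-]; rewrite /= kE /= pi.
have [l lE] := lft a.
have [m mE] : exists m : {linear V -> K}, forall y, i (m y) = (k \- (l \o v)) y.
  by apply: lift_injective => // y; apply: ex; rewrite /= linearB lE aE subrr.
by exists m => x; apply: ii; rewrite mE /= vu linear0 subr0 kE.
Qed.

Lemma Ext1_zero_injective K M : injective_module K -> Ext1_zero K M.
Proof. by move=> Ki U V u v [ui _ _] h; apply: Ki. Qed.

Lemma Prod_power_Prod (C D : lmodType A) (I : Type) : Prod C D -> Prod C (I -> D).
Proof.
move=> /ProdP[J [s [r rs]]]; apply/ProdP; exists (I * J)%type.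
exists (ltuple (fun u => eval_at u.2 \o (s \o eval_at u.1))).
exists (ltuple (fun i => r \o ltuple (fun j => eval_at (i, j)))) => x.
apply/funext => i; rewrite -[RHS]rs; congr (r _); exact/funext.
Qed.

Lemma ker_retract K M N (i : {linear K -> M}) (p : {linear M -> N}) :
  injective i -> (forall x, p (i x) = 0) -> (forall y, p y = 0 -> exists x, i x = y) ->
  retract (ker p) K.
Proof.
move=> ii pi ex.
have [s sE] : exists s : {linear ker p -> K}, forall x, i (s x) = ker_incl p x.
  by apply: lift_injective => // x; apply/ex/ker_incl0.
have [r rE] : exists r : {linear K -> ker p}, forall x, ker_incl p (r x) = i x.
  apply: lift_injective; first exact: ker_incl_inj.
  by move=> x; apply: ker_inclP.
by exists s, r => x; apply: (@ker_incl_inj _ _ _ p); rewrite rE sE.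
Qed.

End CoefficientSequences.

(** * From Wakamatsu cotilting modules to resolving classes *)

Section WakamatsuToResolving.
Variables (A : pzRingType) (C : lmodType A).
Hypothesis pc : product_complete C.
Hypothesis wc : Wakamatsu_cotilting C.
Implicit Types K M N P Q X : lmodType A.

Let cc : chain_condition C := chase pc.

Lemma Wakamatsu_self (I : Type) n : Ext_vanish C n (I -> C).
Proof. by apply/Ext_zeroP; apply: wc.1. Qed.

(* The kernels in the Prod(C)-resolution of the cogenerator Q. Ext^1(-, K i)  *)
(* vanishes on projectives, and this property passes to M' = coker(M -> hull  *)
(* of M) and makes M cogenerated by C.                                        *)
Lemma Wakamatsu_kernels : exists (Q : lmodType A) (K D : nat -> lmodType A)
    (i0 : {linear K 0%N -> D 0%N}) (p0 : {linear D 0%N -> Q})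
    (i : forall n, {linear K n.+1 -> D n.+1}) (p : forall n, {linear D n.+1 -> K n}),
  [/\ cogenerator Q, short_exact i0 p0, forall n, short_exact (i n) (p n),
      forall n, Prod C (D n) & forall n X, Prod C X -> Ext1_zero (K n) X].
Proof.
have [_ [Q [_ Qc [D [f0 [f [[/range_surj f0s /exactP[f00 f01] fex] PD E0 E1]]]]]]] := wc.
pose K n : lmodType A := if n is m.+1 then ker (f m) else ker f0.
have /choice_dep[p pP] : forall n, exists p : {linear D n.+1 -> K n}, short_exact (ker_incl (f n)) p.
  case=> [|n].
    have [p pE] : exists p : {linear D 1%N -> ker f0}, forall x, ker_incl f0 (p x) = f 0%N x.
      apply: lift_injective; first exact: ker_incl_inj.
      by move=> x; apply: ker_inclP.
    exists p; apply/short_exactP; split; first exact: ker_incl_inj.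
    - by move=> x; apply: (@ker_incl_inj _ _ _ f0); rewrite pE ker_incl0 linear0.
    - by move=> y py; apply: ker_inclP; rewrite -pE py linear0.
    - move=> z; have [y yE] := f01 _ (ker_incl0 z); exists y.
      by apply: (@ker_incl_inj _ _ _ f0); rewrite pE.
  have /exactP[fn0 fn1] := fex n.
  have [p pE] : exists p : {linear D n.+2 -> ker (f n)}, forall x, ker_incl (f n) (p x) = f n.+1 x.
    apply: lift_injective; first exact: ker_incl_inj.
    by move=> x; apply: ker_inclP.
  exists p; apply/short_exactP; split; first exact: ker_incl_inj.
  - by move=> x; apply: (@ker_incl_inj _ _ _ (f n)); rewrite pE ker_incl0 linear0.
  - by move=> y py; apply: ker_inclP; rewrite -pE py linear0.
  - move=> z; have [y yE] := fn1 _ (ker_incl0 z); exists y.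
    by apply: (@ker_incl_inj _ _ _ (f n)); rewrite pE.
exists Q, K, D, (ker_incl f0), f0, (fun n => ker_incl (f n)), p; split=> //.
  exact: ker_short_exact.
by case=> [|n] X PX; apply/Ext1_zeroP; [apply: E0|apply: E1].
Qed.

Lemma Ybar_projective P : projective P -> Ybar C P.
Proof.
move=> Pp; have [Q [K [D [i0 [p0 [i [p [Qc se0 se PD EK]]]]]]]] := Wakamatsu_kernels.
(* Maps from M to the cogenerator Q lift to [D 0], so M embeds in a power of [D 0], a module of
   Prod(C). *)
have inj M : (forall n, Ext1_zero (K n) M) -> injective (hull_map C M).
  move=> EM; have [I [f fi]] := Qc M.
  have /choice[k kE] : forall a : I, exists k : {linear M -> D 0%N}, forall x, p0 (k x) = f x a.
    by move=> a; apply: (Ext1_zero_lift (eval_at a \o f) se0).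
  apply: (@hull_map_injective _ C (I -> D 0%N) M (ltuple k)); first exact: Prod_power_Prod.
  move=> x y e; apply: fi; apply/funext => a; rewrite -!kE; congr (p0 _).
  exact: (congr1 (fun g => g a) e).
have stp M : (forall n, Ext1_zero (K n) M) -> forall n, Ext1_zero (K n) (cohull C M).
  move=> EM n; apply: (Ext1_zero_coker (coker_short_exact (inj M EM))).
    exact/EK/Prod_hull.
  (* A map to [K n] lifts to [D n.+1] because Ext^1(M, [K n.+1]) = 0, and the lift extends to the
     hull. Each step consumes one kernel, whence the condition for all n. *)
  move=> h; have [k kE] := Ext1_zero_lift h (se n) (EM n.+1).
  have [l lE] := extends_Prod (PD n.+1) (@hull_map_extends A C M) k.
  by exists (p n \o l) => x; rewrite /= lE kE.
apply/(Ybar_hullP Wakamatsu_self); split=> n; first exact: Ext_vanish_projective.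
have : forall n, Ext1_zero (K n) P by move=> m; apply: Ext1_zero_projective.
elim: n (P) => [|n IHn] M EM /=; first exact: inj.
exact/IHn/stp.
Qed.

Lemma Ybar_precovering_resolving : precovering_resolving (Ybar C).
Proof.
have self := Wakamatsu_self.
split.
- by move=> M N /iso_sym MN; apply: Ybar_iso.
- exact: Ybar_precovering.
- split.
  + by move=> M N /summandP; apply: Ybar_retract.
  + by move=> L M N f g se; apply: Ybar_ext se.
  + by move=> L M N f g se; apply: Ybar_kernel se.
  + exact: Ybar_projective.
Qed.

Lemma Ybar_cogenerator : Ext_injective_cogenerator (Ybar C) C.
Proof.
have self := Wakamatsu_self.
split=> [||M YM]; first exact/Ybar_Prod/Prod_self.
  by move=> X [//|n] YX _; apply/Ext_zeroP; apply: Ybar_Ext.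
have [_ [P [N [f [g [se PP YN]]]]]] := YbarE self YM.
by exists P, N, f, g.
Qed.

End WakamatsuToResolving.

(** * Injective cogenerators *)

Section DivisibleExtension.
Variables (N D : zmodType).
Implicit Types (G : set (N * D)) (x y : N) (c d : D).
Hypothesis Ddiv : forall n d, (0 < n)%N -> exists c, c *+ n = d.

(** The graph of an additive map from a subgroup of N to D; Zorn's lemma will run over such
    graphs. *)
Definition graph G := [/\ G (0, 0), forall x d y c, G (x, d) -> G (y, c) -> G (x - y, d - c)
  & forall d, G (0, d) -> d = 0].

Section Graph.
Variable G : set (N * D).
Hypothesis Gg : graph G.

Lemma graphN x d : G (x, d) -> G (- x, - d).
Proof. by move: Gg => [G0 GB _] /(GB _ _ _ _ G0); rewrite !sub0r. Qed.

Lemma graphD x d y c : G (x, d) -> G (y, c) -> G (x + y, d + c).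
Proof.
by move: Gg => [_ GB _] Gx /graphN Gy; rewrite -[y]opprK -[c]opprK; apply: GB.
Qed.

Lemma graph_fun x d c : G (x, d) -> G (x, c) -> d = c.
Proof.
move: Gg => [_ GB G0] Gd Gc; apply/eqP; rewrite -subr_eq0; apply/eqP/G0.
by rewrite -(subrr x); apply: GB.
Qed.

Lemma graph_nat x d n : G (x, d) -> G (x *+ n, d *+ n).
Proof.
move=> Gx; elim: n => [|n IHn]; first by case: Gg.
by rewrite !mulrS; apply: graphD.
Qed.

Lemma graph_int x d (n : int) : G (x, d) -> G (x *~ n, d *~ n).
Proof.
case: n => n Gx; first exact: graph_nat.
by rewrite !NegzE !mulrNz; apply/graphN/graph_nat.
Qed.

Definition adjoin x c : set (N * D) :=
  [set u | exists y d (n : int), [/\ G (y, d), u.1 = y + x *~ n & u.2 = d + c *~ n]].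

Lemma adjoin_graph x c : (forall (n : int) d, G (x *~ n, d) -> d = c *~ n) -> graph (adjoin x c).
Proof.
move=> xc; split.
- by exists 0, 0, 0; rewrite /= !mulr0z !addr0; case: Gg.
- move=> _ _ _ _ [y [d [n [Gy /= -> ->]]]] [y' [d' [n' [Gy' /= -> ->]]]].
  exists (y - y'), (d - d'), (n - n'); rewrite /= !mulrzBr !opprD !(addrACA _ (_ *~ _)).
  by split=> //; case: Gg => _ GB _; apply: GB.
- move=> d [y [e [n [Gy /= yx ->]]]].
  have -> : e = - (c *~ n); last exact: addNr.
  have yE : x *~ n = - y by apply/eqP; rewrite -addr_eq0 addrC -yx.
  by rewrite -(xc n (- e)) ?opprK // yE; apply: graphN.
Qed.

Lemma adjoin_sub x c : G `<=` adjoin x c.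
Proof. by move=> [y d] Gy; exists y, d, 0; rewrite /= !mulr0z !addr0. Qed.

Lemma adjoin_in x c : adjoin x c (x, c).
Proof. by exists 0, 0, 1; rewrite /= !add0r; split=> //; case: Gg. Qed.

End Graph.

Lemma int_subgroup (H : int -> Prop) : H 0 -> (forall m n, H m -> H n -> H (m - n)) ->
  exists d : nat, H d /\ forall n, H n -> exists q, n = q * d%:Z.
Proof.
move=> H0 HB.
have HN n : H n -> H (- n) by move=> /(HB _ _ H0); rewrite sub0r.
have HD m n : H m -> H n -> H (m + n) by move=> Hm /HN Hn; rewrite -[n]opprK; apply: HB.
have HM (q n : int) : H n -> H (q * n).
  move=> Hn; have Hnat (k : nat) : H (k%:Z * n).
    elim: k => [|k IHk]; first by rewrite mul0r.
    by rewrite intS mulrDl mul1r; apply: HD.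
  by case: q => k; rewrite ?NegzE ?mulNr; [apply: Hnat|apply/HN/Hnat].
have [[k [k0 Hk]]|nH] := EM (exists k : nat, (0 < k)%N /\ H k); last first.
  exists 0%N; split=> // n Hn; exists 0; rewrite mul0r.
  apply: contrapT => n0; apply: nH; exists `|n|%N; rewrite absz_gt0; split; first exact/eqP.
  by case: (n) Hn => m //= Hm; rewrite NegzE in Hm; move/HN: Hm; rewrite opprK.
have ex : exists k : nat, (0 < k)%N && `[< H k >] by exists k; rewrite k0; apply/asboolP.
case: (ex_minnP ex) => d /andP[d0 /asboolP Hd] dmin.
exists d; split=> // n Hn; exists (n %/ d)%Z; apply/eqP; rewrite -subr_eq0 -[_ - _]/(n %% d)%Z.
have r0 : (0 <= (n %% d)%Z)%R by apply: modz_ge0; rewrite -lt0n.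
have rd : ((n %% d)%Z < d)%R by apply: ltz_pmod.
have Hr : H (n %% d)%Z by apply: (HB n) => //; apply: HM.
case: (n %% d)%Z r0 rd Hr => // r _ rd Hr.
have [-> //|rn0] := eqVneq r 0%N.
have := dmin r; rewrite lt0n rn0 /=; case: asboolP => // _ /(_ isT).
by rewrite leqNgt -ltz_nat rd.
Qed.

(** The n with n x in the domain form a subgroup k Z. The value at x is a k-th part of the value at
    k x, or 0 if k = 0. *)
Lemma adjoin_ex G x : graph G -> exists c, forall (n : int) d, G (x *~ n, d) -> d = c *~ n.
Proof.
move=> Gg; have [||k [[e Ge] kP]] := @int_subgroup (fun n => exists d, G (x *~ n, d)).
- by exists 0; case: Gg.
- move=> m n [d Gd] [c Gc]; exists (d - c); rewrite mulrzBr.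
  by case: Gg => _ GB _; apply: GB.
have [k0|k0] := posnP k.
  exists 0 => n d Gd; have [|q nE] := kP n; first by exists d.
  by move: Gd; rewrite mul0rz nE k0 mulr0 mulr0z; case: Gg => _ _; apply.
have [c cE] := Ddiv e k0; exists c => n d Gd.
have [|q nE] := kP n; first by exists d.
apply: (graph_fun Gg Gd); rewrite nE mulrC !mulrzA; apply: (graph_int Gg).
by rewrite -[c *~ k%:Z]/(c *+ k) cE.
Qed.

Lemma graph_extends G0 : graph G0 -> exists f : N -> D,
  (forall x y, f (x - y) = f x - f y) /\ forall x d, G0 (x, d) -> f x = d.
Proof.
move=> G0g; pose P G := graph (G `|` G0).
have [G [PG Gmax]] : exists G, P G /\ forall B, G `<` B -> ~ P B.
  apply: Zorn_bigcup => F FP Ftot.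
  have [[G1 FG1]|F0] := EM (exists G, F G); last first.
    have -> : P (\bigcup_(X in F) X) = P set0; last by rewrite /P set0U.
    by congr P; apply/seteqP; split=> // u [G FG _]; case: F0; exists G.
  have two u v : (\bigcup_(X in F) X `|` G0) u -> (\bigcup_(X in F) X `|` G0) v ->
      exists G, [/\ F G, (G `|` G0) u & (G `|` G0) v].
    move=> [[G FG Gu]|Gu] [[H FH Hv]|Hv].
    - have [GH|HG] := Ftot _ _ FG FH.
        by exists H; split=> //; left=> //; apply: GH.
      by exists G; split=> //; left=> //; apply: HG.
    - by exists G; split=> //; [left|right].
    - by exists H; split=> //; [right|left].
    - by exists G1; split=> //; right.
  split.
  - by right; case: G0g.
  - move=> x d y c Ux Uy; have [G [FG Gx Gy]] := two _ _ Ux Uy.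
    have [_ GB _] := FP G FG; have [?|?] := GB _ _ _ _ Gx Gy; last by right.
    by left; exists G.
  - move=> d Ud; have [G [FG Gd _]] := two _ _ Ud Ud.
    by have [_ _ Gz] := FP G FG; apply: Gz.
have tot x : exists d, (G `|` G0) (x, d).
  apply: contrapT => nx; have [c cP] := adjoin_ex x PG.
  apply: (Gmax (adjoin (G `|` G0) x c)).
    split=> [u Gu|sub]; first by apply: adjoin_sub; left.
    by apply: nx; exists c; left; apply: sub; apply: (adjoin_in PG).
  rewrite /P (_ : _ `|` G0 = adjoin (G `|` G0) x c); first exact: (adjoin_graph PG).
  apply/seteqP; split=> u; last by left.
  by move=> [//|G0u]; apply: adjoin_sub; right.
have /choice[f fE] := tot; exists f; split=> [x y|x d G0x].
  apply: (graph_fun PG (fE _)); have [_ GB _] := PG; exact: GB.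
by apply: (graph_fun PG (fE _)); right.
Qed.

End DivisibleExtension.

Section InjectiveCogenerator.

(** The group is Q/Z. The class of 1/k is killed by k; for k = 0, the case of infinite order, the
    class of 1/2 serves as a nonzero element. *)
Lemma divisible_cogenerator : exists D : zmodType,
  (forall n (d : D), (0 < n)%N -> exists c, c *+ n = d) /\
  (forall k : nat, k != 1%N -> exists c : D, c <> 0 /\ c *+ k = 0).
Proof.
pose K (x : zmodule rat) := exists z : int, x = z%:~R :> rat.
have Ksub : submodule K.
  split=> [|a x y [z ->] [t ->]]; first by exists 0.
  by exists (z * a + t); rewrite -[LHS]/((z%:~R : rat) *~ a + t%:~R) intrD intrM mulrzr.
have [D [q [qs qK]]] := quotient_ex Ksub.
exists D; split=> [n d n0|k k1].
  have [x <-] := qs d; exists (q (x / n%:R : rat)).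
  rewrite -raddfMn; congr (q _); rewrite -[LHS]mulr_natr divfK //.
  by rewrite Num.Theory.pnatr_eq0 -lt0n.
have half : exists c : D, c <> 0 /\ (k = 0%N \/ c *+ k = 0).
  have [->|k0] := eqVneq k 0%N.
    exists (q (2%:R^-1 : rat)); split; last by left.
    move=> /qK[z zE]; have : (z * 2)%:~R = 1%:~R :> rat.
      by rewrite intrM -zE mulVf.
    by move=> /intr_inj; case: z {zE} => // -[|[|n]].
  exists (q (k%:R^-1 : rat)); split; last first.
    right; rewrite -raddfMn; apply/qK; exists 1.
    by rewrite -[LHS]mulr_natr mulVf // Num.Theory.pnatr_eq0.
  move=> /qK[z zE]; have : (z * k)%:~R = 1%:~R :> rat.
    by rewrite intrM -zE mulVf // Num.Theory.pnatr_eq0.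
  move=> /intr_inj zk; have := congr1 absz zk; rewrite abszM /= => /eqP.
  by rewrite muln_eq1 (negbTE k1) andbF.
have [c [c0 ck]] := half; exists c; split=> //.
by case: ck => [->|//].
Qed.

Variables (A : pzRingType) (D : zmodType).
Hypothesis Ddiv : forall n (d : D), (0 < n)%N -> exists c, c *+ n = d.
Hypothesis Dcog : forall k : nat, k != 1%N -> exists c : D, c <> 0 /\ c *+ k = 0.

Definition addfunp : {pred A -> D} :=
  [pred h | `[< forall x y, h (x - y) = h x - h y >]].

Lemma addfunp_closed : zmod_closed addfunp.
Proof.
split=> [|g h]; rewrite !unfold_in /=.
  by apply/asboolP => x y; rewrite subr0.
move=> /asboolP gB /asboolP hB; apply/asboolP => x y.
by rewrite -![(g - h) _]/(g _ - h _) gB hB !opprD opprK addrACA.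
Qed.
HB.instance Definition _ := GRing.isZmodClosed.Build (A -> D) addfunp addfunp_closed.

(* Hom_Z(A, D), with the left action of A that comes from right               *)
(* multiplication on A.                                                       *)
Definition coind := {h : A -> D | h \in addfunp}.
HB.instance Definition _ := SubChoice.on coind.
HB.instance Definition _ := [SubChoice_isSubZmodule of coind by <:].

Lemma coindB (h : coind) x y : val h (x - y) = val h x - val h y.
Proof. by have := valP h; rewrite unfold_in => /asboolP. Qed.

Lemma coindD (h : coind) x y : val h (x + y) = val h x + val h y.
Proof.
have h0 : val h 0 = 0 by have := coindB h 0 0; rewrite !subrr.
have hN : val h (- y) = - val h y by rewrite -[- y]sub0r coindB h0 sub0r.
by rewrite -[in LHS](opprK y) coindB hN opprK.
Qed.

Lemma coind_ex (h : A -> D) : (forall x y, h (x - y) = h x - h y) ->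
  exists g : coind, forall x, val g x = h x.
Proof.
move=> hB; have hp : h \in addfunp by rewrite unfold_in; apply/asboolP.
by exists (exist _ h hp).
Qed.

Lemma coind_scale_ex (a : A) (h : coind) : exists g : coind, forall x, val g x = val h (x * a).
Proof. by apply: coind_ex => x y; rewrite mulrBl coindB. Qed.

Definition coind_scale (a : A) (h : coind) : coind := sval (cid (coind_scale_ex a h)).

Lemma coind_scaleE a h x : val (coind_scale a h) x = val h (x * a).
Proof. exact: (svalP (cid (coind_scale_ex a h)) x). Qed.

Lemma coind_eq (g h : coind) : (forall x, val g x = val h x) -> g = h.
Proof. by move=> gh; apply: val_inj; apply/funext. Qed.

Lemma coind_scaleA a b h : coind_scale a (coind_scale b h) = coind_scale (a * b) h.
Proof. by apply: coind_eq => x; rewrite !coind_scaleE mulrA. Qed.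
Lemma coind_scale1 : left_id 1 coind_scale.
Proof. by move=> h; apply: coind_eq => x; rewrite coind_scaleE mulr1. Qed.
Lemma coind_scaleDr : right_distributive coind_scale +%R.
Proof. by move=> a g h; apply: coind_eq => x; rewrite coind_scaleE -[RHS]/(_ + _) !coind_scaleE. Qed.
Lemma coind_scaleDl h : {morph coind_scale^~ h : a b / a + b}.
Proof.
move=> a b; apply: coind_eq => x.
by rewrite coind_scaleE mulrDr coindD -[RHS]/(_ + _) !coind_scaleE.
Qed.
HB.instance Definition _ := GRing.Zmodule_isLmodule.Build A coind
  coind_scaleA coind_scale1 coind_scaleDr coind_scaleDl.

Lemma coind_hom (M : lmodType A) (f : M -> D) : (forall x y, f (x - y) = f x - f y) ->
  exists k : {linear M -> coind}, forall m x, val (k m) x = f (x *: m).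
Proof.
move=> fB; have fD x y : f (x + y) = f x + f y.
  have f0 : f 0 = 0 by have := fB 0 0; rewrite !subrr.
  have fN : f (- y) = - f y by rewrite -[- y]sub0r fB f0 sub0r.
  by rewrite -[in LHS](opprK y) fB fN opprK.
have /choice[k kE] : forall m : M, exists h : coind, forall x, val h x = f (x *: m).
  by move=> m; apply: coind_ex => x y; rewrite scalerBl fB.
suff kl : linear k by exists (linear_of kl).
move=> a m n; apply: coind_eq => x.
rewrite kE -[RHS]/(val (coind_scale a (k m)) x + val (k n) x) coind_scaleE !kE.
by rewrite scalerDr fD scalerA.
Qed.

(** By adjunction a linear map to [coind] amounts to an additive map to D, namely its value at 1,
    with [coind_hom] as the converse. Additive maps extend because D is divisible. *)
Lemma coind_injective : injective_module coind.
Proof.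
move=> M N g h gi.
pose G : set (N * D) := [set u | exists m, u.1 = g m /\ u.2 = val (h m) 1].
have hB m n x : val (h (m - n)) x = val (h m) x - val (h n) x by rewrite linearB.
have [|f [fB fG]] := @graph_extends N D Ddiv G.
  split=> [|_ _ _ _ [m [/= -> ->]] [n [/= -> ->]]|d [m [/= m0 ->]]].
  - by exists 0; rewrite /= !linear0.
  - by exists (m - n); rewrite /= linearB hB.
  - have -> : m = 0 by apply: gi; rewrite linear0.
    by rewrite linear0.
have [k kE] := coind_hom fB; exists k => m; apply: coind_eq => x.
rewrite kE -linearZ (fG _ (val (h (x *: m)) 1)); last by exists (x *: m).
by rewrite linearZ -[LHS]/(val (coind_scale x (h m)) 1) coind_scaleE mul1r.
Qed.

(** An additive map on the cyclic group of m sends m to a nonzero c killed by the order k of m, with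
    k = 0 for infinite order; it extends to M by divisibility. *)
Lemma coind_separates (M : lmodType A) (m : M) : m <> 0 ->
  exists k : {linear M -> coind}, k m <> 0.
Proof.
move=> m0.
have [||k [mk kP]] := @int_subgroup (fun n => m *~ n = 0).
- by rewrite mulr0z.
- by move=> n p mn mp; rewrite mulrzBr mn mp subr0.
have [c [c0 ck]] : exists c : D, c <> 0 /\ c *+ k = 0.
  by apply: Dcog; apply/eqP => k1; apply: m0; move: mk; rewrite k1 mulr1z.
have triv : graph [set u : M * D | u = (0, 0)].
  split=> [//|_ _ _ _ [-> ->] [-> ->]|d [->]] //.
  by rewrite /= !subr0.
have mc : forall (n : int) d, [set u : M * D | u = (0, 0)] (m *~ n, d) -> d = c *~ n.
  move=> n d [mn ->]; have [q ->] := kP n mn.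
  by rewrite mulrC mulrzA -[c *~ k%:Z]/(c *+ k) ck mul0rz.
have [f [fB fG]] := graph_extends Ddiv (adjoin_graph triv mc).
have [g gE] := coind_hom fB; exists g => g0; apply: c0.
by rewrite -(fG m c (adjoin_in triv m c)) -[m]scale1r -gE g0.
Qed.

Lemma coind_cogenerator : cogenerator coind.
Proof.
move=> M; have /choice[k kE] : forall m : M, exists k : {linear M -> coind}, m <> 0 -> k m <> 0.
  move=> m; have [->|/eqP m0] := eqVneq m 0; first by exists (lzero _ _).
  by have [k km] := coind_separates m0; exists k.
exists M, (ltuple k); apply: linear_inj => m km; apply: contrapT => m0.
by apply: (kE m m0); apply: (congr1 (fun f => f m) km).
Qed.

End InjectiveCogenerator.

Lemma injective_cogenerator_ex (A : pzRingType) :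
  exists Q : lmodType A, injective_module Q /\ cogenerator Q.
Proof.
have [D [Ddiv Dcog]] := divisible_cogenerator.
by exists (coind A D); split; [apply: coind_injective|apply: coind_cogenerator].
Qed.

Section SumsAndDsum.
Variables (A : pzRingType) (J : Type) (C : lmodType A).

Lemma dsum_single (j : J) : exists k : {linear C -> dsum J C},
  forall x i, dsum_incl (k x) i = if (i : {classic J}) == j then x else 0.
Proof.
have /choice[k kE] : forall x : C, exists y : dsum J C,
    dsum_incl y = fun i => if (i : {classic J}) == j then x else 0.
  move=> x; apply: dsum_ex; apply: (@sub_finite_set _ _ [set j]); last exact: finite_set1.
  by move=> i /=; case: eqP.
suff kl : linear k by exists (linear_of kl) => x i; rewrite -[LHS]/(dsum_incl (k x) i) kE.
move=> a x y; apply: dsum_incl_inj; rewrite linearP !kE; apply/funext => i.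
rewrite -[RHS]/(a *: (if _ then _ else _) + (if _ then _ else _)).
by case: eqP => // _; rewrite scaler0 addr0.
Qed.

Lemma dsum_retract_fsum : retract (dsum J C) (fsum (fun _ : J => C)).
Proof.
have /choice[k kE] := dsum_single.
have [f fE] := fsum_lift k.
have fi p i : dsum_incl (f p) i = fsum_proj _ i p.
  apply: (@fsum_eq A J (fun=> C) C ((eval_at i \o dsum_incl) \o f) (fsum_proj _ i)) => j x /=.
  rewrite fE kE; case: eqP => [e|ne].
    by rewrite -[i]/(i : J) e fsum_proj_inj.
  by rewrite fsum_proj_inj0 // => ji; apply: ne.
apply/iso_retract/iso_sym; exists f.
have /choice[g gE] : forall y, exists p, f p = y.
  move=> y; have [s sE] : exists s : seq {classic J}, [set i | dsum_incl y i <> 0] = [set` s].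
    by apply/finite_seqP; apply: dsum_finite.
  exists (fsum_of (undup s) (dsum_incl y)); apply: dsum_incl_inj; apply/funext => i.
  rewrite fi fsum_proj_of ?undup_uniq // mem_undup; case: ifPn => // is_.
  apply/esym; apply: contrapT => yi; move/negP: is_; apply.
  have : [set i | dsum_incl y i <> 0] i by [].
  by rewrite sE.
exists g => [p|y]; last exact: gE.
by apply: fsum_separated => i; rewrite -!fi gE.
Qed.

End SumsAndDsum.

(** * From a class with Ext-injective cogenerator to a Wakamatsu cotilting module *)

Section CogeneratedToWakamatsu.
Variables (A : pzRingType) (C : lmodType A) (D : modclass A).
Hypotheses (pc : product_complete C) (Dpr : precovering_resolving D).
Hypothesis DC : Ext_injective_cogenerator D C.
Implicit Types K M N P Q X : lmodType A.

Lemma class_retract M N : retract M N -> D N -> D M.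
Proof. by have [_ _ [Ds _ _ _]] := Dpr; move=> /summandP; apply: Ds. Qed.

(** The inclusions of the summands lift to a precover Z of the sum, and together these lifts exhibit
    the sum as a retract of Z. *)
Lemma class_fsum (I : Type) (F : I -> lmodType A) : (forall i, D (F i)) -> D (fsum F).
Proof.
move=> DF; have [_ Dpre _] := Dpr.
have [Z DZ [phi phiP]] := Dpre (fsum F).
have /choice_dep[k kE] : forall i, exists k : {linear F i -> Z}, forall x, phi (k x) = fsum_inj F i x.
  by move=> i; apply: phiP.
have [l lE] := fsum_lift k.
apply: class_retract DZ; exists l, phi => p.
by apply: (@fsum_eq A I F _ (phi \o l) idfun) => i x /=; rewrite lE kE.
Qed.

Lemma class_Prod M : Prod C M -> D M.
Proof.
move=> /pc[J /summandP MJ]; have [DC0 _ _] := DC.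
by apply: class_retract (retract_trans MJ (dsum_retract_fsum J C)) _; apply: class_fsum.
Qed.

Lemma class_Ext n M : D M -> Ext_vanish C n M.
Proof. by move=> DM; apply/Ext_zeroP; have [_ Cr _] := DC; apply: Cr. Qed.

(** A precover Z -> K extends to a module P of Prod(C) containing Z, since P/Z is in the class and
    so orthogonal to K. The extension is onto because projectives are in the class, and maps X -> K
    still lift to it through Z, which gives the vanishing for its kernel. *)
Lemma class_cover K : (forall X, D X -> Ext1_zero K X) ->
  exists P (g : {linear P -> K}), [/\ Prod C P, forall z, exists y, g y = z &
    forall X, D X -> Ext1_zero (ker g) X].
Proof.
move=> EK; have [_ Dpre [_ _ _ Dproj]] := Dpr.
have [Z DZ [phi phiP]] := Dpre K.
have [_ _ /(_ Z DZ)[P [N [u [v [se PP DN]]]]]] := DC.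
have [g gE] := EK N DN _ _ _ _ se phi.
have gs z : exists y, g y = z.
  have [p ps] := freemod_cover K.
  have [k kE] := phiP _ p (Dproj _ (@freemod_projective A K)).
  by have [y yE] := ps z; exists (u (k y)); rewrite gE kE.
exists P, g; split=> // X DX.
apply: (Ext1_zero_coeff_kernel (ker_short_exact gs)).
  by apply: Ext1_zero_Prod PP _; apply: (class_Ext 0).
move=> h; have [k kE] := phiP X h DX.
by exists (u \o k) => x; rewrite /= gE kE.
Qed.

Lemma class_resolution Q : injective_module Q -> gen_star (Prod C) Q.
Proof.
move=> Qi.
have [Kn [Dn [pn [inn [K0 se PD EK]]]]] : exists (Kn Dn : nat -> lmodType A)
    (pn : forall n, {linear Dn n -> Kn n}) (inn : forall n, {linear Kn n.+1 -> Dn n}),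
    [/\ Kn 0%N = Q, forall n, short_exact (inn n) (pn n), forall n, Prod C (Dn n) &
        forall n X, D X -> Ext1_zero (Kn n) X].
  pose S := {K : lmodType A | forall X, D X -> Ext1_zero K X}.
  pose step (K : S) := {P : lmodType A & {K' : S & {p : {linear P -> sval K} &
    {i : {linear sval K' -> P} | short_exact i p /\ Prod C P}}}}.
  have st (K : S) : step K.
    apply: inhabited_witness; case: K => K EK.
    have [P [g [PP gs Eg]]] := class_cover EK.
    split; exists P, (exist _ (ker g : lmodType A) Eg), g, (ker_incl g); split=> //.
    exact: ker_short_exact.
  have EQ X : D X -> Ext1_zero Q X by move=> _; apply: Ext1_zero_injective.
  pose nx := fix nx n : S := if n is m.+1 then projT1 (projT2 (st (nx m))) else exist _ Q EQ.
  exists (fun n => sval (nx n)), (fun n => projT1 (st (nx n))).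
  exists (fun n => projT1 (projT2 (projT2 (st (nx n))))).
  exists (fun n => sval (projT2 (projT2 (projT2 (st (nx n)))))).
  split=> // n; last exact: (proj2_sig (nx n)).
    exact: (proj2_sig (projT2 (projT2 (projT2 (st (nx n)))))).1.
  exact: (proj2_sig (projT2 (projT2 (projT2 (st (nx n)))))).2.
subst Q.
have ex n := (short_exactP _ _).1 (se n).
have inn0 n x : inn n (pn n.+1 x) = 0 -> pn n.+1 x = 0.
  by have [ii _ _ _] := ex n; rewrite -{1}(linear0 (inn n)) => /ii.
exists Dn, (pn 0%N), (fun n => inn n \o pn n.+1); split=> //.
- split.
  + by apply: surj_range; have [_ _ _] := ex 0%N.
  + have [_ pi ei _] := ex 0%N; have [_ _ _ ps] := ex 1%N.
    apply/exactP; split=> [x|y /ei[x <-]] /=; first exact: pi.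
    by have [z <-] := ps x; exists z.
  + move=> n; have [_ pi ei _] := ex n.+1; have [_ _ _ ps] := ex n.+2.
    apply/exactP; split=> [x|y] /=; first by rewrite pi linear0.
    by move=> /inn0/ei[x <-]; have [z <-] := ps x; exists z.
- move=> X PX; apply/Ext1_zeroP; have [ii pi ei _] := ex 0%N.
  by apply: Ext1_zero_coeff_retract (ker_retract ii pi ei) _; apply/EK/class_Prod.
- move=> X n PX; apply/Ext1_zeroP; have [ii pi ei _] := ex n.+1.
  have r : retract (ker (inn n \o pn n.+1)) (Kn n.+2).
    apply: (@ker_retract _ _ _ _ (inn n.+1)) => // [x|y] /=; first by rewrite pi linear0.
    by move=> /inn0/ei.
  by apply: Ext1_zero_coeff_retract r _; apply/EK/class_Prod.
Qed.

Lemma class_Wakamatsu : Wakamatsu_cotilting C.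
Proof.
split=> [I [//|n] _|].
  by apply/Ext_zeroP/class_Ext/class_Prod/Prod_power.
have [Q [Qi Qc]] := injective_cogenerator_ex A.
by exists Q; split=> //; apply: class_resolution.
Qed.

Lemma class_sub_Ybar : subclass D (Ybar C).
Proof.
apply: Ybar_coind => M DM; split=> [n|]; first exact: class_Ext.
by have [_ _] := DC; apply.
Qed.

End CogeneratedToWakamatsu.

(** * Tensor products and the relation ~ *)

Section TensorTools.
Variables (S S' : pzRingType) (P : bimodule S S') (N : lmodType S').
Implicit Types (p q : P) (n : N) (t : tensor P N).

Definition ptensor p n : tensor P N := tclass [:: (p, n)].

Lemma formal_sum1 (G : zmodType) (b : P -> N -> G) p n : formal_sum b [:: (p, n)] = b p n.
Proof. exact: big_seq1. Qed.

Lemma ptensor_balanced : balanced ptensor.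
Proof.
by split=> *; apply/tclassP => G b [bD bDr bM];
  rewrite ?formal_sum_cat ?formal_sum_repr // !formal_sum1.
Qed.

Lemma ptensorDl p q n : ptensor (p + q) n = ptensor p n + ptensor q n.
Proof. by case: ptensor_balanced. Qed.
Lemma ptensorDr p m n : ptensor p (m + n) = ptensor p m + ptensor p n.
Proof. by case: ptensor_balanced. Qed.
Lemma ptensorM p s n : ptensor (ract p s) n = ptensor p (s *: n).
Proof. by case: ptensor_balanced. Qed.

Lemma ptensorZ a p n : a *: ptensor p n = ptensor (a *: p) n.
Proof.
apply/tclassP => G b bb; rewrite formal_sum_scale formal_sum_repr ?formal_sum1 //.
exact: balanced_scale.
Qed.

Lemma tclassE x : tclass x = \sum_(u <- x) ptensor u.1 u.2 :> tensor P N.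
Proof.
elim: x => [|[p n] x IHx]; first by rewrite big_nil.
rewrite big_cons -IHx; apply/tclassP => G b bb.
by rewrite formal_sum_cat !formal_sum_repr // -formal_sum_cat.
Qed.

Lemma tensor_sum t : t = \sum_(u <- repr t) ptensor u.1 u.2.
Proof. by rewrite -tclassE tclass_repr. Qed.

Lemma additive_sum (V W : zmodType) (f : V -> W) : (forall x y, f (x + y) = f x + f y) ->
  forall (I : Type) (r : seq I) (F : I -> V), f (\sum_(i <- r) F i) = \sum_(i <- r) f (F i).
Proof.
move=> fD; have f0 : f 0 = 0 by apply: (addrI (f 0)); rewrite -fD !addr0.
by move=> I r F; apply: big_morph.
Qed.

Lemma tensor_eq (G : zmodType) (f g : tensor P N -> G) :
  (forall x y, f (x + y) = f x + f y) -> (forall x y, g (x + y) = g x + g y) ->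
  (forall p n, f (ptensor p n) = g (ptensor p n)) -> f =1 g.
Proof.
move=> fD gD fg t; rewrite [t]tensor_sum !additive_sum //.
by apply: eq_bigr.
Qed.

Lemma tensor_lift (G : zmodType) (b : P -> N -> G) : balanced b ->
  exists f : tensor P N -> G, (forall x y, f (x + y) = f x + f y) /\
    forall p n, f (ptensor p n) = b p n.
Proof.
move=> bb; exists (fun t => formal_sum b (repr t)); split=> [x y|p n].
  by rewrite formal_sum_repr // formal_sum_cat.
by rewrite formal_sum_repr // formal_sum1.
Qed.

End TensorTools.

Lemma tensor_map_ptensor (S S' : pzRingType) (P : bimodule S S') (M N : lmodType S')
    (f : {linear M -> N}) (p : P) m :
  tensor_map P f (ptensor p m) = ptensor p (f m).
Proof.
apply/tclassP => G b bb; rewrite formal_sum_map formal_sum_repr ?formal_sum1 //.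
exact: balanced_map.
Qed.

Lemma tensor_end_scale_ptensor (A S : pzRingType) (T : lmodType A) (P : bimodule S (endo T))
    (r : A) (p : P) (t : T) :
  r *: (ptensor p (t : endmod T) : tensor_end P) = ptensor p (r *: t : endmod T).
Proof.
apply/tclassP => G b bb; rewrite formal_sum_end formal_sum_repr ?formal_sum1 //.
exact: balanced_end.
Qed.

Lemma natural_faithful (A B : pzRingType) (F : modfunctor A B) (G : modfunctor B A) :
  naturally_isomorphic (comp_functor G F) (id_functor A) ->
  forall (M N : lmodType A) (f g : {linear M -> N}), fmap F f =1 fmap F g -> f =1 g.
Proof.
move=> [eta [etab etan]] M N f g fg x.
have [eta' etaK etaK'] := etab M; rewrite -[x]etaK' -[LHS](etan M N f) -[RHS](etan M N g).
by rewrite /= (linear_eqP fg).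
Qed.

Lemma equivalence_full (A B : pzRingType) (F : modfunctor A B) : equivalence F ->
  forall (M N : lmodType A) (h : {linear F M -> F N}),
  exists f : {linear M -> N}, fmap F f =1 h.
Proof.
move=> [G [[eta [etab etan]] FG]] M N h.
have [eta' etaK etaK'] := etab M.
have el : linear eta'.
  by move=> a x y; rewrite -{1}[x]etaK' -{1}[y]etaK' -linearP etaK.
pose f : {linear M -> N} := eta N \o (fmap G h \o linear_of el).
exists f; apply: (natural_faithful FG) => x.
have [etaN' etaNK _] := etab N; apply: (can_inj etaNK).
by rewrite [LHS](etan M N f) /f /= etaK.
Qed.

(** The known notion is that T is a direct summand of a finite power of T'; the pairs are the
    components of inclusion and projection. *)
Definition finitely_retracts (A : pzRingType) (T T' : lmodType A) :=
  exists s : seq ({linear T -> T'} * {linear T' -> T}),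
    forall x, \sum_(u <- s) u.2 (u.1 x) = x.

Lemma finitely_retracts_refl (A : pzRingType) (T : lmodType A) : finitely_retracts T T.
Proof. by exists [:: ((idfun : {linear T -> T}), (idfun : {linear T -> T}))] => x; rewrite big_seq1. Qed.

Lemma finitely_retracts_trans (A : pzRingType) (T T' T'' : lmodType A) :
  finitely_retracts T T' -> finitely_retracts T' T'' -> finitely_retracts T T''.
Proof.
move=> [s sE] [r rE].
exists [seq ((v.1 \o u.1 : {linear T -> T''}), (u.2 \o v.2 : {linear T'' -> T})) |
  u : {linear T -> T'} * {linear T' -> T} <- s,
  v : {linear T' -> T''} * {linear T'' -> T'} <- r] => x.
rewrite big_allpairs_dep -[RHS]sE; apply: eq_bigr => u _.
by rewrite -[in RHS](rE (u.1 x)) linear_sum.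
Qed.

(* With P (x) Y = S, the S'-linear map h p : Y -> S' corresponds by fullness  *)
(* to S -> P, a |-> a p; its values on the components in Y of 1 are the       *)
(* coordinates of p.                                                          *)
Section DualBasis.
Variables (S S' : pzRingType) (P : bimodule S S').
Hypothesis Pinv : invertible P.

Lemma invertible_dual_basis : exists s : seq (P * (P -> S')),
  [/\ forall u p q, u \in s -> u.2 (p + q) = u.2 p + u.2 q,
      forall u p a, u \in s -> u.2 (ract p a) = u.2 p * a
    & forall p, \sum_(u <- s) ract u.1 (u.2 p) = p].
Proof.
have [G [GF [eps [epsb _]]]] := Pinv.
pose Y := G (S^o : lmodType S).
pose e : {linear tensor P Y -> S^o} := eps S^o.
have [e' _ eK'] : bijective e := epsb S^o.
have full := equivalence_full Pinv.
(* [e] identifies P (x) Y with S, and p (x) 1 represents p in P (x) S' = P. *)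
have /choice[h hE] : forall p, exists h : {linear Y -> S'^o},
    forall t, tensor_map P h t = (e t : S) *: (ptensor p (1 : S'^o)).
  move=> p; have hl : linear (fun t => (e t : S) *: (ptensor p (1 : S'^o)) : tensor P S'^o).
    by move=> a x y; rewrite linearP scalerDl scalerA.
  have [f fE] := full Y S'^o (linear_of hl).
  by exists f => t; apply: fE.
have hinj : forall f g : {linear Y -> S'^o}, tensor_map P f =1 tensor_map P g -> f =1 g.
  exact: (natural_faithful GF).
have tD (M N : lmodType S') (f : {linear M -> N}) (x y : tensor P M) :
    tensor_map P f (x + y) = tensor_map P f x + tensor_map P f y by rewrite linearD.
have hD p q y : h (p + q) y = h p y + h q y.
  apply: (hinj (h (p + q)) (h p \+ h q)) => t.
  have -> : tensor_map P (h p \+ h q) t = tensor_map P (h p) t + tensor_map P (h q) t.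
    apply: (@tensor_eq _ _ P Y _ (tensor_map P (h p \+ h q))
      (fun t => tensor_map P (h p) t + tensor_map P (h q) t)) => [x z|x z|r n].
    - exact: tD.
    - by rewrite !tD addrACA.
    - by rewrite !tensor_map_ptensor -ptensorDr.
  by rewrite !hE ptensorDl scalerDr.
have hM p a y : h (ract p a) y = (h p y : S') * a.
  have rl : linear (fun x : S'^o => (x : S') * a : S'^o).
    by move=> c x z; rewrite mulrDl; congr (_ + _); apply/esym/(mulrA c).
  apply: (hinj (h (ract p a)) (linear_of rl \o h p)) => t.
  rewrite (@tensor_map_comp S S' P _ _ _ (linear_of rl) (h p)) /= !hE linearZ /=.
  rewrite tensor_map_ptensor /= mul1r; congr (_ *: _).
  by rewrite ptensorM -[a *: _]/(a * 1) mulr1.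
have [|mu [muD muE]] := @tensor_lift S S' P S'^o P (fun p (a : S') => ract p a).
  split=> [p q a|p a b|p a b]; [exact: ractDl|exact: ractDr|].
  by rewrite -ractM.
pose t0 := e' (1 : S^o).
exists [seq (u.1, fun p => h p u.2 : S') | u <- repr t0].
split=> [_ p q /mapP[u _ ->]|_ p a /mapP[u _ ->]|p] /=; [exact: hD|exact: hM|].
(* [mu] is multiplication P (x) S' -> P. Applied to [h p] at t0, the element with [e t0 = 1], it
   returns p, while the components of t0 give the sum. *)
rewrite big_map /= -[RHS]ract1 -[RHS]muE -[X in _ = mu X]scale1r.
have <- : e t0 = 1 :> S by apply: eK'.
rewrite -hE {2}[t0]tensor_sum linear_sum /= additive_sum //.
by apply: eq_bigr => u _; rewrite tensor_map_ptensor muE.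
Qed.

End DualBasis.

(** The coordinate functions of a dual basis of P induce maps P (x) T' -> T', and the basis elements
    induce maps back; their composites sum to the identity. *)
Lemma wsim_finitely_retracts (A : pzRingType) (T T' : lmodType A)
    (P : bimodule (endo T) (endo T')) :
  invertible P -> iso T (tensor_end P) -> finitely_retracts T T'.
Proof.
move=> /invertible_dual_basis[s [sD sM sE]] /iso_retract[i [p ip]].
have cl q : linear (fun t : T' => ptensor q (t : endmod T') : tensor_end P).
  by move=> a x y; rewrite tensor_end_scale_ptensor -ptensorDr.
have /choice[d dE] : forall u : P * (P -> endo T'), exists d : {linear tensor_end P -> T'},
    u \in s -> forall q (t : T'), d (ptensor q (t : endmod T')) = (u.2 q : {linear T' -> T'}) t.
  move=> u; have [us|us] := boolP (u \in s); last by exists (lzero _ _).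
  have [|f [fD fE]] := @tensor_lift _ _ P (endmod T') T' (fun q t => (u.2 q : {linear T' -> T'}) t).
    split=> [q r t|q m n|q c t]; first by rewrite sD.
      by rewrite linearD.
    by rewrite sM.
  suff fl : linear (f : tensor_end P -> T') by exists (linear_of fl).
  move=> a x y; rewrite fD; congr (_ + _).
  apply: (@tensor_eq _ _ P (endmod T') _ (fun x => f ((a *: (x : tensor_end P)) : tensor_end P))
    (fun x => a *: f x)) => [u1 u2|u1 u2|q t].
  - by rewrite scalerDr fD.
  - by rewrite fD scalerDr.
  - by rewrite (tensor_end_scale_ptensor (T := T')) !fE linearZ.
exists [seq ((d u \o i : {linear T -> T'}), (p \o linear_of (cl u.1) : {linear T' -> T})) | u <- s] => x.
rewrite big_map /= -linear_sum -[RHS]ip; congr (p _).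
apply: (@tensor_eq _ _ P (endmod T') _ (fun y => \sum_(u <- s) (ptensor u.1 (d u y : endmod T')))
  id) => [y z|//|q t].
  by rewrite -big_split; apply: eq_bigr => u _; rewrite linearD ptensorDr.
rewrite -[in RHS](sE q).
have -> : ptensor (\sum_(u <- s) ract u.1 (u.2 q)) (t : endmod T') =
    \sum_(u <- s) ptensor (ract u.1 (u.2 q)) (t : endmod T').
  by apply: (additive_sum (f := fun r => ptensor r (t : endmod T'))) => r r'; rewrite ptensorDl.
rewrite !big_seq; apply: eq_bigr => u us.
by rewrite dE // ptensorM.
Qed.

Section HomBimodule.
Variables (A : pzRingType) (T T' : lmodType A).

Definition hom := {linear T -> T'}.
HB.instance Definition _ := gen_eqMixin hom.
HB.instance Definition _ := gen_choiceMixin hom.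

Implicit Types f g h : hom.

Let hom0 : hom := \0.
Let hom_opp f : hom := \- f.
Let hom_add f g : hom := f \+ g.

Let hom_addA : associative hom_add.
Proof. by move=> f g h; apply: linear_eqP => x /=; rewrite addrA. Qed.
Let hom_addC : commutative hom_add.
Proof. by move=> f g; apply: linear_eqP => x /=; rewrite addrC. Qed.
Let hom_add0 : left_id hom0 hom_add.
Proof. by move=> f; apply: linear_eqP => x /=; rewrite add0r. Qed.
Let hom_addN : left_inverse hom0 hom_opp hom_add.
Proof. by move=> f; apply: linear_eqP => x /=; rewrite addNr. Qed.
HB.instance Definition _ :=
  GRing.isZmodule.Build hom hom_addA hom_addC hom_add0 hom_addN.

Let hom_scale (s : endo T') f : hom := s \o f.

Let hom_scaleA s r f : hom_scale s (hom_scale r f) = hom_scale (s * r) f.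
Proof. exact: linear_eqP. Qed.
Let hom_scale1 : left_id 1 hom_scale.
Proof. by move=> f; apply: linear_eqP. Qed.
Let hom_scaleDr : right_distributive hom_scale +%R.
Proof. by move=> s f g; apply: linear_eqP => x /=; rewrite -linearD. Qed.
Let hom_scaleDl f : {morph hom_scale^~ f : s r / s + r}.
Proof. by move=> s r; apply: linear_eqP. Qed.
HB.instance Definition _ := GRing.Zmodule_isLmodule.Build (endo T') hom
  hom_scaleA hom_scale1 hom_scaleDr hom_scaleDl.

Let hom_ract f (s : endo T) : hom := f \o s.

Let hom_ractDl f g s : hom_ract (f + g) s = hom_ract f s + hom_ract g s.
Proof. exact: linear_eqP. Qed.
Let hom_ractDr f s r : hom_ract f (s + r) = hom_ract f s + hom_ract f r.
Proof. by apply: linear_eqP => x /=; rewrite -linearD. Qed.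
Let hom_ract1 f : hom_ract f 1 = f.
Proof. exact: linear_eqP. Qed.
Let hom_ractM f s r : hom_ract f (s * r) = hom_ract (hom_ract f s) r.
Proof. exact: linear_eqP. Qed.
Let hom_ractZ (a : endo T') f s : hom_ract (a *: f) s = a *: hom_ract f s.
Proof. exact: linear_eqP. Qed.

Definition hom_bimodule : bimodule (endo T') (endo T) :=
  Bimodule hom_ractDl hom_ractDr hom_ract1 hom_ractM hom_ractZ.

End HomBimodule.

Section HomInvertible.
Variables (A : pzRingType) (T T' : lmodType A).
Hypothesis TT' : finitely_retracts T T'.

Let P := hom_bimodule T T'.
Let Q := hom_bimodule T' T.

Let comp2 (q : Q) (p : P) : endo T := (q : {linear T' -> T}) \o (p : {linear T -> T'}).

(** The inverse sends m to the sum of u.2 (x) u.1 (x) m over the decomposition of the identity of T.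
    On q (x) p (x) m the composite of u.1 and q is an endomorphism of T', so it moves across the
    tensor sign. *)
Lemma hom_evaluation (M : lmodType (endo T)) : exists eta : {linear tensor Q (tensor P M) -> M},
  bijective eta /\ forall q p m, eta (ptensor q (ptensor p m)) = comp2 q p *: m.
Proof.
have /choice[b bP] : forall q : Q, exists b : tensor P M -> M,
    (forall x y, b (x + y) = b x + b y) /\ forall p m, b (ptensor p m) = comp2 q p *: m.
  move=> q; apply: tensor_lift; split=> [p r m|p m n|p s m].
  - rewrite -scalerDl; congr (_ *: _); apply: linear_eqP => x /=.
    by rewrite -linearD.
  - by rewrite scalerDr.
  - by rewrite scalerA; congr (_ *: _); apply: linear_eqP.
have [|eta [etaD etaE]] := @tensor_lift _ _ Q (tensor P M) M b.
  split=> [q r x|q x y|q s x].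
  - apply: (@tensor_eq _ _ P M _ (b (q + r)) (fun x => b q x + b r x)) => [y z|y z|p m].
    + exact: (bP _).1.
    + by rewrite !(bP _).1 addrACA.
    + by rewrite !(bP _).2 -scalerDl; congr (_ *: _); apply: linear_eqP.
  - exact: (bP _).1.
  - apply: (@tensor_eq _ _ P M _ (b (ract q s)) (fun x => b q (s *: x))) => [y z|y z|p m].
    + exact: (bP _).1.
    + by rewrite scalerDr (bP _).1.
    + by rewrite ptensorZ !(bP _).2; congr (_ *: _); apply: linear_eqP.
have etaP q p m : eta (ptensor q (ptensor p m)) = comp2 q p *: m.
  by rewrite etaE (bP _).2.
have etal : linear eta.
  move=> a x y; rewrite etaD; congr (_ + _).
  apply: (@tensor_eq _ _ Q (tensor P M) _ (fun x => eta (a *: x)) (fun x => a *: eta x)).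
  - by move=> u v; rewrite scalerDr etaD.
  - by move=> u v; rewrite etaD scalerDr.
  move=> q z; rewrite ptensorZ !etaE.
  apply: (@tensor_eq _ _ P M _ (b (a *: q)) (fun z => a *: b q z)) => [u v|u v|p m].
  - exact: (bP _).1.
  - by rewrite (bP _).1 scalerDr.
  - by rewrite !(bP _).2 scalerA; congr (_ *: _); apply: linear_eqP.
exists (linear_of etal); split=> //.
have [s sE] := TT'.
pose inv m : tensor Q (tensor P M) := \sum_(u <- s) ptensor (u.2 : Q) (ptensor (u.1 : P) m).
have invD m n : inv (m + n) = inv m + inv n.
  by rewrite /inv -big_split; apply: eq_bigr => u _; rewrite !ptensorDr.
exists inv => [x|m] /=.
  apply: (@tensor_eq _ _ Q (tensor P M) _ (inv \o eta) id) => // [u v|q z] /=.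
    by rewrite etaD invD.
  apply: (@tensor_eq _ _ P M _ (fun z => inv (eta (ptensor q z))) (ptensor q)) => [u v|u v|p m].
  - by rewrite ptensorDr etaD invD.
  - exact: ptensorDr.
  rewrite etaP /inv; transitivity (ptensor (\sum_(u <- s)
      ract (u.2 : Q) ((u.1 : {linear T -> T'}) \o (q : {linear T' -> T}) : endo T')) (ptensor p m)).
    rewrite (additive_sum (f := fun r : Q => ptensor r (ptensor p m))); last first.
      by move=> r r'; rewrite ptensorDl.
    apply: eq_bigr => u _; rewrite ptensorM ptensorZ -ptensorM; congr (ptensor _ (ptensor _ _)).
    exact: linear_eqP.
  congr (ptensor _ _); apply: linear_eqP => y.
  rewrite -[RHS]sE; elim: (s) => [|u r IHr]; first by rewrite !big_nil.
  by rewrite !big_cons -IHr.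
rewrite additive_sum // -[RHS]scale1r -[X in X *: _](_ : \sum_(u <- s) comp2 (u.2 : Q) (u.1 : P) = 1).
  by rewrite scaler_suml; apply: eq_bigr => u _; rewrite etaP.
apply: linear_eqP => y; rewrite -[RHS]sE.
elim: (s) => [|u r IHr]; first by rewrite !big_nil.
by rewrite !big_cons -IHr.
Qed.

Lemma hom_natural : naturally_isomorphic
  (comp_functor (tensor_functor Q) (tensor_functor P)) (id_functor (endo T)).
Proof.
exists (fun M => projT1 (cid (hom_evaluation M))).
split=> [M|M N f]; first by have [] := projT2 (cid (hom_evaluation M)).
have [_ eM] := projT2 (cid (hom_evaluation M)); have [_ eN] := projT2 (cid (hom_evaluation N)).
set etaM := projT1 (cid (hom_evaluation M)) in eM *.
set etaN := projT1 (cid (hom_evaluation N)) in eN *.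
apply: (@tensor_eq _ _ Q (tensor P M) _ (fun x => etaN (tensor_map Q (tensor_map P f) x))
  (fun x => f (etaM x))) => [u v|u v|q z]; rewrite ?linearD // tensor_map_ptensor.
apply: (@tensor_eq _ _ P M _ (fun z => etaN (ptensor q (tensor_map P f z)))
  (fun z => f (etaM (ptensor q z)))) => [u v|u v|p m].
- by rewrite linearD ptensorDr linearD.
- by rewrite ptensorDr !linearD.
- by rewrite tensor_map_ptensor eN eM linearZ.
Qed.

Lemma hom_tensor_iso : iso T (tensor_end Q).
Proof.
apply: iso_sym.
have [|f [fD fE]] := @tensor_lift _ _ Q (endmod T') T (fun q t => (q : {linear T' -> T}) t).
  by split=> [q r t|q t u|q s t] //; rewrite linearD.
have fl : linear (f : tensor_end Q -> T).
  move=> a x y; rewrite fD; congr (_ + _).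
  apply: (@tensor_eq _ _ Q (endmod T') _ (fun x => f ((a *: (x : tensor_end Q)) : tensor_end Q))
    (fun x => a *: f x)) => [u v|u v|q t].
  - by rewrite scalerDr fD.
  - by rewrite fD scalerDr.
  - by rewrite (tensor_end_scale_ptensor (T := T')) !fE linearZ.
exists (linear_of fl); have [s sE] := TT'.
pose inv x : tensor_end Q := \sum_(u <- s) ptensor (u.2 : Q) (u.1 x : endmod T').
have invD x y : inv (x + y) = inv x + inv y.
  by rewrite /inv -big_split; apply: eq_bigr => u _; rewrite linearD ptensorDr.
exists inv => [x|y] /=.
  apply: (@tensor_eq _ _ Q (endmod T') _ (inv \o f) id) => // [u v|q t] /=.
    by rewrite fD invD.
  rewrite fE /inv; transitivity (ptensor (\sum_(u <- s)
      ract (u.2 : Q) ((u.1 : {linear T -> T'}) \o (q : {linear T' -> T}) : endo T')) (t : endmod T')).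
    rewrite (additive_sum (f := fun r : Q => ptensor r (t : endmod T'))); last first.
      by move=> r r'; rewrite ptensorDl.
    by apply: eq_bigr => u _; rewrite ptensorM.
  congr (ptensor _ _); apply: linear_eqP => y.
  rewrite -[RHS]sE; elim: (s) => [|u r IHr]; first by rewrite !big_nil.
  by rewrite !big_cons -IHr.
rewrite additive_sum // -[RHS]sE; apply: eq_bigr => u _.
by rewrite fE.
Qed.

End HomInvertible.

(** Finite retractions in both directions make Hom(T', T) and Hom(T, T') mutually inverse, by
    evaluation on either side. *)
Lemma wsimP (A : pzRingType) (T T' : lmodType A) :
  wsim T T' <-> finitely_retracts T T' /\ finitely_retracts T' T.
Proof.
split=> [[[P [Pi TP]] [Q [Qi TQ]]]|[TT' T'T]].
  by split; apply: wsim_finitely_retracts; eassumption.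
have main (U U' : lmodType A) : finitely_retracts U U' -> finitely_retracts U' U ->
    exists P : bimodule (endo U) (endo U'), invertible P /\ iso U (tensor_end P).
  move=> UU' U'U; exists (hom_bimodule U' U); split; last exact: hom_tensor_iso.
  exists (tensor_functor (hom_bimodule U U')); split; exact: hom_natural.
by split; apply: main.
Qed.

(** * Comparison of Ybar for two modules, and the bijection *)

Section Comparison.
Variable A : pzRingType.
Implicit Types C M : lmodType A.

(** The images of finitely many generators have finite support, so finitely many copies of D
    suffice. *)
Lemma finitely_generated_dsum C D (J : Type) :
  finitely_generated C -> retract C (dsum J D) -> finitely_retracts C D.
Proof.
move=> [n [g gE]] [i [p ip]].
have [s us sP] : exists2 s : seq {classic J}, uniq s &
    forall x j, (j : {classic J}) \notin s -> dsum_incl (i x) j = 0.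
  have [s sE] : exists s : seq {classic J},
      \bigcup_(k in [set: 'I_n]) [set j | dsum_incl (i (g k)) j <> 0] = [set` s].
    by apply/finite_seqP; apply: bigcup_finite => // k _; apply: dsum_finite.
  exists (undup s) => [|x j]; first exact: undup_uniq.
  rewrite mem_undup => /negP js; have [c ->] := gE x.
  rewrite -[LHS]/((eval_at j \o dsum_incl \o i) _) linear_sum big1 // => k _.
  rewrite linearZ /=; have -> : dsum_incl (i (g k)) j = 0; last exact: scaler0.
  apply: contrapT => ne; apply: js.
  have : (\bigcup_(k in [set: 'I_n]) [set j | dsum_incl (i (g k)) j <> 0]) j by exists k.
  by rewrite sE.
have /choice[e eE] := @dsum_single A J D.
exists [seq ((eval_at (j : J) \o (dsum_incl \o i) : {linear C -> D}),
  (p \o e j : {linear D -> C})) | j <- s] => x.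
rewrite big_map /= -linear_sum -[RHS]ip; congr (p _).
apply: dsum_incl_inj; apply/funext => j; rewrite linear_sum.
rewrite -[LHS]/(eval_at j _) linear_sum /=.
have [js|js] := boolP ((j : {classic J}) \in s); last first.
  rewrite sP // (@big_seq _ _ _ {classic J}) big1 // => k ks; rewrite eE.
  by case: eqP => // jk; move: js; rewrite jk ks.
rewrite (@bigD1_seq _ _ _ {classic J} _ (j : {classic J})) //= eE eqxx big1 ?addr0 // => k kj.
by rewrite eE eq_sym (negbTE kj).
Qed.

Lemma finitely_retracts_Prod C D : finitely_retracts C D -> Prod D C.
Proof.
move=> [s sE]; apply/ProdP; exists 'I_(size s).
pose u := tnth (in_tuple s).
exists (ltuple (fun k => (u k).1)).
have pl : linear (fun y : 'I_(size s) -> D => \sum_k (u k).2 (y k)).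
  move=> a x y; rewrite scaler_sumr -big_split; apply: eq_bigr => k _.
  exact: (linearP (u k).2 a (x k) (y k)).
exists (linear_of pl) => x; rewrite -[RHS]sE.
by rewrite [RHS](big_tnth _ _ s).
Qed.

Lemma Prod_trans C D M : Prod D C -> Prod C M -> Prod D M.
Proof. by move=> DC /ProdP[I r]; apply: Prod_retract r _; apply: Prod_power_Prod. Qed.

Lemma Ybar_Prod_sub C D : Prod D C -> Prod C D -> subclass (Ybar C) (Ybar D).
Proof.
move=> DC CD M [/lperpP EM [C_ [f_ [f [ex PC E0 E1]]]]]; split.
  by apply/lperpP => n; apply: Ext_vanish_Prod CD _.
have E N : Ext_zero 1 N C -> Ext_zero 1 N D.
  by move=> /Ext1_zeroP E; apply/Ext1_zeroP; apply: Ext1_zero_Prod CD E.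
exists C_, f_, f; split=> //; last 2 first.
- exact: E.
- by move=> i; apply: E.
- by move=> i; apply: Prod_trans DC _.
Qed.

Lemma modclass_eq (D E : modclass A) : subclass D E -> subclass E D -> D = E.
Proof. by move=> DE ED; apply/funext => M; apply/propext; split; [apply: DE|apply: ED]. Qed.

Lemma wsim_Ybar C D : wsim C D -> Ybar C = Ybar D.
Proof.
by move=> /wsimP[/finitely_retracts_Prod CD /finitely_retracts_Prod DC];
  apply: modclass_eq; apply: Ybar_Prod_sub.
Qed.

Lemma wsim_refl C : wsim C C.
Proof. by apply/wsimP; split; apply: finitely_retracts_refl. Qed.

Lemma wsim_class_eq C D : wsim C D -> wsim_class C = wsim_class D.
Proof.
move=> /wsimP[CD DC]; apply: modclass_eq => M /wsimP[a b]; apply/wsimP.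
  split; [exact: finitely_retracts_trans DC a|exact: finitely_retracts_trans b CD].
split; [exact: finitely_retracts_trans CD a|exact: finitely_retracts_trans b DC].
Qed.

Lemma Ybar_finitely_retracts C D :
  finitely_generated C -> product_complete C -> Wakamatsu_cotilting C ->
  product_complete D -> Wakamatsu_cotilting D ->
  Ybar C = Ybar D -> finitely_retracts C D.
Proof.
move=> fgC pC wC pD wD e.
have [YC _ _] := Ybar_cogenerator wC.
have [_ _ cog] := Ybar_cogenerator wD.
have [|P [N [f [g [se PP YN]]]]] := cog C; first by rewrite -e.
have [r rf] : exists r : {linear P -> C}, forall x, r (f x) = x.
  have EN : Ext1_zero C N by apply: (Ybar_Ext (Wakamatsu_self wC) 0); rewrite e.
  exact: (EN _ _ _ _ se idfun).
have CP : Prod D C by apply: (Prod_retract _ PP); exists f, r.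
have [J /summandP CJ] := pD C CP.
exact: finitely_generated_dsum fgC CJ.
Qed.

End Comparison.

Theorem theorem1p3 (R : pzRingType) :
  exists F : modclass R^c -> modclass R^c,
    (forall C : rmodType R,
       finitely_generated C -> product_complete C -> Wakamatsu_cotilting C ->
       F (wsim_class C) = Ybar C) /\
    bijection_on (@wcotilting_classes R^c) (@maximal_cogenerated R^c) F.
Proof.
(* K does not single out a representative, so F takes the union of Ybar over all of them; equivalent
   modules have the same Ybar. *)
pose F (K : modclass R^c) : modclass R^c := fun M => exists C : rmodType R,
  [/\ finitely_generated C, product_complete C, Wakamatsu_cotilting C & K = wsim_class C]
  /\ Ybar C M.
have FE (C : rmodType R) : finitely_generated C -> product_complete C ->
    Wakamatsu_cotilting C -> F (wsim_class C) = Ybar C.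
  move=> fC pC wC; apply: modclass_eq => M.
    move=> [D [[fD pD wD e] YM]].
    have CD : wsim C D.
      by rewrite -[wsim C D]/(wsim_class C D) e; apply: wsim_refl.
    by rewrite (wsim_Ybar CD).
  by move=> YM; exists C; split.
exists F; split=> //; split.
- move=> _ [C [fC pC wC ->]]; rewrite FE //; split; first exact: Ybar_precovering_resolving.
  exists C; split=> //; first exact: Ybar_cogenerator.
  (* Every competing class is contained in Ybar C, so Ybar C is even the largest. *)
  move=> E Epr EC sub; apply: modclass_eq => //; exact: class_sub_Ybar EC.
- move=> _ _ [C [fC pC wC ->]] [D [fD pD wD ->]]; rewrite !FE // => e.
  apply: wsim_class_eq; apply/wsimP; split.
    exact: Ybar_finitely_retracts e.
  exact: Ybar_finitely_retracts (esym e).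
- move=> E [Epr [C [fC pC EC Emax]]].
  have wC : Wakamatsu_cotilting C by apply: class_Wakamatsu Epr EC.
  exists (wsim_class C); first by exists C.
  rewrite FE //; apply/esym/Emax; first exact: Ybar_precovering_resolving.
    exact: Ybar_cogenerator.
  exact: class_sub_Ybar EC.
Qed.
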